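(* Let $S\subset\mathbb{R}^4$ be a compact flat rectangular surface and let $\sigma:I^2=[0,1]^2\to\mathbb{R}^4$ be a parametrization of $S$. For $\kappa>0$ let $(\mathbb{B},\tilde\mu_{\kappa^2})$ be the Wiener probability space with variance $1/\kappa^2$ described in the context (the construction for the abelian gauge group $\mathrm{U}(1)$). Then for every $\kappa>0$ $$\int_{B\in\mathbb{B}}\exp\left[i\sum_{0\le a<b\le 3}\int_{I^2}\frac{\kappa^2}{4}|J^\sigma_{ab}|(s,t)\left(B,\xi_{ab}(\kappa\sigma(s,t)/2)\right)_\sharp\,ds\,dt\right]d\tilde\mu_{\kappa^2}(B)=\exp\left[-\frac12\left\Vert\sum_{0\le a<b\le 3}\int_{I^2}\frac{\kappa}{4}|J^\sigma_{ab}|(s,t)\,\xi_{ab}(\kappa\sigma(s,t)/2)\,ds\,dt\right\Vert^2\right],$$ and as $\kappa\to\infty$ this quantity converges to $$\exp\left[-\frac18\int_S d\rho\right],\qquad \int_S d\rho:=\sum_{0\le a<b\le 3}\int_{I^2}\rho_\sigma^{ab}(s,t)\,|J_{ab}^\sigma|(s,t)\,ds\,dt .$$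
   Context: **Hilbert spaces.** $H^2(\mathbb{C}^4)$ is the real vector space of polynomials with real coefficients in $z=(z_0,z_1,z_2,z_3)$, with inner product $\langle f,g\rangle=\pi^{-4}\int_{\mathbb{C}^4}f\,\overline{g}\,e^{-\sum_{i=0}^3|z_i|^2}\,d\mathrm{Leb}$. For multi-indices $p=(i,j,k,l)\in(\mathbb{N}\cup\{0\})^4$ put $z^p=z_0^iz_1^jz_2^kz_3^l$, $p!=i!j!k!l!$; the $z^p/\sqrt{p!}$ form an orthonormal basis. $\mathcal{H}^2(\mathbb{C}^4)$ is its Hilbert space completion. $H^2(\mathbb{C}^3)$ is the subspace of polynomials in $(z_1,z_2,z_3)$. **Operator $\mathfrak{d}_0$.** $\mathfrak{d}_0$ is the linear operator with $\mathfrak{d}_0[z_0^nz_1^jz_2^kz_3^l]=\left(\frac n2z_0^{n-1}-\frac12z_0^{n+1}\right)z_1^jz_2^kz_3^l$, applied termwise to power series. **Banach spaces.** For $f=\sum_pc_pz^p/\sqrt{p!}$ set $|f|:=\sup_{z\in B(0,1/2)}\sum_p|c_p||z^p|$, where $B(0,1/2)$ is the open ball of radius $1/2$ about $0$ in $\mathbb{C}^4$. $B(\mathbb{C}^4)$ is the completion of $\mathcal{H}^2(\mathbb{C}^4)$ in $|\cdot|$ (a space of holomorphic functions). $B_0(\mathbb{C}^4)$ is the closure of $\{x\in B(\mathbb{C}^4):|\mathfrak{d}_0x|<\infty\}$ in the norm $\|x\|=|x|+|\mathfrak{d}_0x|$; $H^2(\mathbb{C}^4)$ is dense in it. The range $\mathfrak{d}_0B_0(\mathbb{C}^4)$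 is given the norm $\|\mathfrak{d}_0x\|:=|\mathfrak{d}_0x|+|x|$, $x\in B_0(\mathbb{C}^4)$ ($\mathfrak{d}_0$ being treated as injective on $B_0(\mathbb{C}^4)$). It contains the Hilbert space $\mathcal{H}^2(\mathbb{C}^3)+\overline{\mathfrak{d}_0H^2(\mathbb{C}^4)}\subseteq\mathcal{H}^2(\mathbb{C}^4)$, the completion of $H^2(\mathbb{C}^3)+\mathfrak{d}_0H^2(\mathbb{C}^4)$ in $\langle\cdot,\cdot\rangle$. **The space $\mathbb{B}$ and its measure.** Let $\Lambda^2(\mathbb{R}^4)$ have orthonormal basis $\{dx^a\wedge dx^b\}_{0\le a<b\le3}$; let $\ast\Lambda^2(\mathbb{R}^3)$ be the span of $dx^0\wedge dx^i$, $1\le i\le3$, and $\Lambda^2(\mathbb{R}^3)$ the span of $dx^i\wedge dx^j$, $1\le i<j\le3$. Put $$\mathbb{B}=\left\{[\mathfrak{d}_0B_0(\mathbb{C}^4)]\otimes[\ast\Lambda^2(\mathbb{R}^3)]\right\}\oplus\left\{B_0(\mathbb{C}^4)\otimes\Lambda^2(\mathbb{R}^3)\right\},$$ with norm the sum of the norms of the six components. $\mathcal{H}^2(\mathbb{C}^4)\otimes\Lambda^2(\mathbb{R}^4)$ carries the inner product $\langle\sum f_{ab}\otimes dx^a\wedge dx^b,\sum\hat f_{ab}\otimes dx^a\wedge dx^b\rangle=\sum_{a<b}\langle f_{ab},\hat f_{ab}\rangle$ and norm $\|\cdot\|$. The dual $\mathbb{B}^*$ is identified with a dense subspace of $\mathcal{H}^2(\mathbb{C}^4)\otimes\Lambda^2(\mathbb{R}^4)$,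 and $(x,y)_\sharp$ denotes the pairing of $x\in\mathbb{B}$ with the functional identified with $y$ (extending $\langle x,y\rangle$). For $\theta>0$, $\tilde\mu_\theta$ is the (product) abstract Wiener measure on the Borel field of $\mathbb{B}$ with variance $1/\theta$: under $\tilde\mu_\theta$, $(\cdot,y)_\sharp$ is a centred Gaussian random variable with variance $\|y\|^2/\theta$. **The functionals $\xi_{ab}$.** For $w\in\mathbb{C}^4$, $\chi_w(z)=e^{\overline w\cdot z}$ with $\overline w\cdot z=\sum_\alpha\overline{w_\alpha}z_\alpha$ (so $\langle f,\chi_w\rangle=f(w)$), $\psi(w)=e^{-|w|^2/2}/\sqrt{2\pi}$, and $\xi_{ab}(w)=(-1)^{ab}\psi(w)\chi_w\otimes dx^a\wedge dx^b$ for $0\le a<b\le3$. $\mathbb{R}^4$ is regarded as a subset of $\mathbb{C}^4$. **Surface quantities.** Write $\sigma=(\sigma_0,\sigma_1,\sigma_2,\sigma_3)$, $\sigma'=\partial\sigma/\partial s$, $\dot\sigma=\partial\sigma/\partial t$, $J^\sigma_{ij}=\begin{pmatrix}\sigma_i'&\dot\sigma_i\\ \sigma_j'&\dot\sigma_j\end{pmatrix}$, $|J^\sigma_{ij}|=|\det J^\sigma_{ij}|$. For $a<b$, let $c<d$ be the two remaining indices of $\{0,1,2,3\}$, $W_{ab}^{cd}=J_{cd}^\sigma(J_{ab}^{\sigma})^{-1}$ and $\rho_\sigma^{ab}=1/\sqrt{\det[1+(W_{ab}^{cd})^TW_{ab}^{cd}]}$. At points where $|J^\sigma_{ab}|=0$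 the product $\rho_\sigma^{ab}|J^\sigma_{ab}|$ is read as $0$. A parametrization of $S$ is an injective $C^1$ immersion $I^2\to\mathbb{R}^4$ with image $S$.
   Formalization: Since 𝔡₀ is not injective on B_0 (𝔡₀ exp(z_0²/2)=0), the norm of y in 𝔡₀B_0 is taken as |y|+inf{|x| : x∈B_0, 𝔡₀x=y}; and in defining B_0, ''|𝔡₀x|<∞'' is read as 𝔡₀x∈B(C⁴), so that H²(C⁴) is dense in B_0 as claimed. *)

(* Defs.v *)
From HB Require Import structures.
From mathcomp Require Import all_boot all_order all_algebra.
From mathcomp Require Import complex.
From mathcomp Require Import all_classical all_reals all_analysis.
Set Implicit Arguments.
Unset Strict Implicit.
Unset Printing Implicit Defensive.
Import Order.TTheory GRing.Theory Num.Theory.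
Import numFieldNormedType.Exports.
Local Open Scope classical_set_scope.
Local Open Scope ring_scope.
Local Open Scope complex_scope.

Local Notation normc := ComplexField.Normc.normc.

(* The product measure, with its sigma-finiteness: the instance attached to
   [m1 \x m2] in the library is only found for subprobabilities. *)
Section SigmaFiniteProduct.
Local Open Scope ereal_scope.
Context d1 d2 (T1 : measurableType d1) (T2 : measurableType d2) {R : realType}.
Variable m1 : {sigma_finite_measure set T1 -> \bar R}.
Variable m2 : {sigma_finite_measure set T2 -> \bar R}.

Definition sprod : set (T1 * T2) -> \bar R := m1 \x m2.

HB.instance Definition _ := Measure.copy sprod (m1 \x m2).

Let sprod_sigma_finite : sigma_finite setT sprod.
Proof.
have /sigma_finiteP[F [TF ndF Foo]] := sigma_finiteT m1.
have /sigma_finiteP[G [TG ndG Goo]] := sigma_finiteT m2.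
exists (fun n => F n `*` G n).
  rewrite -setXTT TF TG predeqE => -[x y]; split.
    move=> [/= [n _ Fnx] [k _ Gky]]; exists (maxn n k) => //; split.
    - by move: x Fnx; exact/subsetPset/ndF/leq_maxl.
    - by move: y Gky; exact/subsetPset/ndG/leq_maxr.
  by move=> [n _ []/= ? ?]; split; exists n.
move=> k; have [? ?] := Foo k; have [? ?] := Goo k.
split; first exact: measurableX.
by rewrite /sprod product_measure1E// lte_mul_pinfty// ge0_fin_numE.
Qed.

HB.instance Definition _ :=
  Measure_isSigmaFinite.Build _ _ _ sprod sprod_sigma_finite.

End SigmaFiniteProduct.

Section ComplexValued.
Context {R : realType}.

Definition cintegral d (T : measurableType d) (mu : {measure set T -> \bar R})
    (F : T -> R[i]) : R[i] :=
  (\int[mu]_x complex.Re (F x)) +i* (\int[mu]_x complex.Im (F x)).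

Definition cintegrable d (T : measurableType d)
    (mu : {measure set T -> \bar R}) (F : T -> R[i]) : Prop :=
  mu.-integrable setT (fun x => (complex.Re (F x))%:E) /\
  mu.-integrable setT (fun x => (complex.Im (F x))%:E).

(* exp (i x) for real x *)
Definition cexpi (x : R) : R[i] := cos x +i* sin x.

End ComplexValued.

Section FockSpace.
Context {R : realType}.

Definition midx := {ffun 'I_4 -> nat}.

Definition mfact (p : midx) : nat := (\prod_i (p i)`!)%N.

Definition mdeg (p : midx) : nat := (\sum_i p i)%N.

(* A power series sum_p a_p z^p is represented by its Taylor coefficients
   a_p, so that c_p = sqrt(p!) a_p in the expansion sum_p c_p z^p / sqrt(p!). *)
Definition series := midx -> R.

Definition cpow (z : 'I_4 -> R[i]) (p : midx) : R[i] := \prod_i z i ^+ p i.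

(* Evaluation of a polynomial: the sum over a set without finite support is 0
   by convention, and is only used below for finitely supported f. *)
Definition peval (f : series) (z : 'I_4 -> R[i]) : R[i] :=
  \sum_(p \in [set: midx]) (f p)%:C * cpow z p.

Local Notation plane := (measurableTypeR R * measurableTypeR R)%type.

Definition lebesgue_R2 : set plane -> \bar R :=
  sprod (@lebesgue_measure R) (@lebesgue_measure R).
HB.instance Definition _ := SigmaFiniteMeasure.on lebesgue_R2.

(* C^4 is identified with R^8, z_k = x_k + i y_k. *)
Definition C4 : Type := ((plane * plane) * (plane * plane))%type.

Definition lebesgue_C4 : set ((plane * plane) * (plane * plane)) -> \bar R :=
  sprod (sprod lebesgue_R2 lebesgue_R2) (sprod lebesgue_R2 lebesgue_R2).
HB.instance Definition _ := SigmaFiniteMeasure.on lebesgue_C4.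

Definition point4 (x : C4) (k : 'I_4) : R[i] :=
  let xy := tnth [tuple x.1.1; x.1.2; x.2.1; x.2.2] k in xy.1 +i* xy.2.

(* The integral below is real since f and g have real coefficients: the
   conjugation z |-> conj z preserves the Gaussian weight and conjugates the
   integrand. *)
Definition poly_ip (f g : series) : R :=
  complex.Re
    ((pi ^- 4)%:C *
     cintegral lebesgue_C4
       (fun x => let z := point4 x in
          peval f z * conjc (peval g z) *
          (expR (- \sum_i normc (z i) ^+ 2))%:C)).

Definition trunc (N : nat) (f : series) : series :=
  fun p => if (mdeg p <= N)%N then f p else 0.

(* The Hilbert space completion of the polynomials.  The monomials are
   orthogonal, so every element of the completion is the limit of the Taylor
   polynomials of a unique power series, and conversely a power series defines
   an element exactly when its Taylor polynomials form a Cauchy sequence. *)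
Definition fock : set series :=
  [set f | forall e : R, 0 < e -> exists N : nat, forall m n : nat,
     (N <= m)%N -> (N <= n)%N ->
     poly_ip (trunc m f - trunc n f) (trunc m f - trunc n f) < e].

Definition fock_ip (f g : series) : R :=
  limn (fun N : nat => poly_ip (trunc N f) (trunc N g)).

(* The Taylor coefficients of z |-> exp(w . z), w in R^4. *)
Definition chi (w : 'rV[R]_4) : series :=
  fun p => (\prod_i w 0 i ^+ p i) / (mfact p)%:R.

Definition psi (w : 'rV[R]_4) : R :=
  expR (- (\sum_i w 0 i ^+ 2) / 2) / Num.sqrt (2 * pi).

End FockSpace.
Arguments series : clear implicits.
Arguments fock : clear implicits.
Arguments C4 : clear implicits.

Section BanachSpaces.
Context {R : realType}.

(* sup over |z| < 1/2 of sum_p |c_p| |z^p|, with c_p = sqrt(p!) f_p *)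
Definition Bnorm (f : series R) : \bar R :=
  ereal_sup [set (\esum_(p in [set: midx])
                    (`|Num.sqrt (mfact p)%:R * f p| * normc (cpow z p))%:E)%E
            | z in [set z : 'I_4 -> R[i] |
                     \sum_i normc (z i) ^+ 2 < (1 / 2) ^+ 2]].

(* The completion of [fock] for [Bnorm], as a space of power series. *)
Definition BC4 : set (series R) :=
  [set f | forall e : R, 0 < e ->
     exists2 h, fock R h & (Bnorm (f - h)%R < e%:E)%E].

(* n z_0^(n-1) / 2 - z_0^(n+1) / 2, read off on the coefficient of z^p *)
Definition d0 (f : series R) : series R := fun p =>
  let up : midx := [ffun i => if i == ord0 then (p i).+1 else p i] in
  let down : midx := [ffun i => if i == ord0 then (p i).-1 else p i] in
  (p ord0).+1%:R / 2 * f up - (if p ord0 == 0%N then 0 else f down / 2).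

Definition B0norm (f : series R) : \bar R := (Bnorm f + Bnorm (d0 f))%E.

(* The condition |d0 x| < oo is membership of d0 x in the Banach space on which
   |.| is defined, namely BC4. *)
Definition B0dom : set (series R) := [set f | BC4 f /\ BC4 (d0 f)].

Definition B0 : set (series R) :=
  [set f | forall e : R, 0 < e ->
     exists2 h, B0dom h & (B0norm (f - h)%R < e%:E)%E].

Definition d0B0 : set (series R) := d0 @` B0.

(* |d0 x| + |x|.  The infimum is over all x with d0 x = f; it is |x| when x is
   unique, and makes the norm well defined without that assumption (which
   fails: d0 kills the power series of exp(z_0^2 / 2)). *)
Definition d0B0norm (f : series R) : \bar R :=
  (Bnorm f + ereal_inf [set Bnorm x | x in [set x | B0 x /\ d0 x = f]])%E.

End BanachSpaces.
Arguments BC4 : clear implicits.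
Arguments B0 : clear implicits.
Arguments d0B0 : clear implicits.

(* The pairs a < b, indexing the basis dx^a /\ dx^b of Lambda^2(R^4). *)
Definition pair4 := {ab : 'I_4 * 'I_4 | (ab.1 < ab.2)%N}.

Definition fst4 (ab : pair4) : 'I_4 := (val ab).1.
Definition snd4 (ab : pair4) : 'I_4 := (val ab).2.

(* The two remaining indices, in increasing order. *)
Definition rest4 (ab : pair4) : seq 'I_4 :=
  [seq c <- enum 'I_4 | (c != fst4 ab) && (c != snd4 ab)].
Definition cofst4 (ab : pair4) : 'I_4 := nth ord0 (rest4 ab) 0.
Definition cosnd4 (ab : pair4) : 'I_4 := nth ord0 (rest4 ab) 1.

Section WienerSpace.
Context {R : realType}.

(* Formal elements sum_(a < b) f_ab (x) dx^a /\ dx^b *)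
Definition twoform := pair4 -> series R.

Definition fock_form : set twoform := [set f | forall ab, fock R (f ab)].

Definition form_ip (f g : twoform) : R := \sum_(ab : pair4) fock_ip (f ab) (g ab).

Definition form_norm (f : twoform) : R := Num.sqrt (form_ip f f).

Definition BB : set twoform :=
  [set f | forall ab, if fst4 ab == ord0 then d0B0 R (f ab) else B0 R (f ab)].

Definition BBnorm (f : twoform) : \bar R :=
  (\sum_(ab : pair4)
     (if fst4 ab == ord0 then d0B0norm (f ab) else B0norm (f ab)))%E.

Lemma poly_ip0 : poly_ip (0 : series R) 0 = 0.
Proof.
have p0 z : peval (0 : series R) z = 0.
  by rewrite /peval fsbig1// => p _; rewrite mul0r.
have int0 d (T : measurableType d) (m : {measure set T -> \bar R})
    (F : T -> R[i]) : (forall x, F x = 0) -> cintegral m F = 0.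
  move=> F0; rewrite /cintegral /Rintegral !integral0_eq//= => x _.
    by rewrite F0.
  by rewrite F0.
by rewrite /poly_ip int0 ?mulr0// => x /=; rewrite p0 !mul0r.
Qed.

Lemma fock0 : fock R 0.
Proof.
move=> e e0; exists 0%N => m n _ _.
have t0 k : trunc k (0 : series R) = 0.
  by apply/funext => p; rewrite /trunc; case: ifP.
by rewrite !t0 subrr poly_ip0.
Qed.

Lemma Bnorm0 : Bnorm (0 : series R) = 0%E.
Proof.
apply/eqP; rewrite eq_le; apply/andP; split.
  apply: ge_ereal_sup => _ [z _ <-].
  by rewrite esum1// => p _; rewrite mulr0 normr0 mul0r.
apply: ereal_sup_ubound; exists (fun=> 0).
  rewrite /= big1 ?exprn_gt0 ?divr_gt0// => i _.
  by rewrite expr0n /= addr0 sqrtr0 expr0n.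
by rewrite esum1// => p _; rewrite mulr0 normr0 mul0r.
Qed.

Lemma d00 : d0 (0 : series R) = 0.
Proof.
apply/funext => p; rewrite /d0 mulr0.
by case: ifP => _; rewrite ?mul0r subrr.
Qed.

Lemma BC40 : BC4 R 0.
Proof. by move=> e e0; exists 0; [exact: fock0|rewrite subrr Bnorm0 lte_fin]. Qed.

Lemma B00 : B0 R 0.
Proof.
move=> e e0; exists 0; first by split; rewrite ?d00; exact: BC40.
by rewrite subrr /B0norm d00 Bnorm0 adde0 lte_fin.
Qed.

Lemma BB0 : BB 0.
Proof.
move=> ab; case: ifP => _; last exact: B00.
by exists 0; [exact: B00|exact: d00].
Qed.

End WienerSpace.
Arguments twoform : clear implicits.
Arguments fock_form : clear implicits.
Arguments BB : clear implicits.

Section WienerMeasure.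
Context {R : realType}.

Definition BBtype : Type := {f : twoform R | f \in BB R}.
HB.instance Definition _ := Choice.on BBtype.
HB.instance Definition _ :=
  isPointed.Build BBtype (exist _ 0 (mem_set (@BB0 R))).

Definition BBopen : set (set BBtype) :=
  [set U | forall x, U x -> exists2 e : R, 0 < e &
     forall y, (BBnorm (val y - val x)%R < e%:E)%E -> U y].

(* The bounded linear functionals on BB which extend x |-> <x, y>; there is at
   most one, as BB contains a dense set of x in the Hilbert space. *)
Definition extends_ip (y : twoform R) : set (BBtype -> R) :=
  [set L | [/\ forall (a : R) (u v w : BBtype),
                 val w = (fun ab p => a * val u ab p + val v ab p) ->
                 L w = a * L u + L v,
               exists C : R, forall u,
                 (`|L u|%:E <= C%:E * BBnorm (val u))%E
             & forall u, fock_form R (val u) -> L u = form_ip (val u) y]].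

(* y is (identified with) an element of the dual of BB. *)
Definition in_dual (y : twoform R) : Prop :=
  fock_form R y /\ exists L, extends_ip y L.

(* (x, y)_sharp *)
Definition sharp (x : BBtype) (y : twoform R) : R := get (extends_ip y) x.

(* The centred normal law of variance v >= 0; [normal_prob] is not the Dirac
   mass for v = 0. *)
Definition centred_gaussian (v : R) (A : set R) : \bar R :=
  if v == 0 then \d_(0 : R) A else normal_prob 0 (Num.sqrt v) A.

Definition is_wiener (theta : R)
    (mu : probability (g_sigma_algebraType BBopen) R) : Prop :=
  forall y, in_dual y ->
    measurable_fun [set: g_sigma_algebraType BBopen] (fun x => sharp x y) /\
    forall A : set R, measurable A ->
      mu ((fun x => sharp x y) @^-1` A) =
      centred_gaussian (form_norm y ^+ 2 / theta) A.

End WienerMeasure.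
Arguments BBtype : clear implicits.
Arguments BBopen : clear implicits.

Section Surface.
Context {R : realType}.
Implicit Types (S : set 'rV[R]_4) (sigma : R * R -> 'rV[R]_4).

Definition I2 : set (R * R) := `[0, 1]%classic `*` `[0, 1]%classic.

Definition flat_rectangle S : Prop :=
  exists x0 u v : 'rV[R]_4,
    [/\ u != 0, v != 0, u *m v^T = 0 &
        S = [set x0 + x.1 *: u + x.2 *: v | x in I2]].

(* Partial derivatives inside I^2 (one-sided on the boundary). *)
Definition quot_s (f : R * R -> R) (x : R * R) (u : R) : R :=
  (f (u, x.2) - f x) / (u - x.1).
Definition quot_t (f : R * R -> R) (x : R * R) (u : R) : R :=
  (f (x.1, u) - f x) / (u - x.2).
Definition nbhs01 (r : R) := within `[0, 1]%classic (r^').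

Definition Ds (f : R * R -> R) (x : R * R) : R :=
  lim (quot_s f x @ nbhs01 x.1).
Definition Dt (f : R * R -> R) (x : R * R) : R :=
  lim (quot_t f x @ nbhs01 x.2).

Definition C1_on_I2 (f : R * R -> R) : Prop :=
  [/\ forall x, I2 x -> cvg (quot_s f x @ nbhs01 x.1),
      forall x, I2 x -> cvg (quot_t f x @ nbhs01 x.2),
      {within I2, continuous (Ds f)} &
      {within I2, continuous (Dt f)}].

Definition coord sigma (i : 'I_4) : R * R -> R := fun x => sigma x 0 i.

Definition jacobian sigma (x : R * R) : 'M[R]_(4, 2) :=
  \matrix_(i < 4, j < 2)
    (if j == 0 then Ds (coord sigma i) x else Dt (coord sigma i) x).

Definition parametrization S sigma : Prop :=
  [/\ forall i, C1_on_I2 (coord sigma i),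
      forall x, I2 x -> \rank (jacobian sigma x) = 2%N,
      {in I2 &, injective sigma} &
      sigma @` I2 = S].

Definition Jmx sigma (i j : 'I_4) (x : R * R) : 'M[R]_2 :=
  \matrix_(k < 2, l < 2) jacobian sigma x (if k == 0 then i else j) l.

Definition absJ sigma (ab : pair4) (x : R * R) : R :=
  `|\det (Jmx sigma (fst4 ab) (snd4 ab) x)|.

Definition Wmx sigma (ab : pair4) (x : R * R) : 'M[R]_2 :=
  Jmx sigma (cofst4 ab) (cosnd4 ab) x *m
  invmx (Jmx sigma (fst4 ab) (snd4 ab) x).

(* [invmx] is total, so rho * absJ is 0 where absJ = 0. *)
Definition rho sigma (ab : pair4) (x : R * R) : R :=
  1 / Num.sqrt (\det (1%:M + (Wmx sigma ab x)^T *m Wmx sigma ab x)).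

Definition int_I2 (F : R * R -> R) : R :=
  \int[lebesgue_R2]_(x in I2) F x.

Definition area sigma : R :=
  \sum_(ab : pair4) int_I2 (fun x => rho sigma ab x * absJ sigma ab x).

Definition xi (ab : pair4) (w : 'rV[R]_4) : twoform R := fun cd =>
  if cd == ab
  then (fun p => (-1) ^+ (fst4 ab * snd4 ab)%N * psi w * chi w p)
  else 0.

(* The (weak) integral over I^2 of a Hilbert space valued map: the unique
   vector y with <y, h> = int <F, h> for all h. *)
Definition hilbert_int_I2 (F : R * R -> twoform R) : twoform R :=
  get [set y | fock_form R y /\ forall h, fock_form R h ->
         form_ip y h = int_I2 (fun x => form_ip (F x) h)].

Definition wilson_exponent sigma (k : R) (B : BBtype R) : R :=
  \sum_(ab : pair4) int_I2 (fun x =>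
    k ^+ 2 / 4 * absJ sigma ab x * sharp B (xi ab ((k / 2) *: sigma x))).

Definition wilson_vector sigma (k : R) : twoform R :=
  \sum_(ab : pair4) hilbert_int_I2 (fun x cd p =>
    k / 4 * absJ sigma ab x * xi ab ((k / 2) *: sigma x) cd p).

End Surface.

(* Main.v *)
Require Import Defs.
From HB Require Import structures.
From mathcomp Require Import all_boot all_order all_algebra.
From mathcomp Require Import complex ring lra zify.
From mathcomp Require Import all_classical all_reals all_analysis.
From mathcomp Require Import measurable_realfun.
Set Implicit Arguments.
Unset Strict Implicit.
Unset Printing Implicit Defensive.
Import Order.TTheory GRing.Theory Num.Theory.
Import numFieldNormedType.Exports.
Local Open Scope classical_set_scope.
Local Open Scope ring_scope.

(** Everything is read off Taylor coefficients.  Integrating monomials against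
    the Gaussian weight of C^4, one coordinate at a time, gives
    <z^p, z^q> = p! if p = q and 0 otherwise ([fock_ipE]).  So the completion is
    a weighted l^2 space, and exp (w . z) represents evaluation at w.

    The weights sqrt (p!) in the Banach norm grow faster than any geometric
    sequence: although that norm only looks at the ball of radius 1/2,
    evaluation at every real point is bounded for it ([Bnorm_eval]).  Hence a
    vector y whose coefficients are O (rho^|p| / p!) defines a bounded
    functional.  It is the only one extending <., y>, because the polynomials
    are dense in the graph norm of the operator d_0, as Fejer means of the
    Taylor polynomials show ([d0_density], [extends_ip_unique]).  The coherent
    states xi_ab(w) and their weak integrals over the square are of this kind,
    and dominated convergence along Taylor polynomials lets the pairing with a
    point of the Banach space commute with the integral
    ([has_int_sharp_xi]).  The exponent of the Wilson surface observable is
    therefore k (B, Y)_sharp, where Y is the weak integral in the right-hand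
    side.  Under the Wiener measure (B, Y)_sharp is centred Gaussian of variance
    |Y|^2 / k^2, so the expectation is the characteristic function
    exp (- |Y|^2 / 2) ([characteristic_function]).

    For the limit, the reproducing property turns |Y|^2 into a double integral
    over the square.  With A = |J_ab|, the component ab contributes
      k^2 / (32 pi) * int int A(x) A(y) exp (- k^2 |s(y) - s(x)|^2 / 8) dy dx,
    where s is the parametrization ([xi_coef_kernel]).  The inner integral is
    evaluated by Laplace's method: substitute y = x + h / k.  Because s is
    strictly differentiable, the exponent tends to minus one eighth of the
    first fundamental form at h, whose Gaussian integral is 8 pi / sqrt det.
    An injective immersion of a compact square satisfies
    |s(y) - s(x)|^2 >= c |y - x|^2 ([global_lower]), which supplies the
    integrable majorant M exp (- c |h|^2 / 8).  A second dominated convergence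
    in x gives 1/4 int A^2 / sqrt det ([laplace]), and A / sqrt det is the
    density rho_ab by multiplicativity of determinants ([rho_absJ]).  So |Y|^2
    tends to a quarter of the area, and exp (- |Y|^2 / 2) to exp (- area / 8). *)

(** * Real integrals with a prescribed value *)

Section RealIntegral.
Context d (T : measurableType d) (R : realType).
Variable mu : {measure set T -> \bar R}.
Implicit Types (D : set T) (f g : T -> R).

(** Integrability and value are carried together, so that linearity, products
    and limits never separate the two. *)
Definition has_int D f (v : R) : Prop :=
  mu.-integrable D (EFin \o f) /\ \int[mu]_(x in D) f x = v.

Lemma has_int_EFin D f v : measurable D -> has_int D f v ->
  (\int[mu]_(x in D) (f x)%:E = v%:E)%E.
Proof.
move=> mD [fi <-]; rewrite /Rintegral fineK//.
exact: integrable_fin_num.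
Qed.

Lemma has_intD D f g a b : measurable D -> has_int D f a -> has_int D g b ->
  has_int D (fun x => f x + g x) (a + b).
Proof.
move=> mD [fi <-] [gi <-]; split; last by rewrite RintegralD.
by rewrite (_ : _ \o _ = (EFin \o f) \+ (EFin \o g))//; exact: integrableD.
Qed.

Lemma has_intZ D f a c : measurable D -> has_int D f a ->
  has_int D (fun x => c * f x) (c * a).
Proof.
move=> mD [fi <-]; split; last by rewrite RintegralZl.
by rewrite (_ : _ \o _ = fun x => c%:E * (EFin \o f) x)%E//; exact: integrableZl.
Qed.

Lemma eq_has_int D f g a b : measurable D -> {in D, f =1 g} -> a = b -> has_int D f a -> has_int D g b.
Proof.
move=> mD fg <- [fi <-]; split; last by apply: eq_Rintegral => x xD; rewrite fg.
by apply: eq_integrable fi => // x xD /=; rewrite fg.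
Qed.

Lemma has_int0 D : measurable D -> has_int D (fun=> 0) 0.
Proof.
move=> mD; split; last by rewrite Rintegral_cst// mul0r.
exact: integrable0.
Qed.

Lemma has_intB D f g a b : measurable D -> has_int D f a -> has_int D g b ->
  has_int D (fun x => f x - g x) (a - b).
Proof.
move=> mD fa gb; apply: (eq_has_int mD) (has_intD mD fa (has_intZ (-1) mD gb)).
  by move=> x _; rewrite mulN1r.
by rewrite mulN1r.
Qed.

Lemma has_int_sum D I (s : seq I) (F : I -> T -> R) (v : I -> R) : measurable D ->
  (forall i, has_int D (F i) (v i)) ->
  has_int D (fun x => \sum_(i <- s) F i x) (\sum_(i <- s) v i).
Proof.
move=> mD Fv; elim: s => [|i s ih].
  by rewrite big_nil; apply: (eq_has_int mD) (has_int0 mD) => // x _; rewrite big_nil.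
rewrite big_cons; apply: (eq_has_int mD) (has_intD mD (Fv i) ih) => // x _.
by rewrite big_cons.
Qed.

Lemma has_int_restrict D f v : measurable D ->
  has_int D f v <-> has_int setT (f \_ D) v.
Proof.
move=> mD; rewrite /has_int -Rintegral_mkcond -restrict_EFin.
by split=> -[fi fv]; split=> //; apply/(integrable_mkcond _ mD).
Qed.

Lemma has_int_ge0 D f v : measurable D -> measurable_fun D f ->
  (forall x, D x -> 0 <= f x) ->
  (\int[mu]_(x in D) (f x)%:E = v%:E)%E -> has_int D f v.
Proof.
move=> mD mf f0 fv; split; last by rewrite /Rintegral fv.
apply/integrableP; split; first exact/measurable_EFinP.
under eq_integral => x /set_mem xD do rewrite /= ger0_norm ?f0//.
by rewrite fv ltry.
Qed.

(** Dominated convergence for sequences of integrals whose values are known: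
    both integrability of the limit and convergence of the values come out. *)
Lemma dominated_has_int D (f_ : nat -> T -> R) (v : nat -> R) f g : measurable D ->
  (forall n, has_int D (f_ n) (v n)) ->
  (forall x, D x -> f_ ^~ x @ \oo --> f x) ->
  mu.-integrable D (EFin \o g) ->
  (forall n x, D x -> `|f_ n x| <= g x) ->
  has_int D f (\int[mu]_(x in D) f x) /\ v @ \oo --> \int[mu]_(x in D) f x.
Proof.
move=> mD fv ff gi fg.
have mf_ n : measurable_fun D (EFin \o f_ n : T -> \bar R).
  by have [/integrableP[]] := fv n.
have ffE x : D x -> (EFin \o f_ ^~ x) @ \oo --> (f x)%:E.
  by move=> Dx; apply/cvg_EFin; [exact: nearW|exact: ff].
have mf : measurable_fun D (EFin \o f : T -> \bar R).
  exact: (emeasurable_fun_cvg (fun n => EFin \o f_ n)).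
have [fi _ cv] := @dominated_convergence _ _ _ mu D mD (fun n => EFin \o f_ n)
   (EFin \o f) (EFin \o g) mf_ mf (aeW _ ffE) gi
   (aeW _ (fun x n Dx => fg n x Dx)).
split; first by split.
have fin : (\int[mu]_(x in D) (f x)%:E)%E \is a fin_num.
  exact: integrable_fin_num.
have : (fun n => (v n)%:E) @ \oo --> (\int[mu]_(x in D) f x)%:E.
  rewrite /Rintegral fineK//; apply: cvg_trans cv; apply: near_eq_cvg.
  by apply: nearW => n; exact: (has_int_EFin mD (fv n)).
by move/fine_cvg.
Qed.

End RealIntegral.

Section ProductIntegral.
Context d1 d2 (T1 : measurableType d1) (T2 : measurableType d2) (R : realType).
Variable m1 : {sigma_finite_measure set T1 -> \bar R}.
Variable m2 : {sigma_finite_measure set T2 -> \bar R}.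

Lemma has_int_prod (f : T1 -> R) (g : T2 -> R) a b :
  has_int m1 setT f a -> has_int m2 setT g b ->
  has_int (sprod m1 m2) setT (fun x => f x.1 * g x.2) (a * b).
Proof.
move=> fa gb; have [fi _] := fa; have [gi _] := gb.
pose h := fun x : T1 * T2 => (f x.1 * g x.2)%:E.
have mf : measurable_fun setT f.
  by case/integrableP: fi => /measurable_EFinP.
have mg : measurable_fun setT g.
  by case/integrableP: gi => /measurable_EFinP.
have mh : measurable_fun setT h.
  apply/measurable_EFinP; apply: measurable_funM.
    exact: measurableT_comp.
  exact: measurableT_comp.
have hi : (m1 \x m2)%E.-integrable setT h.
  apply/(integrable12ltyP m1 m2 mh).
  under eq_integral => x _.
    under eq_integral do rewrite /h/= normrM EFinM.
    rewrite ge0_integralZl//=; last first.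
      by apply/measurable_EFinP; exact: measurableT_comp.
    over.
  rewrite ge0_integralZr//=; last 2 first.
    by apply/measurable_EFinP; exact: measurableT_comp.
    by apply: integral_ge0.
  case/integrableP: fi => _ fi; case/integrableP: gi => _ gi.
  rewrite lte_mul_pinfty//; first by apply: integral_ge0.
  by rewrite ge0_fin_numE//; apply: integral_ge0.
split=> //.
rewrite /Rintegral; apply: (@congr1 _ _ fine _ (a * b)%:E).
transitivity (\int[m1 \x m2]_x h x)%E; first by [].
rewrite -(integral12_prod_meas1 hi)/=.
transitivity (\int[m1]_x ((f x)%:E * b%:E))%E.
  apply: eq_integral => x _; rewrite /fubini_F /h/=.
  under eq_integral do rewrite EFinM.
  by rewrite integralZl// (has_int_EFin _ gb).
by rewrite integralZr// (has_int_EFin _ fa).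
Qed.

End ProductIntegral.

(** * Gaussian integrals *)

Section Gaussian.
Context {R : realType}.
Notation leb := (@lebesgue_measure R).

(** The pushforward of Lebesgue measure by an affine map agrees with a multiple
    of Lebesgue measure on half-open intervals, hence everywhere. *)
Lemma ge0_integral_affine (a b : R) (f : R -> \bar R) : a != 0 ->
  measurable_fun [set: R] f -> (forall x, 0 <= f x)%E ->
  (\int[leb]_x f (a * x + b)%R = `|a|^-1%:E * \int[leb]_x f x)%E.
Proof.
move=> a0 mf f0.
pose phi : measurableTypeR R -> measurableTypeR R := fun x : R => a * x + b.
have mphi : measurable_fun [set: measurableTypeR R] phi.
  by apply: measurable_funD => //; exact: measurable_funM.
pose nu0 : {measure set (measurableTypeR R) -> \bar R} := pushforward leb phi.
pose nu := nu0 mphi.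
pose na : {nonneg R} := NngNum (normr_ge0 a).
have E : forall A, measurable A -> leb A = mscale na nu A.
  apply: lebesgue_measure_unique => X [[u v] _ <-] /=.
  rewrite /mscale/= /pushforward/= lebesgue_measure_itv/= lte_fin.
  have [a_gt0|a_le0] := ltP 0 a.
    rewrite (_ : phi @^-1` _ = `](u - b) / a, (v - b) / a]%classic); last first.
      apply/seteqP; split=> x /=; rewrite /phi !in_itv/= ltr_pdivrMr// ler_pdivlMr//;
        by rewrite ltrBlDr lerBrDr (mulrC a).
    rewrite lebesgue_measure_itv/= lte_fin ltr_pM2r ?invr_gt0// ltrD2r.
    case: ifP => _; last by rewrite mule0.
    rewrite -!EFinD -EFinM; congr EFin; rewrite gtr0_norm//; field.
    by rewrite gt_eqF.
  have a_lt0 : a < 0 by rewrite lt_neqAle a0.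
  rewrite (_ : phi @^-1` _ = `[(v - b) / a, (u - b) / a[%classic); last first.
    apply/seteqP; split=> x /=; rewrite /phi !in_itv/= ler_ndivrMr// ltr_ndivlMr//;
      by rewrite ltrBlDr lerBrDr (mulrC a) andbC.
  rewrite lebesgue_measure_itv/= lte_fin ltr_nM2r ?invr_lt0// ltrD2r.
  case: ifP => _; last by rewrite mule0.
  rewrite -!EFinD -EFinM; congr EFin; rewrite ltr0_norm//; field.
  by rewrite lt_eqF.
rewrite [in RHS](eq_measure_integral (mscale na nu)); last by move=> A mA _; exact: E.
rewrite ge0_integral_mscale//= ge0_integral_pushforward//.
by rewrite preimage_setT muleA -EFinM mulVf ?normr_eq0// mul1e.
Qed.

Lemma gauss_funE (c x : R) : 0 <= c -> expR (- (c * x ^+ 2)) = gauss_fun (Num.sqrt c * x + 0).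
Proof. by move=> c0; rewrite /gauss_fun addr0 exprMn sqr_sqrtr. Qed.

Lemma measurable_gauss (c b : R) : measurable_fun [set: R] (fun x : R => expR (- (c * (x + b) ^+ 2))).
Proof.
apply: measurableT_comp => //; apply: measurableT_comp => //.
apply: measurable_funM => //; apply: measurable_funX => //.
exact: measurable_funD.
Qed.

Lemma integral_gauss (c b : R) : 0 < c ->
  (\int[leb]_x (expR (- (c * (x + b) ^+ 2)))%:E = (Num.sqrt (pi / c))%:E)%E.
Proof.
move=> c0.
pose s := Num.sqrt c; have s0 : 0 < s by rewrite sqrtr_gt0.
transitivity (\int[leb]_x (EFin (gauss_fun (s * x + s * b))))%E.
  apply: eq_integral => x _; congr EFin.
  by rewrite -mulrDr gauss_funE ?ltW// addr0.
rewrite (@ge0_integral_affine s (s * b) (EFin \o gauss_fun)) ?gt_eqF//; first last.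
- by move=> x; rewrite lee_fin gauss_fun_ge0.
- by apply/measurable_EFinP; exact: measurable_gauss_fun.
rewrite integralT_gauss -EFinM; congr EFin.
by rewrite gtr0_norm// sqrtrM ?pi_ge0// sqrtrV ?ltW// mulrC.
Qed.

Lemma has_int_gauss (c b : R) : 0 < c ->
  has_int leb setT (fun x => expR (- (c * (x + b) ^+ 2))) (Num.sqrt (pi / c)).
Proof.
move=> c0; apply: has_int_ge0 => //.
- exact: measurable_gauss.
- exact: integral_gauss.
Qed.

(** Young's inequality lets a Gaussian absorb an exponential. *)
Lemma expR_gauss_le (t x : R) :
  expR (t * `|x|) * gauss_fun x <= expR (t ^+ 2 / 2) * expR (- (2^-1 * (x + 0) ^+ 2)).
Proof.
rewrite /gauss_fun addr0 -!expRD ler_expR.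
have := sqr_ge0 (t - `|x|); rewrite sqrrB real_normK ?num_real// => h.
nra.
Qed.

Lemma exprn_le_expR (x : R) n : 0 <= x -> x ^+ n <= n`!%:R * expR x.
Proof.
move=> x0; case: n => [|n]; first by rewrite expr0 fact0 mul1r -expR0 ler_expR.
have := expR_ge1Dxn n x0.
have f0 : 0 < (n.+1`!%:R : R) by rewrite ltr0n fact_gt0.
move=> h; rewrite mulrC -ler_pdivrMr//.
by apply: le_trans h; rewrite lerDr.
Qed.

(** One integrable majorant serves all moments up to a constant. *)
Lemma le_moment (n : nat) (x : R) :
  `|x ^+ n * gauss_fun x| <= n`!%:R * expR (1 / 2) * expR (- (2^-1 * (x + 0) ^+ 2)).
Proof.
rewrite normrM normrX (ger0_norm (gauss_fun_ge0 _)) -mulrA.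
have := expR_gauss_le 1 x; rewrite mul1r expr1n => h.
apply: le_trans (ler_wpM2l _ h); last by rewrite ler0n.
rewrite mulrA ler_wpM2r ?gauss_fun_ge0//.
by apply: exprn_le_expR.
Qed.

Lemma measurable_moment n : measurable_fun [set: R] (fun x : R => x ^+ n * gauss_fun x).
Proof.
apply: measurable_funM; first exact: measurable_funX.
exact: measurable_gauss_fun.
Qed.

Lemma integrable_gauss_dom (c : R) :
  leb.-integrable setT (fun x => (c * expR (- (2^-1 * (x + 0) ^+ 2)))%:E).
Proof.
have h : (0 : R) < 2^-1 by rewrite invr_gt0.
by have [] := has_intZ c measurableT (has_int_gauss 0 h).
Qed.

Lemma integrable_moment n : leb.-integrable setT (fun x => (x ^+ n * gauss_fun x)%:E).
Proof.
apply: le_integrable (integrable_gauss_dom (n`!%:R * expR (1/2))) => //.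
  by apply/measurable_EFinP; exact: measurable_moment.
move=> x _; rewrite /= lee_fin (le_trans (le_moment n x))// ler_norm//.
Qed.

Definition moment (n : nat) : R := \int[leb]_x (x ^+ n * gauss_fun x).

Lemma has_int_moment n : has_int leb setT (fun x => x ^+ n * gauss_fun x) (moment n).
Proof. by split=> //; exact: integrable_moment. Qed.

Lemma moment0 : moment 0 = Num.sqrt pi.
Proof.
rewrite /moment /Rintegral; under eq_integral do rewrite expr0 mul1r.
by rewrite integralT_gauss.
Qed.

Lemma is_derive_moment n (x : R) : is_derive x 1 (fun x : R => x ^+ n * gauss_fun x)
  (n%:R * (x ^+ n.-1 * gauss_fun x) - 2 * (x ^+ n.+1 * gauss_fun x)).
Proof.
have h0 m : is_derive x 1 (fun x : R => x ^+ m) (m%:R * x ^+ m.-1).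
  apply: DeriveDef; first exact: exprn_derivable.
  by rewrite exp_derive /GRing.scale/= mulr1.
have h2 : is_derive x 1 (fun x : R => - x ^+ 2) (- (2 * x)).
  by have := is_deriveN (h0 2%N); rewrite expr1.
have h3 : is_derive x 1 (@gauss_fun R) (- (2 * x) * gauss_fun x).
  by rewrite mulrC /gauss_fun; apply: (@is_derive1_comp _ expR _ x _ _ _ h2).
have := @is_deriveM _ _ _ _ x 1 _ _ (h0 n) h3.
move=> h; apply: (is_derive_eq h); rewrite /GRing.scale/= exprS; ring.
Qed.

Lemma moment_cvg0 n (u : nat -> R) : (forall k, `|u k| = k%:R) ->
  (fun k => u k ^+ n * gauss_fun (u k)) @ \oo --> (0 : R).
Proof.
move=> ua; apply/cvgr0Pnorm_le => e e0.
pose C := n`!%:R * expR (1 / 2) : R.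
have C0 : 0 < C by rewrite mulr_gt0 ?expR_gt0// ltr0n fact_gt0.
near=> k; apply: le_trans (le_moment n (u k)) _.
rewrite -/C addr0 -ler_pdivlMl// expRN -[leRHS]invrK lef_pV2 ?posrE ?expR_gt0//; last first.
  by rewrite invr_gt0 mulr_gt0 ?invr_gt0.
apply: (@le_trans _ _ (1 + 2^-1 * u k ^+ 2)); last exact: expR_ge1Dx.
rewrite -(real_normK (num_real (u k))) ua.
have k1 : 1 <= k%:R :> R by near: k; exact: nbhs_infty_ger.
have : 2 * (C^-1 * e)^-1 <= k%:R by near: k; exact: nbhs_infty_ger.
rewrite expr2; set z := (_)^-1; move=> h.
nra.
Unshelve. all: by end_near. Qed.

(** Stein's identity, obtained by integrating the derivative of
    [x ^+ n * gauss_fun x] over [-k, k] and letting k go to infinity. *)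
Lemma momentS n : moment n.+1 = n%:R / 2 * moment n.-1.
Proof.
pose F := fun x : R => x ^+ n * gauss_fun x.
pose f := fun x : R => n%:R * (x ^+ n.-1 * gauss_fun x) - 2 * (x ^+ n.+1 * gauss_fun x).
have dF (x : R) : is_derive x 1 F (f x) by exact: is_derive_moment.
have cF : continuous F.
  by move=> x; apply: differentiable_continuous; apply/derivable1_diffP.
have cf : continuous f.
  move=> x; apply: cvgB; apply: cvgM; try exact: cvg_cst.
  - by apply: cvgM; [exact: exprn_continuous|exact: continuous_gauss_fun].
  - by apply: cvgM; [exact: exprn_continuous|exact: continuous_gauss_fun].
have hf : has_int leb setT f (n%:R * moment n.-1 - 2 * moment n.+1).
  by apply: has_intB => //; apply: has_intZ => //; exact: has_int_moment.
pose f_ k := f \_ `[- k%:R, k%:R].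
have hk k : has_int leb setT (f_ k.+1) (F k.+1%:R - F (- k.+1%:R)).
  have k0 : - k.+1%:R < (k.+1%:R : R) by rewrite (@lt_trans _ _ 0)// ?oppr_lt0 ltr0n.
  pose A : R := - k.+1%:R; pose B : R := k.+1%:R.
  have E : (\int[leb]_(x in `[A, B]) (f x)%:E = (F B)%:E - (F A)%:E)%E.
    apply: continuous_FTC2 => //.
    - exact: continuous_subspaceT.
    - by split=> //; [apply: cvg_at_right_filter; exact: cF|apply: cvg_at_left_filter; exact: cF].
    - by move=> x _; rewrite derive1E; exact: derive_val.
  have [H _] := has_int_restrict leb f (F B - F A) (measurable_itv `[A, B]).
  apply: H; split; last by rewrite /Rintegral E.
  by apply: integrableS hf.1.
have [] := @dominated_has_int _ _ _ leb setT (fun k => f_ k.+1)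
  (fun k => F k.+1%:R - F (- k.+1%:R)) f (fun x => `|f x|) measurableT hk.
- move=> x _; apply: cvg_near_cst; near=> k.
  rewrite /f_ patchE mem_set//= in_itv/= -ler_norml.
  apply: (@le_trans _ _ k%:R); last by rewrite ler_nat.
  by near: k; exact: nbhs_infty_ger.
- by have := integrable_abse hf.1.
- move=> k x _; rewrite /f_ patchE; case: ifP => // _; by rewrite normr0.
move=> _ cv.
have : (fun k => F k.+1%:R - F (- k.+1%:R)) @ \oo --> (0 - 0 : R).
  apply: cvgB.
    have := @moment_cvg0 n (fun k => k%:R) (fun k => normr_nat _ k).
    by rewrite -cvg_shiftS.
  have := @moment_cvg0 n (fun k => - k%:R).
  move/(_ (fun k => etrans (normrN _) (normr_nat _ k))).
  by rewrite -cvg_shiftS.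
rewrite subrr => /(cvg_unique _ cv) /esym.
rewrite hf.2 => /(_ (@Rhausdorff R)) h; lra.
Unshelve. all: by end_near. Qed.

Lemma moment_even n : moment n.*2 = Num.sqrt pi * n.*2`!%:R / (4 ^+ n * n`!%:R).
Proof.
elim: n => [|n ih]; first by rewrite moment0 expr0 fact0 mul1r divr1 mulr1.
rewrite doubleS momentS/= ih !factS exprS !natrM.
have f0 m : (m`!%:R : R) != 0 by rewrite pnatr_eq0 -lt0n fact_gt0.
have -> : (n.*2.+2%:R : R) = 2 * (n.+1)%:R by rewrite -natrM mul2n doubleS.
field.
by rewrite f0 expf_neq0 ?pnatr_eq0// addrC natr1 pnatr_eq0.
Qed.

(** Reduced to the nonnegative case through positive and negative parts. *)
Lemma has_int_affine (a b v : R) (f : R -> R) : a != 0 ->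
  has_int leb setT f v ->
  has_int leb setT (fun x => f (a * x + b)) (`|a|^-1 * v).
Proof.
move=> a0 hf.
have G (g : R -> R) w : (forall x, 0 <= g x) -> has_int leb setT g w ->
    has_int leb setT (fun x => g (a * x + b)) (`|a|^-1 * w).
  move=> g0 hg.
  have mg : measurable_fun [set: R] g.
    by case: hg => /integrableP[/measurable_EFinP].
  apply: has_int_ge0 => //.
    by apply: measurableT_comp => //; apply: measurable_funD => //.
  have := @ge0_integral_affine a b (EFin \o g) a0 _ _.
  rewrite (has_int_EFin _ hg)// -EFinM; apply; last by move=> x; rewrite lee_fin.
  exact/measurable_EFinP.
have hp : has_int leb setT f^\+ (\int[leb]_x f^\+ x).
  by split=> //; apply: integrable_funrpos => //; exact: hf.1.
have hn : has_int leb setT f^\- (\int[leb]_x f^\- x).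
  by split=> //; apply: integrable_funrneg => //; exact: hf.1.
have fE x : f x = f^\+ x - f^\- x by rewrite -[in LHS](funrposBneg f).
have -> : v = \int[leb]_x f^\+ x - \int[leb]_x f^\- x.
  rewrite -hf.2 -(RintegralB _ hp.1 hn.1)//.
  by apply: eq_Rintegral => x _; rewrite fE.
rewrite mulrBr; apply: (eq_has_int measurableT) (has_intB measurableT (G _ _ _ hp) (G _ _ _ hn)) => //.
Qed.

Lemma exp_partial_le (y : R) n : 0 <= y -> series (exp_coeff y) n <= expR y.
Proof.
move=> y0; rewrite /expR; apply: nondecreasing_cvgn_le; last exact: is_cvg_series_exp_coeff.
by apply/nondecreasing_series => k _ _; exact: exp_coeff_ge0.
Qed.

Lemma cos_partial_le (y : R) n : `|series (cos_coeff' y) n| <= expR `|y|.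
Proof.
apply: le_trans (exp_partial_le n.*2 (normr_ge0 y)).
rewrite /series/=; apply: le_trans (ler_norm_sum _ _ _) _.
elim: n => [|n ih]; first by rewrite !big_nil.
rewrite doubleS !big_nat_recr//= -addrA; apply: lerD => //.
rewrite -[leLHS]addr0; apply: lerD; last exact: exp_coeff_ge0.
rewrite /cos_coeff' /exp_coeff/= !normrM normrV ?unitfE ?pnatr_eq0 -?lt0n ?fact_gt0//.
by rewrite normrX normrN1 expr1n mul1r normrX normr_nat.
Qed.

(** The cosine series is integrated termwise: the partial sums of the cosine
    are bounded by [expR `|t * x|], which the Gaussian absorbs, and the even
    moments turn the integrated series into that of the exponential. *)
Lemma has_int_cos_gauss (t : R) :
  has_int leb setT (fun x => cos (t * x) * gauss_fun x)
    (Num.sqrt pi * expR (- (t ^+ 2 / 4))).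
Proof.
pose u n x := series (cos_coeff' (t * x)) n * gauss_fun x.
pose v n := \sum_(0 <= k < n) (Num.sqrt pi * exp_coeff (- (t ^+ 2 / 4)) k).
have hu n : has_int leb setT (u n) (v n).
  have h := @has_int_sum _ _ _ leb setT _ (index_iota 0 n)
    (fun k x => (-1) ^+ k * t ^+ k.*2 / k.*2`!%:R * (x ^+ k.*2 * gauss_fun x))
    (fun k => (-1) ^+ k * t ^+ k.*2 / k.*2`!%:R * moment k.*2)
    measurableT (fun k => has_intZ _ measurableT (has_int_moment k.*2)).
  apply: (eq_has_int measurableT) h => //.
    move=> x _; rewrite /u /series/= mulr_suml; apply: eq_bigr => k _.
    by rewrite /cos_coeff' -exprnP exprMn; ring.
  apply: eq_bigr => k _; rewrite moment_even /exp_coeff/=.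
  rewrite [in RHS]exprNn expr_div_n -exprM mul2n.
  have f0 m : (m`!%:R : R) != 0 by rewrite pnatr_eq0 -lt0n fact_gt0.
  by field; rewrite !f0 expf_neq0 ?pnatr_eq0.
have [] := @dominated_has_int _ _ _ leb setT u v (fun x => cos (t * x) * gauss_fun x)
  (fun x => expR (`|t| ^+ 2 / 2) * expR (- (2^-1 * (x + 0) ^+ 2))) measurableT hu.
- by move=> x _; apply: cvgM; [exact: cvg_cos_coeff'|exact: cvg_cst].
- exact: integrable_gauss_dom.
- move=> n x _; apply: le_trans (expR_gauss_le _ _).
  rewrite normrM (ger0_norm (gauss_fun_ge0 _)) ler_wpM2r ?gauss_fun_ge0//.
  by rewrite -normrM; exact: cos_partial_le.
move=> hc cv; have <- : \int[leb]_x (cos (t * x) * gauss_fun x) = Num.sqrt pi * expR (- (t ^+ 2 / 4)).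
  apply: cvg_unique cv _ => //.
  rewrite (_ : v = fun n => Num.sqrt pi * series (exp_coeff (- (t ^+ 2 / 4))) n); last first.
    by apply/funext => n; rewrite /v /series/= -mulr_sumr.
  apply: cvgM; first exact: cvg_cst.
  by rewrite /expR; exact: is_cvg_series_exp_coeff.
exact: hc.
Qed.

(** The integrand is odd. *)
Lemma has_int_sin_gauss (t : R) :
  has_int leb setT (fun x => sin (t * x) * gauss_fun x) 0.
Proof.
have ms : measurable_fun [set: R] (fun x => sin (t * x) * gauss_fun x).
  apply: measurable_funM; last exact: measurable_gauss_fun.
  apply: measurableT_comp; last exact: measurable_funM.
  by apply: continuous_measurable_fun; exact: continuous_sin.
have hi : has_int leb setT (fun x => sin (t * x) * gauss_fun x)
    (\int[leb]_x (sin (t * x) * gauss_fun x)).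
  split=> //; apply: le_integrable (integrable_gauss_dom (expR (0 ^+ 2 / 2))) => //.
    exact/measurable_EFinP.
  move=> x _; rewrite /= lee_fin [leRHS]ger0_norm; last by rewrite mulr_ge0 ?expR_ge0.
  apply: le_trans (expR_gauss_le _ _); rewrite mul0r expR0 mul1r.
  rewrite normrM (ger0_norm (gauss_fun_ge0 _)) ler_piMl ?gauss_fun_ge0//.
  by rewrite ler_norml sin_geN1 sin_le1.
have h := @has_int_affine (-1) 0 _ _ _ hi.
have N1 : (-1 : R) != 0 by rewrite oppr_eq0 oner_eq0.
have := (has_intZ (-1) measurableT (h N1)).2.
rewrite normrN1 invr1 mul1r.
rewrite (_ : (fun x => _) = (fun x => sin (t * x) * gauss_fun x)); last first.
  apply/funext => x; rewrite addr0 !mulN1r mulrN sinN mulNr opprK.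
  by rewrite /gauss_fun sqrrN.
move=> e; suff <- : \int[leb]_x (sin (t * x) * gauss_fun x) = 0 by [].
lra.
Qed.

(** Fubini, after completing the square in the second variable. *)
Lemma integral_gauss2 (E F G : R) : 0 < G -> 0 < E * G - F ^+ 2 ->
  (\int[sprod leb leb]_h
     (expR (- ((E * h.1 ^+ 2 + 2 * F * h.1 * h.2 + G * h.2 ^+ 2) / 8)))%:E =
   (8 * pi / Num.sqrt (E * G - F ^+ 2))%:E)%E.
Proof.
move=> G0 D0; set D := E * G - F ^+ 2.
pose q (h : R * R) := expR (- ((E * h.1 ^+ 2 + 2 * F * h.1 * h.2 + G * h.2 ^+ 2) / 8)).
have mq : measurable_fun setT (EFin \o q : measurableTypeR R * measurableTypeR R -> \bar R).
  apply/measurable_EFinP; apply: measurableT_comp => //; apply: measurableT_comp => //.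
  apply: measurable_funM => //.
  have m1 : measurable_fun setT (fst : measurableTypeR R * measurableTypeR R -> R) by [].
  have m2 : measurable_fun setT (snd : measurableTypeR R * measurableTypeR R -> R) by [].
  apply: measurable_funD; [apply: measurable_funD|].
  - by apply: measurable_funM => //; exact: measurable_funX.
  - by apply: measurable_funM => //; apply: measurable_funM.
  - by apply: measurable_funM => //; exact: measurable_funX.
transitivity (\int[leb \x leb]_h (EFin \o q) h)%E; first by [].
rewrite fubini_tonelli1//; last by move=> x; rewrite lee_fin expR_ge0.
transitivity (\int[leb]_x ((Num.sqrt (pi / (G / 8)) * expR (- (D / (8 * G) * (x + 0) ^+ 2)))%:E))%E.
  apply: eq_integral => x _; rewrite /fubini_F/=.
  transitivity (\int[leb]_y ((expR (- (D / (8 * G) * (x + 0) ^+ 2)))%:E *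
      (expR (- (G / 8 * (y + F * x / G) ^+ 2)))%:E))%E.
    apply: eq_integral => y _; rewrite /q -EFinM -expRD; congr (EFin (expR _)).
    by rewrite /= /D; field; rewrite gt_eqF.
  rewrite ge0_integralZl//; last by apply/measurable_EFinP; exact: measurable_gauss.
  by rewrite integral_gauss ?divr_gt0// -EFinM mulrC.
under eq_integral do rewrite EFinM.
rewrite ge0_integralZl//; last by apply/measurable_EFinP; exact: measurable_gauss.
rewrite integral_gauss ?divr_gt0 ?mulr_gt0// -EFinM; congr EFin.
rewrite -sqrtrM ?divr_ge0 ?pi_ge0 ?ltW ?divr_gt0//.
rewrite (_ : _ / _ * _ = (8 * pi) ^+ 2 / D); last by field; rewrite !gt_eqF.
by rewrite sqrtrM ?sqr_ge0// sqrtr_sqr ger0_norm ?mulr_ge0 ?pi_ge0// sqrtrV// ltW.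
Qed.

End Gaussian.

(** * The Fock inner product in Taylor coefficients *)

Section MultiIndices.

(** Boxes are products, so sums over them factor; total degree balls are what
    the Taylor polynomials run over. *)
Definition mbox (N : nat) : seq midx :=
  [seq [ffun i => nat_of_ord (q i)] | q : {ffun 'I_4 -> 'I_N.+1} <- enum {: {ffun 'I_4 -> 'I_N.+1}}].

Lemma mem_mbox N (p : midx) : (p \in mbox N) = [forall i, (p i <= N)%N].
Proof.
apply/mapP/forallP => [[q _ ->] i|pN]; first by rewrite ffunE -ltnS ltn_ord.
exists [ffun i => inord (p i)]; first by rewrite mem_enum.
by apply/ffunP => i; rewrite !ffunE inordK// ltnS.
Qed.

Lemma mbox_uniq N : uniq (mbox N).
Proof.
rewrite map_inj_uniq ?enum_uniq// => q r /ffunP qr; apply/ffunP => i.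
by apply: val_inj; have := qr i; rewrite !ffunE.
Qed.

Definition mball (N : nat) : seq midx := [seq p <- mbox N | (mdeg p <= N)%N].

Lemma le_mdeg (p : midx) i : (p i <= mdeg p)%N.
Proof. by rewrite /mdeg (bigD1 i)//= leq_addr. Qed.

Lemma mem_mball N (p : midx) : (p \in mball N) = (mdeg p <= N)%N.
Proof.
rewrite mem_filter mem_mbox andb_idr// => pN.
by apply/forallP => i; exact: leq_trans (le_mdeg p i) pN.
Qed.

Lemma mball_uniq N : uniq (mball N).
Proof. by rewrite filter_uniq// mbox_uniq. Qed.

End MultiIndices.

Section GaussianMoments.
Context {R : realType}.
Local Open Scope complex_scope.
Local Notation leb := (@lebesgue_measure R).
Local Notation Re := complex.Re.
Local Notation Im := complex.Im.

Section ComplexIntegral.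
Context d (T : measurableType d) (mu : {measure set T -> \bar R}).

Definition has_cint (F : T -> R[i]) (c : R[i]) : Prop :=
  has_int mu setT (fun x => Re (F x)) (Re c) /\
  has_int mu setT (fun x => Im (F x)) (Im c).

Lemma has_cint_cintegral F c : has_cint F c -> cintegral mu F = c.
Proof. by case: c => a b [[_ /= Fa] [_ /= Fb]]; rewrite /cintegral Fa Fb. Qed.

Lemma eq_has_cint F G a b : F =1 G -> a = b -> has_cint F a -> has_cint G b.
Proof. by move=> /funext -> ->. Qed.

Lemma has_cintD F G a b : has_cint F a -> has_cint G b ->
  has_cint (fun x => F x + G x) (a + b).
Proof.
move=> [Fa1 Fa2] [Gb1 Gb2]; split.
  apply: (eq_has_int measurableT) (has_intD measurableT Fa1 Gb1).
    by move=> x _; case: (F x) (G x) => ? ? [].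
  by case: a b {Fa1 Fa2 Gb1 Gb2} => ? ? [].
apply: (eq_has_int measurableT) (has_intD measurableT Fa2 Gb2).
  by move=> x _; case: (F x) (G x) => ? ? [].
by case: a b {Fa1 Fa2 Gb1 Gb2} => ? ? [].
Qed.

Lemma has_cintZ F a c : has_cint F a -> has_cint (fun x => c * F x) (c * a).
Proof.
case: c => u v [Fa1 Fa2]; split.
  have := has_intB measurableT (has_intZ u measurableT Fa1) (has_intZ v measurableT Fa2).
  apply: (eq_has_int measurableT).
    by move=> x _; case: (F x).
  by case: a {Fa1 Fa2}.
have := has_intD measurableT (has_intZ u measurableT Fa2) (has_intZ v measurableT Fa1).
apply: (eq_has_int measurableT).
  by move=> x _; case: (F x).
by case: a {Fa1 Fa2}.
Qed.

Lemma has_cint_sum I (s : seq I) (F : I -> T -> R[i]) (v : I -> R[i]) :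
  (forall i, has_cint (F i) (v i)) ->
  has_cint (fun x => \sum_(i <- s) F i x) (\sum_(i <- s) v i).
Proof.
move=> Fv; elim: s => [|i s ih].
  rewrite big_nil; split; apply: (eq_has_int measurableT) (has_int0 _ measurableT) => // x _;
  by rewrite big_nil.
rewrite big_cons; apply: eq_has_cint (has_cintD (Fv i) ih) => // x.
by rewrite big_cons.
Qed.

End ComplexIntegral.

Lemma has_cint_prod d1 d2 (T1 : measurableType d1) (T2 : measurableType d2)
  (m1 : {sigma_finite_measure set T1 -> \bar R})
  (m2 : {sigma_finite_measure set T2 -> \bar R}) F G a b :
  has_cint m1 F a -> has_cint m2 G b ->
  has_cint (sprod m1 m2) (fun x => F x.1 * G x.2) (a * b).
Proof.
case: a b => a1 a2 [b1 b2] [/= F1 F2] [/= G1 G2]; split=> /=.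
  have := has_intB measurableT (has_int_prod F1 G1) (has_int_prod F2 G2).
  apply: (eq_has_int measurableT) => // x _.
  by case: (F x.1) (G x.2) => ? ? [].
have := has_intD measurableT (has_int_prod F1 G2) (has_int_prod F2 G1).
apply: (eq_has_int measurableT) => // x _.
by case: (F x.1) (G x.2) => ? ? [].
Qed.

(** [zmom m n a b] is the integral of [z^m zbar^n x^a y^b exp (- |z|^2)] over
    the plane, [z = x + i y], obtained by expanding one factor [x +- i y] at a
    time; [zbmom] is the case [m = 0].  The extra exponents [a] and [b] make the
    recursions close up. *)
Fixpoint zbmom (n a b : nat) : R[i] :=
  if n is n'.+1 then zbmom n' a.+1 b - 'i * zbmom n' a b.+1
  else (moment a * moment b)%:C.

Fixpoint zmom (m n a b : nat) : R[i] :=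
  if m is m'.+1 then zmom m' n a.+1 b + 'i * zmom m' n a b.+1
  else zbmom n a b.

Lemma mulii : 'i * 'i = -1 :> R[i].
Proof. by rewrite -expr2 sqr_i. Qed.

Lemma moment_rec a : (moment a.+1 : R)%:C = a%:R / 2 * (moment a.-1)%:C.
Proof.
rewrite momentS -!(rmorph_nat (real_complex R)).
by rewrite -fmorphV -!rmorphM.
Qed.

(** Integration by parts (Stein's identity) in the four lemmas below: a factor
    [x] or [y] is traded for half of the derivative of the other factors. *)
Lemma zbmom_stein_x n a b :
  zbmom n a.+1 b = 2^-1 * (n%:R * zbmom n.-1 a b + a%:R * zbmom n a.-1 b).
Proof.
elim: n a b => [|n ih] a b.
  rewrite /= !rmorphM/= moment_rec; ring.
rewrite [LHS]/= !ih.
case: n a ih => [|n] [|a] ih; rewrite [X in _ = 2^-1 * X]/= /=; try ring.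
Qed.

Lemma zbmom_stein_y n a b :
  zbmom n a b.+1 = 2^-1 * (- 'i * n%:R * zbmom n.-1 a b + b%:R * zbmom n a b.-1).
Proof.
elim: n a b => [|n ih] a b.
  rewrite /= !rmorphM/= moment_rec; ring.
rewrite [LHS]/= !ih.
have i2 := mulii.
case: n b ih => [|n] [|b] ih; rewrite /=; ring: i2.
Qed.

Lemma zmom_stein_x m n a b :
  zmom m n a.+1 b = 2^-1 * (m%:R * zmom m.-1 n a b + n%:R * zmom m n.-1 a b
                            + a%:R * zmom m n a.-1 b).
Proof.
elim: m a b => [|m ih] a b; first by rewrite /= zbmom_stein_x; ring.
rewrite [LHS]/= !ih.
case: m a ih => [|m] [|a] ih; rewrite /=; ring.
Qed.

Lemma zmom_stein_y m n a b :
  zmom m n a b.+1 = 2^-1 * ('i * m%:R * zmom m.-1 n a b - 'i * n%:R * zmom m n.-1 a b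
                            + b%:R * zmom m n a b.-1).
Proof.
elim: m a b => [|m ih] a b; first by rewrite /= zbmom_stein_y; ring.
rewrite [LHS]/= !ih.
have i2 := mulii.
case: m b ih => [|m] [|b] ih; rewrite /=; ring: i2.
Qed.

(** Combining the identities for [x] and [y] cancels the derivative in [z] and
    leaves the recursion [zmom m.+1 n.+1 0 0 = n.+1 * zmom m n 0 0]. *)
Lemma zmomE m n : zmom m n 0 0 = if m == n then (pi * m`!%:R)%:C else 0.
Proof.
have i2 := mulii.
elim: m n => [|m ih] [|n].
- by rewrite /= moment0 -expr2 sqr_sqrtr ?pi_ge0// fact0 mulr1.
- by rewrite /= zbmom_stein_x zbmom_stein_y; ring: i2.
- by rewrite /= zmom_stein_x zmom_stein_y; case: m ih => [|m] ih; ring: i2.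
- transitivity (n.+1%:R * zmom m n 0 0 : R[i]).
    by rewrite [LHS]/= zmom_stein_x zmom_stein_y/=; case: m ih => [|m] ih; rewrite /=; field: i2.
  rewrite ih eqSS; case: eqP => [->|_]; last by rewrite mulr0.
  by rewrite factS natrM !rmorphM/= rmorph_nat; ring.
Qed.

Local Notation plane := (measurableTypeR R * measurableTypeR R)%type.

Definition zpt (x : plane) : R[i] := x.1 +i* x.2.

Definition cgauss (x : plane) : R[i] := (gauss_fun x.1 * gauss_fun x.2)%:C.

Lemma has_cint_real d (T : measurableType d) (mu : {measure set T -> \bar R})
  (f : T -> R) a : has_int mu setT f a -> has_cint mu (fun x => (f x)%:C) a%:C.
Proof. by move=> fa; split=> //=; exact: has_int0. Qed.

Lemma has_cint_xy a b : has_cint lebesgue_R2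
  (fun x : plane => (x.1 ^+ a * x.2 ^+ b)%:C * cgauss x) (zmom 0 0 a b).
Proof.
have := has_cint_real (has_int_prod (has_int_moment (R := R) a) (has_int_moment b)).
apply: eq_has_cint => // x.
by rewrite /cgauss -rmorphM/=; congr (_%:C); ring.
Qed.

Lemma zptE (x : plane) : zpt x = x.1%:C + 'i * x.2%:C.
Proof. by rewrite {1}(complexE (zpt x)). Qed.

Lemma conj_zptE (x : plane) : conjc (zpt x) = x.1%:C - 'i * x.2%:C.
Proof. by rewrite {1}(complexE (conjc (zpt x)))/= rmorphN/= mulrN. Qed.

Lemma has_cint_zb n a b : has_cint lebesgue_R2
  (fun x : plane => conjc (zpt x) ^+ n * (x.1 ^+ a * x.2 ^+ b)%:C * cgauss x) (zmom 0 n a b).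
Proof.
elim: n a b => [|n ih] a b.
  by apply: eq_has_cint (has_cint_xy a b) => // x; rewrite expr0 mul1r.
have := has_cintD (ih a.+1 b) (has_cintZ (- 'i) (ih a b.+1)).
apply: eq_has_cint; last by rewrite /= mulNr.
by move=> x; rewrite exprS conj_zptE !rmorphM/= !exprS !rmorphM/=; ring.
Qed.

Lemma has_cint_z m n a b : has_cint lebesgue_R2
  (fun x : plane => zpt x ^+ m * conjc (zpt x) ^+ n * (x.1 ^+ a * x.2 ^+ b)%:C * cgauss x)
  (zmom m n a b).
Proof.
elim: m a b => [|m ih] a b.
  by apply: eq_has_cint (has_cint_zb n a b) => // x; rewrite expr0 mul1r.
have := has_cintD (ih a.+1 b) (has_cintZ 'i (ih a b.+1)).
apply: eq_has_cint => // x.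
have -> : zpt x ^+ m.+1 = (x.1%:C + 'i * x.2%:C) * zpt x ^+ m by rewrite exprS {1}zptE.
by rewrite !rmorphM/= !exprS !rmorphM/=; ring.
Qed.

Lemma has_cint_plane m n : has_cint lebesgue_R2
  (fun x : plane => zpt x ^+ m * conjc (zpt x) ^+ n * cgauss x)
  (if m == n then (pi * m`!%:R)%:C else 0).
Proof.
apply: eq_has_cint (has_cint_z m n 0 0) => [x|]; last exact: zmomE.
by rewrite !expr0 mulr1 mulr1.
Qed.

Lemma has_cint_C4 (p q : midx) : has_cint lebesgue_C4
  (fun x : C4 R => cpow (point4 x) p * conjc (cpow (point4 x) q) *
     (expR (- \sum_i ComplexField.Normc.normc (point4 x i) ^+ 2))%:C)
  (if p == q then (pi ^+ 4 * (mfact p)%:R)%:C else 0).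
Proof.
pose h k := has_cint_plane (p k) (q k).
pose i0 : 'I_4 := ord0; pose i1 : 'I_4 := lift ord0 (ord0 : 'I_3).
pose i2 : 'I_4 := lift ord0 (lift ord0 (ord0 : 'I_2)).
pose i3 : 'I_4 := lift ord0 (lift ord0 (lift ord0 (ord0 : 'I_1))).
have E4 (S : Type) (idx : S) (op : S -> S -> S) (F : 'I_4 -> S) :
    \big[op/idx]_i F i = op (F i0) (op (F i1) (op (F i2) (op (F i3) idx))).
  by rewrite !big_ord_recl big_ord0.
have := has_cint_prod (has_cint_prod (h i0) (h i1)) (has_cint_prod (h i2) (h i3)).
apply: eq_has_cint => [x|].
  have P0 : point4 x i0 = zpt x.1.1 by rewrite /point4 (tnth_nth (0, 0)).
  have P1 : point4 x i1 = zpt x.1.2 by rewrite /point4 (tnth_nth (0, 0)).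
  have P2 : point4 x i2 = zpt x.2.1 by rewrite /point4 (tnth_nth (0, 0)).
  have P3 : point4 x i3 = zpt x.2.2 by rewrite /point4 (tnth_nth (0, 0)).
  have gE (y : plane) : cgauss y = (expR (- ComplexField.Normc.normc (zpt y) ^+ 2))%:C.
    rewrite /cgauss /gauss_fun -expRD /zpt/= sqr_sqrtr ?addr_ge0 ?sqr_ge0//.
    by rewrite opprD.
  rewrite /cpow !E4 P0 P1 P2 P3 !gE !mulr1 addr0 !opprD !expRD.
  rewrite !(rmorphM conjc) !(rmorphM (real_complex R)) !(rmorphXn conjc).
  by ring.
case: (p =P q) => [<-|/eqP pq].
  rewrite !eqxx -!rmorphM/=; congr (_%:C).
  rewrite /mfact E4 muln1 !natrM; ring.
have : ~~ [&& p i0 == q i0, p i1 == q i1, p i2 == q i2 & p i3 == q i3].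
  apply: contra pq => /and4P[/eqP e0 /eqP e1 /eqP e2 /eqP e3].
  apply/eqP/ffunP => i; case: (unliftP ord0 i) => [j ->|->//].
  case: (unliftP ord0 j) => [k ->|->//].
  case: (unliftP ord0 k) => [l ->|->//].
  by rewrite (ord1 l).
by rewrite !negb_and; case/or4P => /negbTE ->; rewrite ?(mul0r, mulr0).
Qed.

Local Notation fseries := (Defs.series R).

Lemma peval_mball N (f : fseries) z : (forall p, (N < mdeg p)%N -> f p = 0) ->
  peval f z = \sum_(p <- mball N) (f p)%:C * cpow z p.
Proof.
move=> f0; rewrite fsbig_seq ?mball_uniq// /peval.
apply/esym/fsbig_widen => // p /= [_].
rewrite mem_mball => /negP; rewrite -ltnNge => /f0 ->.
by rewrite mul0r.
Qed.

Lemma poly_ip_mball N (f g : fseries) :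
  (forall p, (N < mdeg p)%N -> f p = 0) -> (forall p, (N < mdeg p)%N -> g p = 0) ->
  poly_ip f g = \sum_(p <- mball N) (mfact p)%:R * (f p * g p).
Proof.
move=> f0 g0; rewrite /poly_ip.
pose F (pq : midx * midx) (x : C4 R) := ((f pq.1 * g pq.2)%:C : R[i]) *
 (cpow (point4 x) pq.1 * conjc (cpow (point4 x) pq.2) *
     (expR (- \sum_i ComplexField.Normc.normc (point4 x i) ^+ 2))%:C).
pose v (pq : midx * midx) : R[i] := (f pq.1 * g pq.2)%:C *
  (if pq.1 == pq.2 then (pi ^+ 4 * (mfact pq.1)%:R)%:C else 0).
have H : has_cint lebesgue_C4 (fun x : C4 R =>
   let z := point4 x in peval f z * conjc (peval g z) *
      (expR (- \sum_i ComplexField.Normc.normc (z i) ^+ 2))%:C)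
  (\sum_(p <- mball N) \sum_(q <- mball N) v (p, q)).
  have := has_cint_sum (mball N) (fun p => has_cint_sum (mball N) (fun q =>
     has_cintZ (f p * g q)%:C (has_cint_C4 p q))).
  apply: eq_has_cint => // x /=.
  rewrite !(peval_mball _ f0, peval_mball _ g0) rmorph_sum/= mulr_suml mulr_suml.
  apply: eq_bigr => p _; rewrite mulr_sumr mulr_suml; apply: eq_bigr => q _.
  have -> : conjc ((g q)%:C * cpow (point4 x) q) = (g q)%:C * conjc (cpow (point4 x) q).
    by rewrite rmorphM; congr (_ * _); exact: conjc_real.
  by rewrite (rmorphM (real_complex R)); ring.
rewrite (has_cint_cintegral H) mulr_sumr.
rewrite (raddf_sum (@complex.Re R : {additive R[i] -> R})).
rewrite big_seq [RHS]big_seq; apply: eq_bigr => p pN.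
rewrite (bigD1_seq p) ?mball_uniq//= big1 => [|q qp]; last first.
  by rewrite /v/= eq_sym (negbTE qp) mulr0.
rewrite /v [X in if X then _ else _]eqxx addr0 -!(rmorphM (real_complex R)) [LHS]/=.
have pi0 : (pi : R) != 0 by rewrite gt_eqF// pi_gt0.
by move: (pi : R) pi0 => t t0; field.
Qed.

Lemma trunc_gt N (f : fseries) p : (N < mdeg p)%N -> trunc N f p = 0.
Proof. by move=> Np; rewrite /trunc leqNgt Np. Qed.

Lemma poly_ip_trunc N (f g : fseries) :
  poly_ip (trunc N f) (trunc N g) = \sum_(p <- mball N) (mfact p)%:R * (f p * g p).
Proof.
rewrite (@poly_ip_mball N); try exact: trunc_gt.
rewrite big_seq [RHS]big_seq; apply: eq_bigr => p.
by rewrite mem_mball /trunc => ->.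
Qed.

(** The monomials are orthogonal with squared norms [p!], so that truncation at
    degree [N] keeps exactly the terms of degree at most [N]. *)
Lemma fock_ipE (f g : fseries) :
  fock_ip f g = limn (fun N => \sum_(p <- mball N) (mfact p)%:R * (f p * g p)).
Proof. by rewrite /fock_ip; congr (limn _); apply/funext => N; exact: poly_ip_trunc. Qed.

End GaussianMoments.

(** * Absolutely summable families over multi-indices *)

Section MultiSeries.
Context {R : realType}.
Implicit Types (a b : midx -> R).

Lemma ler_sum_sub (I : eqType) (s t : seq I) (F : I -> R) :
  uniq s -> uniq t -> {subset s <= t} -> (forall i, 0 <= F i) ->
  \sum_(i <- s) F i <= \sum_(i <- t) F i.
Proof.
move=> us ut st F0; rewrite [leRHS](bigID (mem s))/= -[leLHS]addr0.
apply: lerD; last exact: sumr_ge0.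
rewrite -[leRHS]big_filter (perm_big [seq x <- t | x \in s]) //.
apply: uniq_perm => //; first exact: filter_uniq.
move=> x; rewrite mem_filter; case xs: (x \in s) => //=.
by rewrite st.
Qed.

Lemma sub_mball M N : (M <= N)%N -> {subset mball M <= mball N}.
Proof. by move=> MN p; rewrite !mem_mball => /leq_trans; apply. Qed.

Lemma sub_mball_mbox N : {subset mball N <= mbox N}.
Proof. by move=> p; rewrite mem_filter => /andP[]. Qed.

Lemma mdeg_mbox N p : p \in mbox N -> (mdeg p <= 4 * N)%N.
Proof.
rewrite mem_mbox => /forallP pN; rewrite /mdeg.
apply: (@leq_trans (\sum_(i < 4) N)%N); first by apply: leq_sum => i _.
by rewrite sum_nat_const card_ord.
Qed.

Lemma sub_mbox_mball N : {subset mbox N <= mball (4 * N)}.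
Proof. by move=> p /mdeg_mbox; rewrite mem_mball. Qed.

Lemma mbox_prod N (F : 'I_4 -> nat -> R) :
  \sum_(p <- mbox N) \prod_i F i (p i) = \prod_i \sum_(k < N.+1) F i k.
Proof.
rewrite (bigA_distr_bigA (fun i (k : 'I_N.+1) => F i k)) big_map big_enum/=.
by apply: eq_bigr => q _; apply: eq_bigr => i _; rewrite ffunE.
Qed.

(** Absolute summability with an explicit bound; the sum is taken along the
    degree balls, the order in which the inner product is defined. *)
Definition mabs a (M : R) := forall N, \sum_(p <- mball N) `|a p| <= M.

Definition mtsum a : R := limn (fun N => \sum_(p <- mball N) a p).

Lemma mball_sum_nd a : (forall p, 0 <= a p) ->
  nondecreasing_seq (fun N => \sum_(p <- mball N) a p).
Proof.
move=> a0 M N MN; apply: ler_sum_sub; rewrite ?mball_uniq//.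
exact: sub_mball.
Qed.

Lemma mabs_cvg a M : mabs a M ->
  (fun N => \sum_(p <- mball N) a p) @ \oo --> mtsum a.
Proof.
move=> aM.
have h1 : cvgn (fun N => \sum_(p <- mball N) `|a p|).
  apply: nondecreasing_is_cvgn; first exact: mball_sum_nd.
  by exists M => _ [N _ <-]; exact: aM.
have h2 : cvgn (fun N => \sum_(p <- mball N) (`|a p| + a p)).
  apply: nondecreasing_is_cvgn.
    by apply: mball_sum_nd => p; rewrite addrC -lerBlDr sub0r lerNl ler_normr lexx orbT.
  exists (M + M) => _ [N _ <-]; rewrite big_split/=; apply: lerD => //.
  by apply: le_trans (aM N); apply: ler_sum => p _; exact: ler_norm.
suff h : cvgn (fun N => \sum_(p <- mball N) a p) by exact: h.
rewrite (_ : (fun N => _) = (fun N => \sum_(p <- mball N) (`|a p| + a p)) -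
    (fun N => \sum_(p <- mball N) `|a p|)).
  exact: (is_cvgB h2 h1).
apply/funext => N; rewrite !fctE -sumrB; apply: eq_bigr => p _.
by rewrite addrC addKr.
Qed.

Lemma le_mtsum a M : mabs a M -> `|mtsum a| <= M.
Proof.
move=> aM.
have h : `|\sum_(p <- mball N) a p| @[N --> \oo] --> `|mtsum a|.
  exact: cvg_norm (mabs_cvg aM).
rewrite -(cvg_lim _ h)//; apply: limr_le; first exact: cvgP h.
apply: nearW => N; by apply: le_trans (aM N); exact: ler_norm_sum.
Qed.

Lemma le_mabs a b M : (forall p, `|a p| <= `|b p|) -> mabs b M -> mabs a M.
Proof. by move=> ab bM N; apply: le_trans (bM N); apply: ler_sum => p _. Qed.

Lemma mabsZ a M c : mabs a M -> mabs (fun p => c * a p) (`|c| * M).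
Proof.
move=> aM N; apply: le_trans (ler_wpM2l (normr_ge0 c) (aM N)).
by rewrite mulr_sumr; apply: ler_sum => p _; rewrite normrM.
Qed.

Lemma eq_mtsum a b : a =1 b -> mtsum a = mtsum b.
Proof. by move=> /funext ->. Qed.

Lemma mtsum_lin a b M K c : mabs a M -> mabs b K ->
  mtsum (fun p => c * a p + b p) = c * mtsum a + mtsum b.
Proof.
move=> aM bK; apply: cvg_lim => //.
rewrite (_ : (fun N => _) = fun N => c * (\sum_(p <- mball N) a p) + \sum_(p <- mball N) b p).
  by apply: cvgD; [apply: cvgM; [exact: cvg_cst|exact: mabs_cvg aM]|exact: mabs_cvg bK].
by apply/funext => N; rewrite big_split/= mulr_sumr.
Qed.

Lemma mtsum0 : mtsum (fun=> 0) = 0.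
Proof.
apply: cvg_lim => //; rewrite (_ : (fun N => _) = fun=> 0); first exact: cvg_cst.
by apply/funext => N; rewrite big1.
Qed.

(** The box of size [N] lies between the balls of radius [N] and [4 * N], and the
    mass between these two balls vanishes in the limit. *)
Lemma mtsum_box a M l : mabs a M ->
  (fun N => \sum_(p <- mbox N) a p) @ \oo --> l -> mtsum a = l.
Proof.
move=> aM al.
have aM' : mabs (fun p => `|a p|) M.
  by move=> N; under eq_bigr do rewrite normr_id.
have c4 : (fun N => \sum_(p <- mball (4 * N)) a p) @ \oo --> mtsum a.
  have := mabs_cvg aM; apply: cvg_comp.
  apply/cvgnyPge => A; near=> n; apply: (@leq_trans n); last by rewrite leq_pmull.
  by near: n; exact: nbhs_infty_ge.
suff d0 : (fun N => \sum_(p <- mball (4 * N)) a p - \sum_(p <- mbox N) a p) @ \oo --> (0 : R).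
  suff h : (fun N => \sum_(p <- mbox N) a p) @ \oo --> mtsum a - 0.
    by rewrite subr0 in h; exact: (cvg_unique (@Rhausdorff R) h al).
  rewrite (_ : (fun N => _) = fun N => \sum_(p <- mball (4 * N)) a p -
    (\sum_(p <- mball (4 * N)) a p - \sum_(p <- mbox N) a p)); first exact: cvgB c4 d0.
  by apply/funext => N; rewrite opprB addrC subrK.
have b4 : (fun N => \sum_(p <- mball (4 * N)) `|a p|) @ \oo --> mtsum (fun p => `|a p|).
  have := mabs_cvg aM'; apply: cvg_comp.
  apply/cvgnyPge => A; near=> n; apply: (@leq_trans n); last by rewrite leq_pmull.
  by near: n; exact: nbhs_infty_ge.
have e0 : (fun N => \sum_(p <- mball (4 * N)) `|a p| - \sum_(p <- mball N) `|a p|) @ \oo --> (0 : R).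
  suff : (fun N => \sum_(p <- mball (4 * N)) `|a p| - \sum_(p <- mball N) `|a p|) @ \oo -->
      mtsum (fun p => `|a p|) - mtsum (fun p => `|a p|) by rewrite subrr.
  by apply: cvgB; [exact: b4|exact: mabs_cvg aM'].
apply: (norm_cvg0 (squeeze_cvgr _ (cvg_cst 0) e0)).
apply: nearW => N; rewrite normr_ge0/=.
have D (F : midx -> R) (s : seq midx) : uniq s -> {subset s <= mball (4 * N)} ->
    \sum_(p <- mball (4 * N)) F p - \sum_(p <- s) F p = \sum_(p <- mball (4 * N) | p \notin s) F p.
  move=> us ss; rewrite [X in X - _](bigID (mem s))/= -big_filter.
  rewrite (perm_big s); first by rewrite addrC addrK.
  apply: uniq_perm => //; first by rewrite filter_uniq// mball_uniq.
  by move=> x; rewrite mem_filter; case xs: (x \in s) => //=; rewrite ss.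
rewrite D ?mbox_uniq//; last exact: sub_mbox_mball.
rewrite D ?mball_uniq//; last by apply: sub_mball; rewrite leq_pmull.
apply: le_trans (ler_norm_sum _ _ _) _.
rewrite !(big_mkcond (fun p => p \notin _))/=.
apply: ler_sum => p _; case: ifPn => [pb|_]; last by case: ifP.
rewrite ifT//; apply: contra pb; exact: sub_mball_mbox.
Unshelve. all: by end_near. Qed.

End MultiSeries.

Section Monomials.
Context {R : realType}.
Implicit Types (r : 'I_4 -> R).

Definition rpow r (p : midx) : R := \prod_i r i ^+ p i.

Lemma rpow_ge0 r p : (forall i, 0 <= r i) -> 0 <= rpow r p.
Proof. by move=> r0; apply: prodr_ge0 => i _; exact: exprn_ge0. Qed.

Lemma rpowM r s p : rpow (fun i => r i * s i) p = rpow r p * rpow s p.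
Proof. by rewrite /rpow -big_split/=; apply: eq_bigr => i _; rewrite exprMn. Qed.

Lemma rpow_cst (c : R) p : rpow (fun=> c) p = c ^+ mdeg p.
Proof. by rewrite /rpow /mdeg expr_sum. Qed.

Lemma le_rpow r s p : (forall i, 0 <= r i <= s i) -> rpow r p <= rpow s p.
Proof.
move=> rs; apply: ler_prod => i _; have /andP[r0 rsi] := rs i.
by rewrite exprn_ge0//= lerXn2r// nnegrE// (le_trans r0).
Qed.

Lemma normr_rpow r p : `|rpow r p| = rpow (fun i => `|r i|) p.
Proof. by rewrite /rpow normr_prod; apply: eq_bigr => i _; rewrite normrX. Qed.

Lemma mfact_gt0 p : 0 < (mfact p)%:R :> R.
Proof. by rewrite ltr0n prodn_gt0// => i; exact: fact_gt0. Qed.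

Lemma mfact_neq0 p : (mfact p)%:R != 0 :> R.
Proof. by rewrite gt_eqF// mfact_gt0. Qed.

Definition wt (p : midx) : R := Num.sqrt (mfact p)%:R.

Lemma wt_gt0 p : 0 < wt p.
Proof. by rewrite sqrtr_gt0 mfact_gt0. Qed.

Lemma wt_sqr p : wt p ^+ 2 = (mfact p)%:R.
Proof. by rewrite sqr_sqrtr// ler0n. Qed.

Lemma rpow_fact r p : rpow r p / (mfact p)%:R = \prod_i (exp_coeff (r i) (p i)).
Proof.
rewrite /rpow /mfact natr_prod -prodfV -big_split/=.
by apply: eq_bigr.
Qed.

(** Over a box the sum factors into four exponential series. *)
Lemma mabs_exp r : mabs (fun p => rpow r p / (mfact p)%:R) (\prod_i expR `|r i|).
Proof.
move=> N; apply: (@le_trans _ _ (\sum_(p <- mbox N) `|rpow r p / (mfact p)%:R|)).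
  by apply: ler_sum_sub; rewrite ?mball_uniq ?mbox_uniq//; exact: sub_mball_mbox.
have E p : `|rpow r p / (mfact p)%:R| = \prod_i exp_coeff `|r i| (p i).
  by rewrite normrM normfV (ger0_norm (ltW (mfact_gt0 p))) normr_rpow rpow_fact.
rewrite (eq_bigr _ (fun p _ => E p)).
rewrite (mbox_prod N (fun i k => exp_coeff `|r i| k)).
apply: ler_prod => i _; rewrite sumr_ge0/=; last by move=> k _; exact: exp_coeff_ge0.
have := exp_partial_le N.+1 (normr_ge0 (r i)).
by rewrite /series/= big_mkord.
Qed.

Lemma mtsum_exp r : mtsum (fun p => rpow r p / (mfact p)%:R) = expR (\sum_i r i).
Proof.
apply: mtsum_box (mabs_exp r) _.
rewrite (_ : (fun N => _) = fun N => \prod_i \sum_(k < N.+1) exp_coeff (r i) k); last first.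
  apply/funext => N; rewrite (eq_bigr _ (fun p _ => rpow_fact r p)).
  by rewrite (mbox_prod N (fun i k => exp_coeff (r i) k)).
rewrite expR_sum; apply: cvg_big => [|i _].
  by apply: mul_continuous.
have := @is_cvg_series_exp_coeff R (r i) => h.
have : series (exp_coeff (r i)) @ \oo --> expR (r i) by exact: h.
rewrite -cvg_shiftS; apply: cvg_trans; apply: near_eq_cvg; apply: nearW => N.
by rewrite /series/= big_mkord.
Qed.

End Monomials.

(** * The Hilbert norm and the Banach norm *)

Section FockAndB.
Context {R : realType}.
Local Notation fseries := (Defs.series R).
Local Notation Bnorm := (@Bnorm R).
Implicit Types (f g h : fseries) (r : 'I_4 -> R).

(** The partial sums in [Bnorm], at a point whose coordinates have absolute
    values [r]. *)
Definition bsum f r N : R := \sum_(p <- mball N) wt p * `|f p| * rpow r p.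

Definition half_ball r := (forall i, 0 <= r i) /\ \sum_i r i ^+ 2 < (1 / 2) ^+ 2.

Lemma bsum_ge0 f r N : (forall i, 0 <= r i) -> 0 <= bsum f r N.
Proof.
move=> r0; apply: sumr_ge0 => p _.
by rewrite mulr_ge0 ?rpow_ge0// mulr_ge0// ltW// wt_gt0.
Qed.

Local Notation normc := ComplexField.Normc.normc.

Lemma normc_cpow (z : 'I_4 -> R[i]) p : normc (cpow z p) = rpow (fun i => normc (z i)) p.
Proof.
apply: complexI; rewrite -[LHS]/(`|cpow z p|) /cpow normr_prod /rpow rmorph_prod.
by apply: eq_bigr => i _; rewrite normrX rmorphXn.
Qed.

Lemma normc_ge0 (z : R[i]) : 0 <= normc z.
Proof. by case: z => a b; exact: sqrtr_ge0. Qed.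

(** Only the absolute values of the coordinates matter, and every finite set of
    multi-indices lies in a ball: the supremum over complex points and the sum
    over all indices reduce to real points and degree balls. *)
Lemma Bnorm_leP f (M : R) :
  (Bnorm f <= M%:E)%E <-> (forall r, half_ball r -> forall N, bsum f r N <= M).
Proof.
have tE z p : `|Num.sqrt (mfact p)%:R * f p| * normc (cpow z p) =
    wt p * `|f p| * rpow (fun i => normc (z i)) p.
  by rewrite normrM (ger0_norm (sqrtr_ge0 _)) normc_cpow.
split=> [BM r [r0 rb] N|fM].
  rewrite -lee_fin; apply: le_trans BM.
  pose z i : R[i] := (r i)%:C%C.
  have zr : (fun i => normc (z i)) = r.
    by apply/funext => i; rewrite /z/= expr0n/= addr0 sqrtr_sqr ger0_norm.
  apply: le_trans (ereal_sup_ubound _); last first.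
    by exists z; [rewrite /= (eq_bigr (fun i => r i ^+ 2))// => i _; rewrite -[in RHS]zr|reflexivity].
  apply: esum_ge; exists [set` mball N].
    by split=> //; exact: finite_seq.
  rewrite -fsbig_seq ?mball_uniq// sumEFin lee_fin.
  by apply: ler_sum => p _; rewrite tE zr.
apply: ge_ereal_sup => _ [z /= zb <-].
apply: ge_ereal_sup => _ [A [finA _] <-].
have [s /= us As] : exists2 s : seq midx, uniq s & A = [set` s].
  move/finite_seqP: finA => [s ->]; exists (undup s); first exact: undup_uniq.
  by apply/seteqP; split=> p /=; rewrite mem_undup.
rewrite As -fsbig_seq// sumEFin lee_fin.
pose N := (\max_(p <- s) mdeg p)%N.
have rb : half_ball (fun i => normc (z i)) by split=> // i; exact: normc_ge0.
apply: le_trans (fM _ rb N); rewrite /bsum.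
rewrite (eq_bigr (fun p => wt p * `|f p| * rpow (fun i => normc (z i)) p)) => [|p _]; last exact: tE.
apply: ler_sum_sub; rewrite ?mball_uniq//.
  by move=> p ps; rewrite mem_mball /N; exact: leq_bigmax_seq.
by move=> p; rewrite mulr_ge0 ?rpow_ge0 ?mulr_ge0 ?(ltW (wt_gt0 _))//; move=> i; exact: normc_ge0.
Qed.

Lemma half_ball0 : half_ball (fun=> 0).
Proof. by split=> //; rewrite big1 ?exprn_gt0 ?divr_gt0// => i _; rewrite expr0n. Qed.

Lemma Bnorm_ge0 f : (0 <= Bnorm f)%E.
Proof.
case E : (Bnorm f) => [x| |] //.
  rewrite lee_fin; apply: le_trans (bsum_ge0 f 0 (r := fun=> 0) _) _ => //.
  by apply: (Bnorm_leP f x).1; [rewrite E|exact: half_ball0].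
have : (Bnorm f <= (-1)%:E)%E by rewrite E leNye.
move/Bnorm_leP => /(_ _ half_ball0 0%N) /(le_trans (bsum_ge0 f 0 (r := fun=> 0) (fun=> lexx 0))).
by rewrite lerNr oppr0 ler10.
Qed.

Lemma Bnorm_fin f : (Bnorm f < +oo)%E -> exists2 M, 0 <= M & Bnorm f = M%:E.
Proof.
by have := Bnorm_ge0 f; case: (Bnorm f) => [x| |]// x0 _; exists x.
Qed.

Lemma le_Bnorm f g : (forall p, `|f p| <= `|g p|) -> (Bnorm f <= Bnorm g)%E.
Proof.
move=> fg; have := Bnorm_ge0 g; case E : (Bnorm g) => [x| |] // _; last by rewrite leey.
apply/Bnorm_leP => r rb N; apply: le_trans ((Bnorm_leP g x).1 _ r rb N); last by rewrite E.
apply: ler_sum => p _; rewrite ler_wpM2r ?rpow_ge0//; first by case: rb.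
by rewrite ler_wpM2l// ltW// wt_gt0.
Qed.

Lemma le_BnormD f g : (Bnorm (fun p => f p + g p)%R <= Bnorm f + Bnorm g)%E.
Proof.
have := Bnorm_ge0 f; have := Bnorm_ge0 g.
case F : (Bnorm f) => [x| |] //; case G : (Bnorm g) => [y| |] // _ _; rewrite ?leey//.
apply/Bnorm_leP => r rb N.
apply: le_trans (lerD ((Bnorm_leP f x).1 _ r rb N) ((Bnorm_leP g y).1 _ r rb N)); rewrite ?F ?G//.
rewrite -big_split/=; apply: ler_sum => p _; rewrite -mulrDl -mulrDr.
rewrite ler_wpM2r ?rpow_ge0//; first by case: rb.
by rewrite ler_wpM2l ?ler_normD// ltW// wt_gt0.
Qed.

Lemma le_BnormB f g : (Bnorm (f - g)%R <= Bnorm f + Bnorm g)%E.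
Proof.
apply: le_trans (le_BnormD f (fun p => - g p)) _.
by apply: leeD => //; apply: le_Bnorm => p; rewrite normrN.
Qed.

Lemma le_BnormZ f g (c M : R) : 0 <= c -> (Bnorm g <= M%:E)%E ->
  (forall p, `|f p| <= c * `|g p|) -> (Bnorm f <= (c * M)%:E)%E.
Proof.
move=> c0 /Bnorm_leP gM fg; apply/Bnorm_leP => r rb N.
apply: le_trans (ler_wpM2l c0 (gM r rb N)); rewrite mulr_sumr; apply: ler_sum => p _.
rewrite mulrA ler_wpM2r ?rpow_ge0//; first by case: rb.
by rewrite mulrCA ler_wpM2l// ltW// wt_gt0.
Qed.

(** The squared distance of two Taylor polynomials is a difference of partial
    sums of [p! f_p^2], so being Cauchy amounts to these being bounded. *)
Lemma fockP f : fock R f <->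
  exists M : R, forall N, \sum_(p <- mball N) (mfact p)%:R * f p ^+ 2 <= M.
Proof.
pose S N := \sum_(p <- mball N) (mfact p)%:R * f p ^+ 2.
have S_nd : nondecreasing_seq S.
  by apply: mball_sum_nd => p; rewrite mulr_ge0 ?sqr_ge0// ler0n.
have D m n : (n <= m)%N -> poly_ip (trunc m f - trunc n f) (trunc m f - trunc n f) = S m - S n.
  move=> nm.
  have tr0 p : (m < mdeg p)%N -> (trunc m f - trunc n f) p = 0.
    by move=> mp; rewrite !fctE !trunc_gt ?subrr// (leq_ltn_trans nm).
  rewrite (poly_ip_mball tr0 tr0) /S.
  have -> : \sum_(p <- mball n) (mfact p)%:R * f p ^+ 2 =
      \sum_(p <- mball m) (if (mdeg p <= n)%N then (mfact p)%:R * f p ^+ 2 else 0).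
    rewrite -big_mkcond -[RHS]big_filter; apply: perm_big; apply: uniq_perm.
    - exact: mball_uniq.
    - by rewrite filter_uniq// mball_uniq.
    - move=> p; rewrite mem_mball mem_filter mem_mball; case pn: (mdeg p <= n)%N => //=.
      by rewrite (leq_trans pn nm).
  rewrite -sumrB big_seq [RHS]big_seq; apply: eq_bigr => p.
  rewrite mem_mball => pm; rewrite !fctE /trunc pm.
  by case: ifP => _; rewrite ?subrr ?mulr0// !subr0 expr2.
split=> [/(_ 1 ltr01) [N NS]|[M SM] e e0].
  exists (S N + 1) => n; have [nN|/ltnW Nn] := leqP n N.
    by rewrite (le_trans (S_nd _ _ nN))// lerDl.
  have := NS n N Nn (leqnn N); rewrite D// => /ltW.
  by rewrite lerBlDr addrC.
have Dsym m n : poly_ip (trunc m f - trunc n f) (trunc m f - trunc n f) = `|S m - S n|.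
  have [nm|/ltnW mn] := leqP n m.
    by rewrite D// ger0_norm// subr_ge0; exact: S_nd.
  rewrite distrC ger0_norm ?subr_ge0; last exact: S_nd.
  rewrite -D//.
  have tr0 p : (n < mdeg p)%N -> (trunc m f - trunc n f) p = 0.
    by move=> mp; rewrite !fctE !trunc_gt ?subrr// (leq_ltn_trans mn).
  have tr1 p : (n < mdeg p)%N -> (trunc n f - trunc m f) p = 0.
    by move=> mp; rewrite !fctE !trunc_gt ?subrr// (leq_ltn_trans mn).
  rewrite (poly_ip_mball tr0 tr0) (poly_ip_mball tr1 tr1); apply: eq_bigr => p _.
  by rewrite !fctE; ring.
have cS : S @ \oo --> limn S.
  apply: nondecreasing_is_cvgn => //; by exists M => _ [n _ <-]; exact: SM.
have e2 : 0 < e / 2 by rewrite divr_gt0.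
have /cvgrPdist_lt/(_ _ e2) [N _ NS] := cS.
exists N => m n Nm Nn; rewrite Dsym.
have -> : S m - S n = (limn S - S n) - (limn S - S m) by ring.
rewrite (le_lt_trans (ler_normB _ _))//.
by rewrite [ltRHS](splitr e) ltrD//; [exact: NS|exact: NS].
Qed.

Lemma fock_mabs f : fock R f -> exists M, mabs (fun p => (mfact p)%:R * f p ^+ 2) M.
Proof.
move=> /fockP [M fM]; exists M => N; apply: le_trans (fM N).
apply: ler_sum => p _.
by rewrite ger0_norm// mulr_ge0 ?sqr_ge0// ler0n.
Qed.

Lemma fockB f g : fock R f -> fock R g -> fock R (f - g).
Proof.
move=> /fockP [M fM] /fockP [K gK]; apply/fockP; exists (2 * M + 2 * K) => N.
apply: le_trans (lerD (ler_wpM2l _ (fM N)) (ler_wpM2l _ (gK N))) => //.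
rewrite !mulr_sumr -big_split/=; apply: ler_sum => p _.
rewrite !fctE !(mulrCA 2) -mulrDr ler_wpM2l ?ler0n//.
by have := sqr_ge0 (f p + g p); nra.
Qed.

Lemma fock_fin f D : (forall p, (D < mdeg p)%N -> f p = 0) -> fock R f.
Proof.
move=> f0; apply/fockP; exists (\sum_(p <- mball D) (mfact p)%:R * f p ^+ 2) => N.
have F0 p : 0 <= (mfact p)%:R * f p ^+ 2 by rewrite mulr_ge0 ?sqr_ge0// ler0n.
have [ND|/ltnW DN] := leqP N D; first exact: mball_sum_nd.
rewrite [leLHS](bigID (fun p => mdeg p <= D)%N)/= [X in _ + X]big1 ?addr0; last first.
  by move=> p; rewrite -ltnNge => /f0 ->; rewrite expr0n mulr0.
rewrite -big_filter; apply: ler_sum_sub => //.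
- by rewrite filter_uniq// mball_uniq.
- exact: mball_uniq.
- by move=> p; rewrite mem_filter => /andP[pD _]; rewrite mem_mball.
Qed.

(** The monomials [z ^ p] are square summable on the ball of radius [1/2], so
    the Fock norm dominates [Bnorm]. *)
Lemma fock_Bnorm f (e : R) : 0 < e ->
  (forall N, \sum_(p <- mball N) (mfact p)%:R * f p ^+ 2 <= e ^+ 2 / 4) ->
  (Bnorm f <= e%:E)%E.
Proof.
move=> e0 fe; apply/Bnorm_leP => r [r0 rb] N.
have rq i : r i ^+ 2 <= 4^-1.
  apply: le_trans (ltW (_ : _ < (1 / 2) ^+ 2)) _; last by rewrite expr_div_n expr1n; lra.
  by apply: le_lt_trans rb; rewrite (bigD1 i)//= lerDl sumr_ge0// => j _; exact: sqr_ge0.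
(* each coordinate contributes a geometric series of ratio at most 1/4, and
   (4/3)^4 <= 4 *)
have geo : \sum_(p <- mball N) rpow r p ^+ 2 <= 4.
  apply: (@le_trans _ _ (\sum_(p <- mbox N) rpow r p ^+ 2)).
    apply: ler_sum_sub; rewrite ?mball_uniq ?mbox_uniq//; first exact: sub_mball_mbox.
    by move=> p; exact: sqr_ge0.
  have E p : rpow r p ^+ 2 = \prod_i (r i ^+ 2) ^+ p i.
    by rewrite /rpow -prodrXl; apply: eq_bigr => i _; rewrite exprAC.
  rewrite (eq_bigr _ (fun p _ => E p)) (mbox_prod N (fun i k => (r i ^+ 2) ^+ k)).
  apply: (@le_trans _ _ (\prod_(i < 4) (4 / 3))); last first.
    by rewrite prodr_const card_ord; lra.
  apply: ler_prod => i _; rewrite sumr_ge0/=; last by move=> k _; rewrite exprn_ge0 ?sqr_ge0.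
  set x := r i ^+ 2; have x0 : 0 <= x by exact: sqr_ge0.
  have x4 : x <= 4^-1 by exact: rq.
  have : (1 - x) * (\sum_(k < N.+1) x ^+ k) <= 1.
    have := subrX1 x N.+1; rewrite -[x - 1]opprB -[x ^+ _ - 1]opprB mulNr => /oppr_inj <-.
    by rewrite gerBl exprn_ge0.
  set s := \sum_(k < N.+1) _.
  have s0 : 0 <= s by apply: sumr_ge0 => k _; rewrite exprn_ge0.
  nra.
(* Young's inequality, balanced so that both halves add up to e *)
apply: (@le_trans _ _ (\sum_(p <- mball N)
    (2 / e * ((mfact p)%:R * f p ^+ 2) + e / 8 * rpow r p ^+ 2))).
  apply: ler_sum => p _.
  have -> : (mfact p)%:R * f p ^+ 2 = (wt p * `|f p|) ^+ 2.
    by rewrite exprMn wt_sqr real_normK ?num_real.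
  set a := wt p * _; set b := rpow r p.
  have := sqr_ge0 (4 * a - e * b).
  move=> h; rewrite -subr_ge0 (_ : _ - _ = (4 * a - e * b) ^+ 2 / (8 * e)).
    by rewrite divr_ge0// mulr_ge0// ltW.
  by field; rewrite gt_eqF.
rewrite big_split/= -!mulr_sumr.
have e2 : 0 <= 2 / e by rewrite divr_ge0// ltW.
have e8 : 0 <= e / 8 by rewrite divr_ge0// ltW.
have h1 := ler_wpM2l e2 (fe N); have h2 := ler_wpM2l e8 geo.
apply: le_trans (lerD h1 h2) _.
by rewrite le_eqVlt; apply/orP; left; apply/eqP; field; rewrite gt_eqF.
Qed.

Lemma fock_Bnorm_fin f : fock R f -> (Bnorm f < +oo)%E.
Proof.
move=> /fockP [M fM].
apply: (@le_lt_trans _ _ (`|M| + 1)%:E%E); last exact: ltry.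
apply: fock_Bnorm; first by rewrite ltr_wpDl.
move=> N; apply: le_trans (fM N) _; apply: le_trans (ler_norm _) _.
by have := sqr_ge0 (`|M| - 1); nra.
Qed.

Lemma fock_BC4 f : fock R f -> BC4 R f.
Proof. by move=> ff e e0; exists f => //; rewrite subrr Bnorm0 lte_fin. Qed.

(** The completion is closed under limits. *)
Lemma BC4_lim f : (forall e : R, 0 < e -> exists2 g, BC4 R g & (Bnorm (f - g)%R < e%:E)%E) -> BC4 R f.
Proof.
move=> fg e e0; have e2 : 0 < e / 2 by rewrite divr_gt0.
have [g gB gf] := fg _ e2; have [h hF hg] := gB _ e2.
exists h => //; rewrite (_ : f - h = fun p => (f - g) p + (g - h) p).
  by apply: le_lt_trans (le_BnormD _ _) _; rewrite (splitr e) EFinD; exact: lteD.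
by apply/funext => p; rewrite !fctE addrA subrK.
Qed.

Lemma BC4B f g : BC4 R f -> BC4 R g -> BC4 R (f - g).
Proof.
move=> fB gB e e0; have e2 : 0 < e / 2 by rewrite divr_gt0.
have [h hF hf] := fB _ e2; have [k kF kg] := gB _ e2.
exists (h - k); first exact: fockB.
rewrite (_ : f - g - (h - k) = (f - h) - (g - k)).
  by apply: le_lt_trans (le_BnormB _ _) _; rewrite (splitr e) EFinD; exact: lteD.
by apply/funext => p; rewrite !fctE; ring.
Qed.

Lemma BC4_fin f : BC4 R f -> (Bnorm f < +oo)%E.
Proof.
move=> /(_ 1 ltr01) [h hF fh].
rewrite (_ : f = fun p => (f - h) p + h p); last first.
  by apply/funext => p; rewrite !fctE subrK.
apply: le_lt_trans (le_BnormD _ _) _.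
by apply: lte_add_pinfty; [exact: lt_trans fh (ltry _)|exact: fock_Bnorm_fin].
Qed.

(** Evaluation at any real point, also far outside the ball of radius [1/2],
    is bounded for [Bnorm]: the weights [wt p] beat every geometric growth. *)
Lemma Bnorm_eval f (M rho : R) : 0 <= rho -> (Bnorm f <= M%:E)%E ->
  mabs (fun p => f p * rho ^+ mdeg p) (expR (50 * rho ^+ 2) * M).
Proof.
move=> rho0 /Bnorm_leP fM N.
(* the point (1/5, 1/5, 1/5, 1/5) has norm 2/5 < 1/2; comparing with the
   exponential series at (5 rho)^2 in each variable gives the constant
   50 = 4 * 5^2 / 2 *)
pose r : 'I_4 -> R := fun=> 5^-1.
have rb : half_ball r.
  split=> [i|]; first by rewrite invr_ge0.
  by rewrite !big_ord_recl big_ord0 /r; lra.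
apply: le_trans (ler_wpM2l (expR_ge0 _) (fM r rb N)).
rewrite mulr_sumr; apply: ler_sum => p _.
rewrite rpow_cst normrM normrX (ger0_norm rho0).
suff key : rho ^+ mdeg p <= expR (50 * rho ^+ 2) * (wt p * 5^-1 ^+ mdeg p).
  rewrite [leRHS](_ : _ = `|f p| * (expR (50 * rho ^+ 2) * (wt p * 5^-1 ^+ mdeg p))); last by ring.
  by rewrite ler_wpM2l.
have c5 : (0 : R) < 5 ^+ mdeg p by rewrite exprn_gt0.
rewrite exprVn mulrA ler_pdivlMr// -exprMn.
rewrite -(@ler_pXn2r _ 2)// ?nnegrE ?exprn_ge0 ?mulr_ge0 ?expR_ge0 ?(ltW (wt_gt0 _))//.
rewrite [leRHS]exprMn wt_sqr -(expRM_natl 2) -exprM mulnC exprM.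
have := mabs_exp (fun=> (rho * 5) ^+ 2) (mdeg p).
rewrite (bigD1_seq p) ?mball_uniq ?mem_mball//= => h.
have {h} : `|rpow (fun=> (rho * 5) ^+ 2) p / (mfact p)%:R| <= \prod_(i < 4) expR `|(rho * 5) ^+ 2|.
  by apply: le_trans h; rewrite lerDl sumr_ge0.
rewrite rpow_cst ger0_norm; last by rewrite divr_ge0 ?ler0n// exprn_ge0// sqr_ge0.
rewrite prodr_const card_ord -expRM_natl (ger0_norm (sqr_ge0 _)) ler_pdivrMr ?mfact_gt0//.
by have -> : 2 * (50 * rho ^+ 2) = 4 * (rho * 5) ^+ 2 by ring.
Qed.

End FockAndB.

(** * Density of polynomials in the graph norm *)

Section Fejer.
Context {R : realType}.
Local Notation fseries := (Defs.series R).
Local Notation Bnorm := (@Bnorm R).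
Implicit Types (f g h : fseries) (r : 'I_4 -> R).

(** The Fejer weights: unlike sharp truncation, their variation from one degree
    to the next is at most [N^-1], which compensates the unboundedness of
    multiplication by [z_0]. *)
Definition fwt (N d : nat) : R := (N - d)%N%:R / N%:R.

Definition fejer N f : fseries := fun p => fwt N (mdeg p) * f p.

Lemma fwt_ge0 N d : 0 <= fwt N d.
Proof. by rewrite divr_ge0. Qed.

Lemma fwt_le1 N d : fwt N d <= 1.
Proof.
case: N => [|N]; first by rewrite /fwt invr0 mulr0.
by rewrite ler_pdivrMr ?ltr0n// mul1r ler_nat leq_subr.
Qed.

Lemma fwt0 N d : (N <= d)%N -> fwt N d = 0.
Proof. by rewrite /fwt => /eqP ->; rewrite mul0r. Qed.

Lemma fwtB N d : (0 < N)%N -> 0 <= fwt N d - fwt N d.+1 <= N%:R^-1.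
Proof.
move=> N0; rewrite /fwt -mulrBl -natrB ?leq_sub2l//.
rewrite divr_ge0//= -[leRHS]mul1r ler_wpM2r ?invr_ge0// -[1]/(1%:R) ler_nat.
lia.
Qed.

Lemma one_fwt N d D : (0 < N)%N -> (d <= D)%N -> 1 - fwt N d <= D%:R / N%:R.
Proof.
move=> N0 dD; have Nr : 0 < N%:R :> R by rewrite ltr0n.
rewrite lerBlDr -mulrDl ler_pdivlMr// mul1r -natrD ler_nat; lia.
Qed.

Lemma fejer_gt N f p : (N < mdeg p)%N -> fejer N f p = 0.
Proof. by move=> /ltnW Np; rewrite /fejer fwt0// mul0r. Qed.

Lemma le_fejer N f p : `|f p - fejer N f p| <= `|f p|.
Proof.
rewrite /fejer -{1}[f p]mul1r -mulrBl normrM ler_piMl//.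
by rewrite ger0_norm ?subr_ge0 ?fwt_le1// gerBl fwt_ge0.
Qed.

(** Low degrees converge because the weights tend to 1, and the tail is small
    uniformly in [N] because the weights are at most 1. *)
Lemma fock_fejer h (e : R) : fock R h -> 0 < e ->
  exists N0, forall N, (N0 <= N)%N -> (Bnorm (h - fejer N h)%R <= e%:E)%E.
Proof.
move=> hF e0; have [M hM] := fock_mabs hF.
pose a p := (mfact p)%:R * h p ^+ 2.
have a0 p : 0 <= a p by rewrite mulr_ge0 ?sqr_ge0// ler0n.
have cS := mabs_cvg hM.
pose d := e ^+ 2 / 8; have d0 : 0 < d by rewrite divr_gt0 ?exprn_gt0.
have /cvgrPdist_le/(_ _ d0) [D _ DS] := cS.
have tail N : \sum_(p <- mball N | (D < mdeg p)%N) a p <= d.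
  have := DS D (leqnn D); rewrite ler_distlC => /andP[h1 _].
  have h2 : \sum_(p <- mball (maxn N D)) a p <= mtsum a.
    have nd := mball_sum_nd a0; apply: (nondecreasing_cvgn_le nd).
    exact: cvgP cS.
  rewrite (bigID (fun p => (D < mdeg p)%N))/= in h2.
  have h3 : \sum_(p <- mball D) a p <= \sum_(p <- mball (maxn N D) | ~~ (D < mdeg p)%N) a p.
    rewrite -[leRHS]big_filter; apply: ler_sum_sub => //.
    - exact: mball_uniq.
    - by rewrite filter_uniq// mball_uniq.
    - move=> p; rewrite mem_mball mem_filter -leqNgt => pD.
      by rewrite pD mem_mball leq_max pD orbT.
  have h4 : \sum_(p <- mball N | (D < mdeg p)%N) a p <=
      \sum_(p <- mball (maxn N D) | (D < mdeg p)%N) a p.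
    rewrite -big_filter -[leRHS]big_filter; apply: ler_sum_sub => //.
    - by rewrite filter_uniq// mball_uniq.
    - by rewrite filter_uniq// mball_uniq.
    - move=> p; rewrite mem_filter => /andP[Dp pN]; rewrite mem_filter Dp/=.
      by apply: sub_mball pN; exact: leq_maxl.
  lra.
have M0 : 0 <= M.
  by apply: le_trans (hM 0%N); apply: sumr_ge0.
(* degrees up to D are damped by at most D / N *)
pose N0 := (Num.truncn (D%:R ^+ 2 * M / d)).+1.
exists (N0 + D).+1 => N N0N.
have N_gt0 : (0 < N)%N by exact: leq_ltn_trans N0N.
have Nr : 0 < N%:R :> R by rewrite ltr0n.
apply: fock_Bnorm => // K.
apply: (@le_trans _ _ (d + d)); last first.
  by rewrite /d le_eqVlt; apply/orP; left; apply/eqP; field.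
rewrite (bigID (fun p => (D < mdeg p)%N))/=; apply: lerD.
  apply: le_trans (tail K); apply: ler_sum => p _.
  rewrite ler_wpM2l ?ler0n// -[leLHS]real_normK ?num_real// -[leRHS]real_normK ?num_real//.
  by rewrite lerXn2r ?nnegrE//; exact: le_fejer.
apply: (@le_trans _ _ (\sum_(p <- mball K) (D%:R / N%:R) ^+ 2 * a p)).
  rewrite big_mkcond/=; apply: ler_sum => p _; case: ifPn => [|_]; last first.
    by rewrite mulr_ge0// sqr_ge0.
  rewrite -leqNgt => pD.
  rewrite !fctE /fejer -{1}[h p]mul1r -mulrBl exprMn mulrCA; apply: ler_wpM2r; first exact: a0.
  rewrite lerXn2r ?nnegrE ?divr_ge0 ?subr_ge0 ?fwt_le1//.
  exact: one_fwt.
rewrite -mulr_sumr.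
apply: (@le_trans _ _ ((D%:R / N%:R) ^+ 2 * M)).
  rewrite ler_wpM2l ?sqr_ge0//; apply: le_trans (hM K).
  by apply: ler_sum => p _; rewrite ler_norm.
have h1 : D%:R ^+ 2 * M / d < N%:R.
  by apply: (lt_le_trans (truncnS_gt _)); rewrite ler_nat -/N0; lia.
have N1 : 1 <= N%:R :> R by rewrite -[1]/(1%:R) ler_nat.
rewrite expr_div_n mulrAC ler_pdivrMr ?exprn_gt0//.
move: h1; rewrite ltr_pdivrMr// => h1; apply: le_trans (ltW h1) _.
rewrite mulrC ler_wpM2l ?(ltW d0)// expr2 ler_peMl//.
Qed.

Lemma BC4_fejer h (e : R) : BC4 R h -> 0 < e ->
  exists N0, forall N, (N0 <= N)%N -> (Bnorm (h - fejer N h)%R <= e%:E)%E.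
Proof.
move=> hB e0; have e2 : 0 < e / 2 by rewrite divr_gt0.
have [k kF hk] := hB _ e2; have [N0 kN] := fock_fejer kF e2.
exists N0 => N /kN kN'.
rewrite (_ : h - fejer N h = fun p => ((h - k) - fejer N (h - k)) p + (k - fejer N k) p).
  apply: le_trans (le_BnormD _ _) _; rewrite (splitr e) EFinD; apply: leeD => //.
  apply: le_trans (ltW hk); apply: le_Bnorm => p; exact: le_fejer.
by apply/funext => p; rewrite /fejer !fctE; ring.
Qed.

(** Multiplication and division of a monomial by [z_0]. *)
Definition mup (p : midx) : midx := [ffun i => if i == ord0 then (p i).+1 else p i].
Definition mdown (p : midx) : midx := [ffun i => if i == ord0 then (p i).-1 else p i].

Lemma d0E f p : d0 f p = (p ord0).+1%:R / 2 * f (mup p) -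
   (if p ord0 == 0%N then 0 else f (mdown p) / 2).
Proof. by []. Qed.

Lemma mdeg_up p : mdeg (mup p) = (mdeg p).+1.
Proof.
rewrite /mdeg (bigD1 ord0)//= ffunE eqxx addSn [in RHS](bigD1 ord0)//=.
by congr (_ + _).+1; apply: eq_bigr => i /negbTE i0; rewrite ffunE i0.
Qed.

Lemma mdownK (p : midx) : p ord0 != 0%N -> mup (mdown p) = p.
Proof.
move=> p0; apply/ffunP => i; rewrite !ffunE; case: eqP => [->|//].
by rewrite prednK// lt0n.
Qed.

Lemma mupK p : mdown (mup p) = p.
Proof. by apply/ffunP => i; rewrite !ffunE; case: eqP => [->|]. Qed.

Lemma mfact_up p : mfact (mup p) = ((p ord0).+1 * mfact p)%N.
Proof.
rewrite /mfact (bigD1 ord0)//= ffunE eqxx factS -mulnA [in RHS](bigD1 ord0)//=.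
by congr (_ * (_ * _))%N; apply: eq_bigr => i /negbTE i0; rewrite ffunE i0.
Qed.

Lemma rpow_up r p : rpow r (mup p) = r ord0 * rpow r p.
Proof.
rewrite /rpow (bigD1 ord0)//= ffunE eqxx exprS -mulrA [in RHS](bigD1 ord0)//=.
by congr (_ * (_ * _)); apply: eq_bigr => i /negbTE i0; rewrite ffunE i0.
Qed.

Lemma d0B f g : d0 (f - g) = d0 f - d0 g.
Proof. have E (F G : fseries) q : (F - G) q = F q - G q by [].
by apply/funext => p; rewrite E !d0E !E; case: ifP => _; ring. Qed.

(** Multiplication by [z_0] followed by truncation at degree [m ^ 2]; its norm
    grows like [m] because of the weights [wt]. *)
Definition raise (m : nat) f : fseries := fun p =>
  if (p ord0 != 0%N) && (mdeg p <= m ^ 2)%N then f (mdown p) else 0.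

Lemma Bnorm_raise m f (M : R) : (Bnorm f <= M%:E)%E -> (Bnorm (raise m f) <= (m%:R * M)%:E)%E.
Proof.
move=> /Bnorm_leP fM; apply/Bnorm_leP => r rb N; have [r0 rs] := rb.
apply: le_trans (ler_wpM2l (ler0n _ m) (fM r rb N)).
pose G p := wt p * `|raise m f p| * rpow r p.
have G0 p : 0 <= G p by rewrite mulr_ge0 ?rpow_ge0// mulr_ge0// ltW// wt_gt0.
have h1 : bsum (raise m f) r N <= \sum_(q <- map mup (mball N)) G q.
  rewrite (_ : bsum _ _ _ = \sum_(p <- mball N) G p)//.
  rewrite [leLHS](bigID (fun p : midx => p ord0 != 0%N))/= [X in _ + X]big1 ?addr0; last first.
    by move=> p /negbTE p0; rewrite /G /raise p0 normr0 mulr0 mul0r.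
  rewrite -big_filter; apply: ler_sum_sub => //.
  - by rewrite filter_uniq// mball_uniq.
  - by rewrite map_inj_uniq ?mball_uniq//; exact: can_inj mupK.
  - move=> p; rewrite mem_filter => /andP[p0 pN]; apply/mapP; exists (mdown p).
      move: pN; rewrite !mem_mball -{1}(mdownK p0) mdeg_up; exact: ltnW.
    by rewrite mdownK.
apply: le_trans h1 _; rewrite big_map mulr_sumr; apply: ler_sum => p _.
rewrite /G /raise ffunE eqxx/= mupK mdeg_up.
case: ifPn => [pm|_]; last first.
  by rewrite normr0 mulr0 mul0r !mulr_ge0 ?rpow_ge0// ltW// wt_gt0.
have r1 : r ord0 <= 1.
  rewrite -(@ler_pXn2r _ 2)// ?nnegrE// expr1n.
  apply: le_trans (ltW (_ : _ < (1 / 2) ^+ 2)) _; last by lra.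
  by apply: le_lt_trans rs; rewrite (bigD1 ord0)//= lerDl sumr_ge0// => j _; exact: sqr_ge0.
have w1 : wt (mup p) <= m%:R * wt p :> R.
  rewrite -(@ler_pXn2r _ 2)// ?nnegrE ?mulr_ge0 ?(ltW (wt_gt0 _))//.
  rewrite exprMn !wt_sqr mfact_up natrM ler_wpM2r ?ler0n// -natrX ler_nat.
  by apply: leq_trans pm; rewrite ltnS le_mdeg.
rewrite rpow_up -!mulrA (mulrA m%:R) ler_pM ?(ltW (wt_gt0 _))//.
  by rewrite !mulr_ge0 ?rpow_ge0.
rewrite ler_wpM2l// ler_piMl ?rpow_ge0//.
Qed.

(** The commutator of [d0] with Fejer summation: the differences of consecutive
    weights are at most [m ^- 2], against a growth of order [m] of the
    multiplication by [z_0] below degree [m ^ 2]. *)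
Lemma d0_fejer m h p : (0 < m)%N ->
  `|(d0 (fejer (m ^ 2) h) - fejer (m ^ 2) (d0 h)) p| <=
    (m ^ 2)%:R^-1 * `|d0 h p| + (m ^ 2)%:R^-1 * `|raise m h p|.
Proof.
move=> m0; set N := (m ^ 2)%N; have N0 : (0 < N)%N by rewrite expn_gt0 m0.
have Ni : 0 <= N%:R^-1 :> R by rewrite invr_ge0.
rewrite !fctE /fejer !d0E mdeg_up /raise.
have [/eqP p0|p0] := boolP (p ord0 == 0%N); rewrite /=.
  rewrite normr0 mulr0 addr0 !subr0 (mulrCA _ (fwt _ _)) -mulrBl normrM.
  rewrite ler_wpM2r// distrC; have /andP[h1 h2] := fwtB (mdeg p) N0.
  by rewrite ger0_norm.
have dp : mdeg p = (mdeg (mdown p)).+1 by rewrite -mdeg_up mdownK.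
set A := _ / 2 * h (mup p); set B := h (mdown p).
have -> : (p ord0).+1%:R / 2 * (fwt N (mdeg p).+1 * h (mup p)) -
   fwt N (mdeg (mdown p)) * B / 2 - fwt N (mdeg p) * (A - B / 2) =
   (fwt N (mdeg p).+1 - fwt N (mdeg p)) * (A - B / 2) +
   (fwt N (mdeg p).+1 - fwt N (mdeg (mdown p))) * B / 2.
  by rewrite /A; ring.
apply: le_trans (ler_normD _ _) _.
have /andP[h1 h2] := fwtB (mdeg p) N0.
have /andP[h3 h4] := fwtB (mdeg (mdown p)) N0; rewrite -dp in h3 h4.
apply: lerD.
  by rewrite normrM ler_wpM2r// distrC ger0_norm.
case: ifPn => [pN|]; last first.
  rewrite -ltnNge => Np; rewrite normr0 mulr0 !fwt0 ?subrr ?mul0r ?normr0//.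
  - by rewrite dp in Np.
  - by rewrite ltnW// ltnW.
rewrite !normrM (ger0_norm (_ : 0 <= 2^-1)) ?invr_ge0// mulrAC ler_wpM2r//.
rewrite distrC ger0_norm; last by rewrite -(subrKA (fwt N (mdeg p))) addr_ge0.
rewrite ler_pdivrMr// -(subrKA (fwt N (mdeg p))) mulr_natr mulr2n lerD//.
Qed.

Lemma d0_fin h D : (forall p, (D < mdeg p)%N -> h p = 0) ->
  forall p, (D.+1 < mdeg p)%N -> d0 h p = 0.
Proof.
move=> h0 p Dp; rewrite d0E h0 ?mulr0 ?sub0r; last by rewrite mdeg_up ltnW// ltnW.
case: ifPn => [_|p0]; first by rewrite oppr0.
by rewrite h0 ?mul0r ?oppr0//; move: Dp; rewrite -{1}(mdownK p0) mdeg_up.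
Qed.

(** The Fejer means approximate both [h] and [d0 h]: the mean of [d0 h] and
    [d0] of the mean differ by the commutator, which is [O (m^-1)]. *)
Lemma d0_density h (e : R) : BC4 R h -> BC4 R (d0 h) -> 0 < e ->
  exists k, [/\ exists D, forall p, (D < mdeg p)%N -> k p = 0,
     (Bnorm (h - k)%R <= e%:E)%E & (Bnorm (d0 h - d0 k)%R <= e%:E)%E].
Proof.
move=> hB dB e0; have e2 : 0 < e / 2 by rewrite divr_gt0.
have [N1 hN] := BC4_fejer hB e0; have [N2 dN] := BC4_fejer dB e2.
have [M1 M10 hM] := Bnorm_fin (BC4_fin hB).
have [M2 M20 dM] := Bnorm_fin (BC4_fin dB).
pose m0 := (Num.truncn ((M1 + M2) / (e / 2))).+1.
pose m := (m0 + N1 + N2)%N.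
have m_gt0 : (0 < m)%N by rewrite /m /m0 !addSn.
have mN : (m <= m ^ 2)%N by rewrite expnS expn1 leq_pmulr.
exists (fejer (m ^ 2) h); split.
- by exists (m ^ 2)%N => p; exact: fejer_gt.
- by apply: hN; apply: leq_trans mN; rewrite /m; lia.
rewrite (_ : d0 h - d0 _ = (d0 h - fejer (m ^ 2) (d0 h)) -
   (d0 (fejer (m ^ 2) h) - fejer (m ^ 2) (d0 h))); last first.
  by apply/funext => p; rewrite !fctE; ring.
apply: le_trans (le_BnormB _ _) _; rewrite (splitr e) EFinD; apply: leeD.
  by apply: dN; apply: leq_trans mN; rewrite /m; lia.
pose c : R := (m ^ 2)%:R^-1.
have c0 : 0 <= c by rewrite invr_ge0.
have mr : 0 < m%:R :> R by rewrite ltr0n.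
apply: (@le_trans _ _ (Bnorm (fun p => c * `|d0 h p| + c * `|raise m h p|)%R)).
  apply: le_Bnorm => p; rewrite [leRHS]ger0_norm; last by rewrite addr_ge0// mulr_ge0.
  exact: d0_fejer.
apply: le_trans (le_BnormD _ _) _.
apply: (@le_trans _ _ ((c * M2)%:E + (c * (m%:R * M1))%:E)%E).
  apply: leeD.
    apply: (le_BnormZ c0 (g := d0 h)); first by rewrite dM.
    by move=> p; rewrite normrM normr_id (ger0_norm c0).
  apply: (le_BnormZ c0 (g := raise m h)); first by apply: Bnorm_raise; rewrite hM.
  by move=> p; rewrite normrM normr_id (ger0_norm c0).
rewrite -EFinD lee_fin /c natrX.
have h1 : (M1 + M2) / (e / 2) < m%:R.
  by apply: (lt_le_trans (truncnS_gt _)); rewrite ler_nat -/m0 /m; lia.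
rewrite ltr_pdivrMr// in h1.
have m1 : 1 <= m%:R :> R by rewrite -[1]/(1%:R) ler_nat.
rewrite -mulrDr mulrC ler_pdivrMr ?exprn_gt0//.
apply: (@le_trans _ _ (m%:R * (M1 + M2))).
  by rewrite mulrDr addrC lerD2l ler_peMl.
by rewrite expr2 mulrCA ler_wpM2l ?ler0n// mulrC ltW// mulrC.
Qed.

End Fejer.

(** * Functionals of exponential type *)

Section Duality.
Context {R : realType}.
Local Notation fseries := (Defs.series R).
Local Notation Bnorm := (@Bnorm R).
Implicit Types (f g h : fseries) (u v y : twoform R).

(** [d0] is closed: a limit in the graph norm stays in its domain. *)
Lemma B0P f : B0 R f <-> BC4 R f /\ BC4 R (d0 f).
Proof.
split=> [fB|[fB dB] e e0]; last first.
  by exists f; [split|rewrite subrr /B0norm d00 Bnorm0 adde0 lte_fin].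
have le_l (a b : \bar R) (e : R) : (0 <= b)%E -> (a + b < e%:E)%E -> (a < e%:E)%E.
  by move=> b0; apply: le_lt_trans; rewrite leeDl.
have le_r (a b : \bar R) (e : R) : (0 <= a)%E -> (a + b < e%:E)%E -> (b < e%:E)%E.
  by move=> a0; apply: le_lt_trans; rewrite leeDr.
split; apply: BC4_lim => e e0; have [h [hB dB] fh] := fB _ e0.
  by exists h => //; apply: le_l fh; exact: Bnorm_ge0.
by exists (d0 h) => //; rewrite -d0B; apply: le_r fh; exact: Bnorm_ge0.
Qed.

Lemma B0B f g : B0 R f -> B0 R g -> B0 R (f - g).
Proof.
move=> /B0P[f1 f2] /B0P[g1 g2]; apply/B0P; rewrite d0B.
by split; exact: BC4B.
Qed.

(** A common name for the two kinds of components, so that what only uses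
    [Bnorm <= comp_norm] is proved once. *)
Definition comp_norm (ab : pair4) f : \bar R :=
  if fst4 ab == ord0 then d0B0norm f else B0norm f.

Definition comp_space (ab : pair4) : set fseries :=
  if fst4 ab == ord0 then d0B0 R else B0 R.

Lemma BB_comp_space u : BB R u <-> forall ab, comp_space ab (u ab).
Proof. by split=> uB ab; have := uB ab; rewrite /comp_space; case: ifP. Qed.

Lemma comp_spaceB ab f g : comp_space ab f -> comp_space ab g -> comp_space ab (f - g).
Proof.
rewrite /comp_space; case: ifP => _; last exact: B0B.
by move=> [x xB <-] [z zB <-]; exists (x - z); [exact: B0B|exact: d0B].
Qed.

Lemma comp_space_BC4 ab f : comp_space ab f -> BC4 R f.
Proof.
by rewrite /comp_space; case: ifP => _ => [[x /B0P[_ xB] <-]|/B0P[]].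
Qed.

Lemma le_comp_norm ab f : (Bnorm f <= comp_norm ab f)%E.
Proof.
rewrite /comp_norm; case: ifP => _; last by rewrite /B0norm leeDl ?Bnorm_ge0.
rewrite /d0B0norm leeDl//; apply: le_ereal_inf_tmp => _ [x _ <-].
exact: Bnorm_ge0.
Qed.

Lemma comp_norm_ge0 ab f : (0 <= comp_norm ab f)%E.
Proof. exact: le_trans (Bnorm_ge0 f) (le_comp_norm ab f). Qed.

Lemma le_BBnorm ab u : (Bnorm (u ab) <= BBnorm u)%E.
Proof.
apply: le_trans (le_comp_norm ab (u ab)) _; rewrite /BBnorm (bigD1 ab)//=.
by rewrite leeDl//; apply: sume_ge0 => cd _; exact: comp_norm_ge0.
Qed.

(** A component in the range of [d0] is approximated by [d0 k], with [k] a
    polynomial close to a preimage in the graph norm.  The error is counted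
    twice for the two terms of each component norm. *)
Lemma BB_density u (e : R) : BB R u -> 0 < e ->
  exists v, [/\ BB R v, fock_form R v & (BBnorm (u - v)%R <= (#|{: pair4}|%:R * (e + e))%:E)%E].
Proof.
move=> /BB_comp_space uB e0.
have H ab : exists g, [/\ comp_space ab g, fock R g & (comp_norm ab (u ab - g)%R <= (e + e)%:E)%E].
  have := uB ab; rewrite /comp_space /comp_norm; case: ifP => _.
    move=> [x xB xu]; have [x1 x2] := (B0P x).1 xB.
    have [k [[D kD] k1 k2]] := d0_density x1 x2 e0.
    have kB : B0 R k.
      by apply/B0P; split; apply: fock_BC4; [exact: fock_fin kD|exact: fock_fin (d0_fin kD)].
    exists (d0 k); split; [by exists k|exact: fock_fin (d0_fin kD)|].
    rewrite -xu /d0B0norm EFinD; apply: leeD => //.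
    apply: le_trans k1; apply: ereal_inf_lbound; exists (x - k) => //.
    by split; [exact: B0B|exact: d0B].
  move=> xB; have [x1 x2] := (B0P _).1 xB.
  have [k [[D kD] k1 k2]] := d0_density x1 x2 e0.
  exists k; split.
  - by apply/B0P; split; apply: fock_BC4; [exact: fock_fin kD|exact: fock_fin (d0_fin kD)].
  - exact: fock_fin kD.
  - by rewrite /B0norm EFinD d0B; apply: leeD.
have [v vP] := choice H.
exists v; split.
- by apply/BB_comp_space => ab; have [] := vP ab.
- by move=> ab; have [] := vP ab.
rewrite /BBnorm; apply: (@le_trans _ _ (\sum_(ab : pair4) (e + e)%:E)%E).
  by apply: lee_sum => ab _; have [] := vP ab.
by rewrite sumEFin sumr_const mulr_natl.
Qed.

(** Two bounded functionals that agree on a dense set are equal. *)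
Lemma extends_ip_unique y L1 L2 : extends_ip y L1 -> extends_ip y L2 -> L1 = L2.
Proof.
move=> [l1 [C1 b1] e1] [l2 [C2 b2] e2]; apply/funext => u.
have uB : BB R (val u) by exact/set_mem/(valP u).
apply/eqP; rewrite -subr_eq0 -normr_eq0 eq_le normr_ge0 andbT.
apply/ler_addgt0Pr => e e0; rewrite add0r.
pose c := #|{: pair4}|%:R : R.
have c0 : 0 <= c by exact: ler0n.
pose d := e / (2 * (c + 1) * (`|C1| + `|C2| + 1)).
have d0 : 0 < d by rewrite divr_gt0// !mulr_gt0// ltr_wpDl// addr_ge0.
have [v [vB vF uv]] := BB_density uB d0.
pose v' : BBtype R := exist _ v (mem_set vB).
have uvB : BB R (val u - v).
  by apply/BB_comp_space => ab; apply: comp_spaceB; [exact: (BB_comp_space _).1|exact: (BB_comp_space _).1].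
pose w : BBtype R := exist _ (val u - v) (mem_set uvB).
have wE : val w = (fun ab p => -1 * val v' ab p + val u ab p).
  by apply/funext => ab; apply/funext => p; rewrite mulN1r addrC.
have -> : L1 u - L2 u = L1 w - L2 w.
  have h1 : L1 v' = form_ip v y by exact: e1.
  have h2 : L2 v' = form_ip v y by exact: e2.
  by rewrite (l1 _ _ _ _ wE) (l2 _ _ _ _ wE) h1 h2; ring.
have bound (L : BBtype R -> R) (C : R) :
    (forall u : BBtype R, (`|L u|%:E <= C%:E * BBnorm (val u))%E) -> `|L w| <= `|C| * (c * (d + d)).
  move=> /(_ w) Lw; rewrite -lee_fin; apply: le_trans Lw _.
  have BBge0 : (0 <= BBnorm (val w))%E by apply: sume_ge0 => ab _; exact: comp_norm_ge0.
  apply: (@le_trans _ _ (`|C|%:E * BBnorm (val w))%E).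
    by rewrite lee_wpmul2r// lee_fin ler_norm.
  by rewrite [leRHS]EFinM lee_wpmul2l.
apply: le_trans (ler_normB _ _) _.
apply: le_trans (lerD (bound _ _ b1) (bound _ _ b2)) _.
rewrite -mulrDl.
have -> : e = (`|C1| + `|C2| + 1) * ((c + 1) * (d + d)).
  rewrite /d; field; rewrite !gt_eqF// ltr_wpDl// addr_ge0//.
by apply: ler_pM; rewrite ?addr_ge0 ?mulr_ge0 ?addr_ge0 ?(ltW d0)// ?lerDl// ler_wpM2r ?addr_ge0 ?(ltW d0)// lerDl.
Qed.

(** These vectors are in the dual, and the pairing with them is given by the
    same absolutely convergent series as the inner product. *)
Definition exp_type y := exists K rho : R, 0 <= rho /\
  forall ab p, (mfact p)%:R * `|y ab p| <= K * rho ^+ mdeg p.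

Lemma fock_ip_mtsum f g : fock_ip f g = mtsum (fun p => (mfact p)%:R * (f p * g p)).
Proof. exact: fock_ipE. Qed.

Lemma pair_mabs y K (rho : R) f M ab : 0 <= rho ->
  (forall ab p, (mfact p)%:R * `|y ab p| <= K * rho ^+ mdeg p) ->
  (Bnorm f <= M%:E)%E ->
  mabs (fun p => (mfact p)%:R * (f p * y ab p)) (`|K| * (expR (50 * rho ^+ 2) * M)).
Proof.
move=> rho0 yK fM; apply: le_mabs (mabsZ K (Bnorm_eval rho0 fM)) => p.
rewrite !normrM (ger0_norm (ltW (mfact_gt0 p))) mulrCA [leRHS]mulrCA ler_wpM2l//.
by apply: le_trans (yK ab p) _; rewrite -normrM ler_norm.
Qed.

Lemma exp_type_fock y : exp_type y -> fock_form R y.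
Proof.
move=> [K [rho [rho0 yK]]] ab; apply/fockP.
exists (K ^+ 2 * \prod_(i < 4) expR `|rho ^+ 2|) => N.
apply: le_trans (ler_wpM2l (sqr_ge0 K) (mabs_exp (fun=> rho ^+ 2) N)).
rewrite mulr_sumr; apply: ler_sum => p _.
rewrite rpow_cst ger0_norm; last by rewrite divr_ge0 ?ler0n// exprn_ge0// sqr_ge0.
rewrite [leRHS]mulrA ler_pdivlMr ?mfact_gt0// mulrAC -expr2 -exprM mulnC exprM -!exprMn.
rewrite -[leLHS]real_normK ?num_real// normrM (ger0_norm (ltW (mfact_gt0 p))).
have y0 : 0 <= (mfact p)%:R * `|y ab p| by rewrite mulr_ge0// ltW// mfact_gt0.
by rewrite lerXn2r ?nnegrE ?yK// (le_trans y0).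
Qed.

Lemma exp_type_extends y : exp_type y -> extends_ip y (fun u : BBtype R => form_ip (val u) y).
Proof.
move=> [K [rho [rho0 yK]]].
have fin (u : BBtype R) ab : exists2 M, 0 <= M & Bnorm (val u ab) = M%:E.
  apply: Bnorm_fin; apply: BC4_fin; apply: (@comp_space_BC4 ab).
  by apply: (BB_comp_space _).1; exact/set_mem/(valP u).
split=> [a u v w wE|| //].
  rewrite /form_ip mulr_sumr -big_split/=; apply: eq_bigr => ab _.
  have [M M0 uM] := fin u ab; have [N N0 vN] := fin v ab.
  rewrite !fock_ip_mtsum -(mtsum_lin (M := `|K| * (expR (50 * rho ^+ 2) * M))
    (K := `|K| * (expR (50 * rho ^+ 2) * N))).
  - apply: eq_mtsum => p.
    have -> : val w ab p = a * val u ab p + val v ab p by rewrite wE.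
    by rewrite -[val u]/(sval u) -[val v]/(sval v); ring.
  - by apply: pair_mabs => //; rewrite uM.
  - by apply: pair_mabs => //; rewrite vN.
exists (#|{: pair4}|%:R * (`|K| * expR (50 * rho ^+ 2))) => u.
(* for an infinite norm the bound is void, unless the constant is 0; then the
   functional vanishes *)
have [->|fu] := eqVneq (BBnorm (val u)) +oo%E.
  have [c0|c0] := eqVneq (#|{: pair4}|%:R * (`|K| * expR (50 * rho ^+ 2))) 0; last first.
    by rewrite gt0_muley ?leey// lte_fin lt_def c0/= mulr_ge0// mulr_ge0 ?expR_ge0.
  suff -> : form_ip (val u) y = 0 by rewrite normr0 c0 mul0e.
  apply: big1 => ab _; apply/eqP; rewrite -normr_eq0 eq_le normr_ge0 andbT.
  have [M M0 uM] := fin u ab.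
  rewrite fock_ip_mtsum; apply: le_trans (le_mtsum (pair_mabs ab rho0 yK (_ : (Bnorm (val u ab) <= M%:E)%E))) _.
    by rewrite uM.
  have n0 : (#|{: pair4}|%:R : R) != 0.
    by rewrite pnatr_eq0 -lt0n; apply/card_gt0P; exists ab.
  by move/eqP: c0; rewrite mulf_eq0 (negbTE n0)/= => /eqP c0; rewrite mulrA c0 mul0r.
have [N N0 uN] : exists2 N, 0 <= N & BBnorm (val u) = N%:E.
  have : (0 <= BBnorm (val u))%E by apply: sume_ge0 => ab _; exact: comp_norm_ge0.
  by case: (BBnorm _) fu => [x| |]// _ x0; exists x.
rewrite uN -EFinM lee_fin /form_ip; apply: le_trans (ler_norm_sum _ _ _) _.
apply: (@le_trans _ _ (\sum_(ab : pair4) (`|K| * expR (50 * rho ^+ 2) * N))); last first.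
  by rewrite le_eqVlt; apply/orP; left; apply/eqP; rewrite sumr_const -[LHS]mulr_natl mulrA.
apply: ler_sum => ab _.
rewrite fock_ip_mtsum -mulrA; apply: le_mtsum; apply: pair_mabs => //.
by rewrite -uN; exact: le_BBnorm.
Qed.

Lemma exp_type_dual y : exp_type y -> in_dual y.
Proof.
move=> ye; split; first exact: exp_type_fock.
by eexists; exact: exp_type_extends ye.
Qed.

Lemma sharpE (u : BBtype R) y : exp_type y -> sharp u y = form_ip (val u) y.
Proof.
move=> ye; have ex := exp_type_extends ye.
have := getPex (ex_intro (extends_ip y) _ ex).
by rewrite /sharp => /(extends_ip_unique ex) <-.
Qed.

End Duality.

(** * Weak integrals of coherent states *)

Section WeakIntegral.
Context {R : realType}.
Local Notation fseries := (Defs.series R).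
Local Notation plane := (measurableTypeR R * measurableTypeR R)%type.
Local Notation I2 := (@I2 R : set plane).
Implicit Types (w : plane -> 'rV[R]_4) (g : plane -> R).

Lemma measurable_I2 : measurable I2.
Proof. by apply: measurableX; exact: measurable_itv. Qed.

Lemma lebesgue_I2 : lebesgue_R2 I2 = 1%E.
Proof.
rewrite /lebesgue_R2 /sprod product_measure1E; try exact: measurable_itv.
have l1 : lebesgue_measure (`[0, 1]%classic : set R) = 1%E.
  by rewrite lebesgue_measure_itv/= lte_fin ltr01 oppr0 adde0.
by transitivity (1 * 1 : \bar R)%E; [congr (_ * _)%E|rewrite mule1].
Qed.

Lemma integrable_I2 g (M : R) : measurable_fun I2 g -> (forall x, I2 x -> `|g x| <= M) ->
  lebesgue_R2.-integrable I2 (EFin \o g).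
Proof.
move=> mg gM; apply: measurable_bounded_integrable => //.
- exact: measurable_I2.
- by rewrite [ltLHS]lebesgue_I2 ltry.
- exists M; split; first exact: num_real.
  by move=> N MN x xI; apply: le_trans (gM x xI) (ltW MN).
Qed.

Definition wpow w (x : plane) (p : midx) : R := rpow (fun i => w x 0 i) p.

(** What is needed to integrate [g x * chi (w x)] over the square. *)
Record bounded_data w g (rho G : R) : Prop := BoundedData {
  bd_w : forall i, measurable_fun I2 (fun x => w x 0 i);
  bd_g : measurable_fun I2 g;
  bd_rho : 0 <= rho;
  bd_wle : forall x i, I2 x -> `|w x 0 i| <= rho;
  bd_gle : forall x, I2 x -> `|g x| <= G }.

Section Data.
Variables (w : plane -> 'rV[R]_4) (g : plane -> R) (rho G : R).
Hypothesis wg : bounded_data w g rho G.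

Lemma wpow_le x p : I2 x -> `|wpow w x p| <= rho ^+ mdeg p.
Proof.
move=> xI; rewrite normr_rpow -rpow_cst; apply: le_rpow => i.
by rewrite normr_ge0 (bd_wle wg).
Qed.

Lemma measurable_wpow p : measurable_fun I2 (fun x => wpow w x p).
Proof.
rewrite /wpow /rpow.
apply: (@measurable_prod _ _ R I2 _ (index_enum 'I_4) (fun i x => w x 0 i ^+ p i)) => i _.
by apply: measurable_funX; exact: (bd_w wg).
Qed.

Lemma has_int_wpow p : has_int lebesgue_R2 I2 (fun x => g x * wpow w x p)
  (int_I2 (fun x => g x * wpow w x p)).
Proof.
split=> //; apply: (@integrable_I2 _ (G * rho ^+ mdeg p)).
  by apply: measurable_funM; [exact: (bd_g wg)|exact: measurable_wpow].
by move=> x xI; rewrite normrM ler_pM//; [exact: (bd_gle wg)|exact: wpow_le].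
Qed.

(** The weak integral of [g x * chi (w x)], computed coefficientwise. *)
Definition weak_int : fseries := fun p => int_I2 (fun x => g x * wpow w x p) / (mfact p)%:R.

Lemma weak_int_le p : (mfact p)%:R * `|weak_int p| <= G * rho ^+ mdeg p.
Proof.
rewrite /weak_int normrM normfV (ger0_norm (ltW (mfact_gt0 p))) mulrC divfK ?mfact_neq0//.
have [hi _] := has_int_wpow p.
apply: le_trans (le_normr_Rintegral measurable_I2 hi) _.
have -> : G * rho ^+ mdeg p = \int[lebesgue_R2]_(x in I2) (G * rho ^+ mdeg p).
  rewrite (Rintegral_cst lebesgue_R2 measurable_I2).
    by rewrite (_ : fine _ = 1) ?mulr1//; exact: (congr1 fine lebesgue_I2).
apply: le_Rintegral.
- exact: measurable_I2.
- exact: integrable_norm.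
- by apply: (@integrable_I2 _ `|G * rho ^+ mdeg p|).
- by move=> x xI; rewrite normrM ler_pM//; [exact: (bd_gle wg)|exact: wpow_le].
Qed.

(** Pairing with the weak integral is the integral of the pairings: dominated
    convergence along the Taylor polynomials of [f]. *)
Lemma has_int_entire f K : mabs (fun p => f p * rho ^+ mdeg p) K ->
  has_int lebesgue_R2 I2 (fun x => g x * mtsum (fun p => f p * wpow w x p))
   (mtsum (fun p => (mfact p)%:R * (f p * weak_int p))).
Proof.
move=> fK.
have fx x : I2 x -> mabs (fun p => f p * wpow w x p) K.
  move=> xI; apply: le_mabs fK => p; rewrite !normrM ler_wpM2l//.
  by rewrite (le_trans (wpow_le p xI))// ler_norm.
have hN N : has_int lebesgue_R2 I2 (fun x => \sum_(p <- mball N) f p * (g x * wpow w x p))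
    (\sum_(p <- mball N) f p * int_I2 (fun x => g x * wpow w x p)).
  apply: (@has_int_sum _ _ _ _ _ _ _ (fun p x => f p * (g x * wpow w x p))) => [|p].
    exact: measurable_I2.
  by apply: has_intZ; [exact: measurable_I2|exact: has_int_wpow].
have [] := @dominated_has_int _ _ _ lebesgue_R2 I2 _ _
   (fun x => g x * mtsum (fun p => f p * wpow w x p)) (fun=> G * K) measurable_I2 hN.
- move=> x xI.
  rewrite (_ : (fun N => _) = fun N => g x * \sum_(p <- mball N) f p * wpow w x p).
    by apply: cvgM; [exact: cvg_cst|exact: mabs_cvg (fx x xI)].
  by apply/funext => N; rewrite mulr_sumr; apply: eq_bigr => p _; rewrite mulrCA.
- by apply: (@integrable_I2 _ `|G * K|).
- move=> N x xI.
  rewrite (eq_bigr (fun p => g x * (f p * wpow w x p))) => [|p _]; last by rewrite mulrCA.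
  rewrite -mulr_sumr normrM; apply: ler_pM => //; first exact: (bd_gle wg).
  by apply: le_trans (ler_norm_sum _ _ _) _; exact: fx.
move=> hi cv.
suff -> : mtsum (fun p => (mfact p)%:R * (f p * weak_int p)) =
   \int[lebesgue_R2]_(x in I2) (g x * mtsum (fun p => f p * wpow w x p)) by [].
apply: cvg_lim => //; apply: cvg_trans cv; apply: near_eq_cvg; apply: nearW => N.
by apply: eq_bigr => p _; rewrite /weak_int mulrCA (mulrC (mfact p)%:R) divfK ?mfact_neq0.
Qed.

End Data.

Definition sgn (ab : pair4) : R := (-1) ^+ (fst4 ab * snd4 ab)%N.

Lemma xiE ab (v : 'rV[R]_4) cd p : xi ab v cd p =
  if cd == ab then sgn ab * psi v * (rpow (fun i => v 0 i) p / (mfact p)%:R) else 0.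
Proof. by rewrite /xi; case: ifP. Qed.

Lemma form_ip_supp (ab : pair4) (y h : twoform R) : (forall cd, cd != ab -> y cd = 0) ->
  form_ip y h = fock_ip (y ab) (h ab).
Proof.
move=> y0; rewrite /form_ip (bigD1 ab)//= big1 ?addr0// => cd /y0 ->.
rewrite fock_ip_mtsum -[RHS]mtsum0; apply: eq_mtsum => p.
by rewrite mul0r mulr0.
Qed.

Lemma fock_ipC (f h : fseries) : fock_ip f h = fock_ip h f.
Proof. by rewrite !fock_ip_mtsum; apply: eq_mtsum => p; rewrite (mulrC (f p)). Qed.

Lemma form_ipC (y h : twoform R) : form_ip y h = form_ip h y.
Proof. by apply: eq_bigr => ab _; exact: fock_ipC. Qed.

Lemma mtsumZ (a : midx -> R) c K : mabs a K -> mtsum (fun p => c * a p) = c * mtsum a.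
Proof.
move=> aK; have z : mabs (fun=> 0 : R) 0 by move=> N; rewrite big1// => p _; rewrite normr0.
have := mtsum_lin c aK z; rewrite mtsum0 addr0 => <-.
by apply: eq_mtsum => p; rewrite addr0.
Qed.

Lemma xi_exp_type ab (v : 'rV[R]_4) : exp_type (xi ab v).
Proof.
exists `|psi v|, (\sum_i `|v 0 i|); split; first exact: sumr_ge0.
move=> cd p; rewrite xiE; case: eqP => _; last first.
  by rewrite normr0 mulr0 mulr_ge0// exprn_ge0// sumr_ge0.
rewrite !normrM /sgn normrX normrN1 expr1n mul1r mulrCA ler_wpM2l//.
rewrite normfV (ger0_norm (ltW (mfact_gt0 p))) mulrC divfK ?mfact_neq0//.
rewrite normr_rpow -rpow_cst; apply: le_rpow => i.
by rewrite normr_ge0/= (bigD1 i)//= lerDl sumr_ge0.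
Qed.

Lemma form_ip_xi ab (v : 'rV[R]_4) (h : twoform R) K :
  mabs (fun p => h ab p * rpow (fun i => v 0 i) p) K ->
  form_ip (xi ab v) h = sgn ab * psi v * mtsum (fun p => h ab p * rpow (fun i => v 0 i) p).
Proof.
move=> hK; rewrite (@form_ip_supp ab); last by move=> cd /negbTE cdab; rewrite /xi cdab.
rewrite fock_ip_mtsum -(mtsumZ _ hK); apply: eq_mtsum => p.
by rewrite xiE eqxx; field; exact: mfact_neq0.
Qed.

End WeakIntegral.

Section WilsonLaw.
Context {R : realType}.
Local Notation fseries := (Defs.series R).
Local Notation plane := (measurableTypeR R * measurableTypeR R)%type.
Local Notation I2 := (@I2 R : set plane).

Lemma form_norm_sqr (y : twoform R) : exp_type y -> form_norm y ^+ 2 = form_ip y y.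
Proof.
move=> ye; rewrite /form_norm sqr_sqrtr//; apply: sumr_ge0 => ab _.
have /fock_mabs [M yM] := exp_type_fock ye ab.
rewrite fock_ip_mtsum.
have yM' : mabs (fun p => (mfact p)%:R * (y ab p * y ab p)) M.
  by move=> N; under eq_bigr => p _ do rewrite -expr2; exact: yM.
have cv := mabs_cvg yM'.
rewrite -(cvg_lim _ cv)//; apply: limr_ge; first exact: cvgP cv.
by apply: nearW => N; apply: sumr_ge0 => p _; rewrite mulr_ge0 ?ler0n// -expr2 sqr_ge0.
Qed.

Lemma fock_form_mabs (h : twoform R) ab (rho : R) : fock_form R h -> 0 <= rho ->
  exists K, mabs (fun p => h ab p * rho ^+ mdeg p) K.
Proof.
move=> hF rho0; have [M M0 hM] := Bnorm_fin (fock_Bnorm_fin (hF ab)).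
by eexists; apply: Bnorm_eval => //; rewrite hM.
Qed.

(** Testing against monomials recovers the Taylor coefficients, which makes weak
    integrals unique. *)
Lemma form_ip_inj (y z : twoform R) :
  (forall h, fock_form R h -> form_ip y h = form_ip z h) -> y = z.
Proof.
move=> yz; apply/funext => ab; apply/funext => p.
pose e : twoform R := fun cd q => if (cd == ab) && (q == p) then 1 else 0.
have eF : fock_form R e.
  move=> cd; apply: (@fock_fin _ _ (mdeg p)) => q pq; rewrite /e.
  by case: eqP => //= _; case: eqP pq => // ->; rewrite ltnn.
have E (x : twoform R) : form_ip x e = (mfact p)%:R * x ab p.
  rewrite form_ipC (@form_ip_supp _ ab); last first.
    by move=> cd /negbTE cdab; apply/funext => q; rewrite /e cdab.
  rewrite fock_ip_mtsum; apply: cvg_lim => //; apply: cvg_near_cst.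
  near=> N.
  rewrite (bigD1_seq p) ?mball_uniq//=; last first.
    by rewrite mem_mball; near: N; exact: nbhs_infty_ge.
  rewrite big1 ?addr0 => [|q /negbTE qp]; first by rewrite /e !eqxx mul1r.
  by rewrite /e qp andbF mul0r mulr0.
have := yz e eF; rewrite !E => /(mulfI (mfact_neq0 p)).
by [].
Unshelve. all: by end_near. Qed.

Lemma hilbert_int_unique (F : R * R -> twoform R) y : fock_form R y ->
  (forall h, fock_form R h -> form_ip y h = int_I2 (fun x => form_ip (F x) h)) ->
  hilbert_int_I2 F = y.
Proof.
move=> yF yh; have := getPex (ex_intro (fun y => fock_form R y /\ forall h, fock_form R h ->
         form_ip y h = int_I2 (fun x => form_ip (F x) h)) y (conj yF yh)).
rewrite -/(hilbert_int_I2 F) => -[zF zh].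
by apply: form_ip_inj => h hF; rewrite zh// yh.
Qed.

Lemma eq_int_I2 (f g : R * R -> R) : (forall x, I2 x -> f x = g x) -> int_I2 f = int_I2 g.
Proof. by move=> fg; apply: eq_Rintegral => x /set_mem/fg. Qed.

Section Surface.
Variables (c : pair4 -> plane -> R) (w : plane -> 'rV[R]_4) (rho C : R).

(** The scalar in front of [chi (w x)] in [c x *: xi ab (w x)]. *)
Definition xi_coef (ab : pair4) (x : plane) : R := c ab x * (sgn ab * psi (w x)).

Hypothesis bd : forall ab, bounded_data w (xi_coef ab) rho C.

Definition xi_integral : twoform R := fun ab => weak_int w (xi_coef ab).

Lemma xi_integral_exp_type : exp_type xi_integral.
Proof.
pose ab0 : pair4 := exist _ (ord0 : 'I_4, lift ord0 ord0 : 'I_4) isT.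
exists C, rho; split; first exact: bd_rho (bd ab0).
by move=> ab p; exact: weak_int_le (bd ab) p.
Qed.

Definition single (ab : pair4) (f : fseries) : twoform R := fun cd => if cd == ab then f else 0.

Lemma form_ip_scaled_xi ab x h K : I2 x -> mabs (fun p => h ab p * rho ^+ mdeg p) K ->
  form_ip (fun cd p => c ab x * xi ab (w x) cd p) h =
    xi_coef ab x * mtsum (fun p => h ab p * wpow w x p).
Proof.
move=> xI hK.
have hK' : mabs (fun p => h ab p * wpow w x p) K.
  apply: le_mabs hK => p; rewrite !normrM ler_wpM2l//.
  by rewrite (le_trans (wpow_le (bd ab) p xI))// ler_norm.
rewrite (@form_ip_supp _ ab); last first.
  by move=> cd /negbTE cdab; apply/funext => p; rewrite /xi cdab mulr0.
rewrite fock_ip_mtsum -(mtsumZ _ hK'); apply: eq_mtsum => p.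
by rewrite xiE eqxx /xi_coef /wpow; field; exact: mfact_neq0.
Qed.

Lemma hilbert_int_xi ab :
  hilbert_int_I2 (fun x cd p => c ab x * xi ab (w x) cd p) = single ab (xi_integral ab).
Proof.
apply: hilbert_int_unique => [cd|h hF].
  rewrite /single; case: eqP => _; first exact: exp_type_fock xi_integral_exp_type ab.
  exact: fock0.
have [K hK] := fock_form_mabs ab hF (bd_rho (bd ab)).
rewrite (@form_ip_supp _ ab); last by move=> cd /negbTE cdab; rewrite /single cdab.
rewrite /single eqxx fock_ipC fock_ip_mtsum.
rewrite (eq_int_I2 (g := fun x => xi_coef ab x * mtsum (fun p => h ab p * wpow w x p))); last first.
  by move=> x xI; exact: form_ip_scaled_xi xI hK.
by have [_ <-] := has_int_entire (bd ab) hK.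
Qed.

Lemma sum_hilbert_int_xi :
  \sum_(ab : pair4) hilbert_int_I2 (fun x cd p => c ab x * xi ab (w x) cd p) = xi_integral.
Proof.
rewrite (eq_bigr _ (fun ab _ => hilbert_int_xi ab)).
apply/funext => cd; rewrite fct_sumE (bigD1 cd)//= big1 ?addr0.
  by rewrite /single eqxx.
by move=> ab; rewrite /single eq_sym => /negbTE ->.
Qed.

(** Points of the Banach space are entire series with enough absolute summability
    for the weak integral to commute with the pairing. *)
Lemma has_int_sharp_xi (B : BBtype R) ab : has_int lebesgue_R2 I2
  (fun x => c ab x * sharp B (xi ab (w x))) (fock_ip (val B ab) (xi_integral ab)).
Proof.
have [K hK] : exists K, mabs (fun p => val B ab p * rho ^+ mdeg p) K.
  have [M M0 hM] : exists2 M, 0 <= M & Bnorm (val B ab) = M%:E.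
    apply: Bnorm_fin; apply: BC4_fin; apply: (@comp_space_BC4 _ ab).
    by apply: (BB_comp_space _).1; exact/set_mem/(valP B).
  by eexists; apply: Bnorm_eval (bd_rho (bd ab)) _; rewrite hM.
rewrite fock_ip_mtsum.
apply: (eq_has_int measurable_I2) (has_int_entire (bd ab) hK) => // x /set_mem xI.
rewrite sharpE; last exact: xi_exp_type.
have hK' : mabs (fun p => val B ab p * rpow (fun i => w x 0 i) p) K.
  apply: le_mabs hK => p; rewrite !normrM ler_wpM2l//.
  by rewrite (le_trans (wpow_le (bd ab) p xI))// ler_norm.
by rewrite form_ipC (form_ip_xi hK') /xi_coef [RHS]mulrA.
Qed.

Lemma sharp_xi_integral (B : BBtype R) :
  sharp B xi_integral = \sum_(ab : pair4) fock_ip (val B ab) (xi_integral ab).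
Proof. by rewrite (sharpE B xi_integral_exp_type). Qed.

(** The reproducing kernel [exp (w x . w x')] appears by integrating the
    exponential series twice. *)
Lemma has_int_xi_integral ab : has_int lebesgue_R2 I2
  (fun x => xi_coef ab x * int_I2 (fun x' => xi_coef ab x' * expR (\sum_i w x 0 i * w x' 0 i)))
  (fock_ip (xi_integral ab) (xi_integral ab)).
Proof.
have yF := exp_type_fock xi_integral_exp_type.
have [K hK] := fock_form_mabs ab yF (bd_rho (bd ab)).
rewrite fock_ip_mtsum.
apply: (eq_has_int measurable_I2) (has_int_entire (bd ab) hK) => // x /set_mem xI; congr (_ * _).
pose f p := wpow w x p / (mfact p)%:R.
have fK : mabs (fun p => f p * rho ^+ mdeg p) (\prod_(i < 4) expR `|rho ^+ 2|).
  apply: le_mabs (mabs_exp (fun=> rho ^+ 2)) => p.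
  rewrite rpow_cst /f mulrAC !normrM ler_wpM2r// exprAC expr2 normrM ler_wpM2r//.
  by apply: le_trans (wpow_le (bd ab) p xI) _; rewrite ler_norm.
have [_] := has_int_entire (bd ab) fK.
rewrite (eq_mtsum (b := fun p => xi_integral ab p * wpow w x p)) => [<-|p]; last first.
  by rewrite /f /xi_integral; field; exact: mfact_neq0.
apply: eq_int_I2 => x' _; congr (_ * _).
rewrite -mtsum_exp; apply: eq_mtsum => p.
by rewrite (rpowM (fun i => w x 0 i)) /f /wpow mulrAC.
Qed.

Lemma xi_integral_norm :
  form_norm xi_integral ^+ 2 = \sum_(ab : pair4) fock_ip (xi_integral ab) (xi_integral ab).
Proof. exact: form_norm_sqr xi_integral_exp_type. Qed.

End Surface.

End WilsonLaw.

(** * Continuous functions on the closed square *)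

Lemma cvg_sumr (R : realType) (T : Type) (F : set_system T) (FF : Filter F) (I : Type)
    (r : seq I) (f : I -> T -> R) (l : I -> R) :
  (forall i, f i @ F --> l i) -> (fun t => \sum_(i <- r) f i t) @ F --> \sum_(i <- r) l i.
Proof.
move=> fl; have -> : (fun t => \sum_(i <- r) f i t) = \sum_(i <- r) f i by rewrite fct_sumE.
elim: r => [|i r ih]; first by rewrite !big_nil; exact: cvg_cst.
by rewrite !big_cons; exact: cvgD.
Qed.

Section PlaneTopology.
Context {R : realType}.
Local Notation plane := (measurableTypeR R * measurableTypeR R)%type.
Local Notation I2 := (@I2 R).

(** An open set is the union of the rational open rectangles it contains. *)
Lemma open_plane_measurable (U : set (R * R)) : open U -> measurable (U : set plane).
Proof.
move=> oU.
pose rect (q : (rat * rat) * (rat * rat)) : set (R * R) :=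
  `]ratr q.1.1, ratr q.1.2[%classic `*` `]ratr q.2.1, ratr q.2.2[%classic.
pose F q := if `[< rect q `<=` U >] then rect q else set0.
have -> : U = \bigcup_q F q.
  apply/seteqP; split=> [[x1 x2] Ux|x [q _]]; last first.
    by rewrite /F; case: asboolP => // qU /qU.
  have /= [[A B] /= [A1 B2] ABU] := oU _ Ux.
  have [e1 /= e10 e1A] := A1; have [e2 /= e20 e2B] := B2.
  have rt (y e : R) : 0 < e -> exists a b : rat, ratr a < y < ratr b /\
      (forall z, ratr a < z < ratr b -> `|y - z| < e).
    move=> e0.
    have /rat_in_itvoo[a] : y - e < y by rewrite ltrBlDr ltrDl.
    have /rat_in_itvoo[b] : y < y + e by rewrite ltrDl.
    rewrite !in_itv/= => /andP[b1 b2] /andP[a1 a2]; exists a, b.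
    rewrite a2 b1; split=> // z /andP[z1 z2]; rewrite ltr_distlC.
    by rewrite (lt_trans a1 z1) (lt_trans z2 b2).
  have [a [b [ab1 abA]]] := rt x1 e1 e10; have [c [d [cd2 cdB]]] := rt x2 e2 e20.
  exists ((a, b), (c, d)) => //; rewrite /F; case: asboolP => [_|].
    by split; rewrite /= in_itv.
  case=> -[z1 z2] [/= z1i z2i]; apply: ABU; split=> /=.
    by apply: e1A; apply: abA; rewrite in_itv in z1i.
  by apply: e2B; apply: cdB; rewrite in_itv in z2i.
have [f bf] : exists f : nat -> (rat * rat) * (rat * rat), forall q, exists n, f n = q.
  exists (fun n => odflt ((0, 0), (0, 0)) (unpickle n)) => q.
  by exists (pickle q); rewrite pickleK.
have -> : \bigcup_q F q = \bigcup_n F (f n).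
  apply/seteqP; split=> x [q _ Fq]; last by exists (f q).
  by have [n nq] := bf q; exists n => //; rewrite nq.
apply: bigcupT_measurable => n; rewrite /F; case: ifP => _; last exact: measurable0.
by apply: measurableX; exact: measurable_itv.
Qed.

Lemma continuous_plane_measurable (f : R * R -> R) : continuous f ->
  measurable_fun setT (f : plane -> R).
Proof.
move=> /continuousP cf; apply: (measurability _ (RGenOpens.measurableE R)).
move=> _ [_ [a [b ->] <-]]; rewrite setTI; apply: open_plane_measurable.
exact/cf/interval_open.
Qed.

(** The nearest-point retraction onto the unit interval, and onto the square.
    Composing with it turns continuity within the square into continuity. *)
Definition clamp1 (t : R) : R := Num.max 0 (Num.min t 1).
Definition clamp (x : R * R) : R * R := (clamp1 x.1, clamp1 x.2).

Lemma clamp1_itv t : 0 <= clamp1 t <= 1.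
Proof. by rewrite /clamp1 le_max lexx/= ge_max ler01/= ge_min lexx orbT. Qed.

Lemma clamp_I2 x : I2 (clamp x).
Proof. by split; rewrite /= in_itv; exact: clamp1_itv. Qed.

Lemma clamp1_id t : 0 <= t <= 1 -> clamp1 t = t.
Proof. by move=> /andP[t0 t1]; rewrite /clamp1 (min_idPl t1) (max_idPr t0). Qed.

Lemma clamp_id x : I2 x -> clamp x = x.
Proof.
by case: x => x1 x2 [/= h1 h2]; rewrite /clamp !clamp1_id//.
Qed.

Lemma clamp1_lip s t : `|clamp1 s - clamp1 t| <= `|s - t|.
Proof.
have h1 := ler_norm (s - t); have h2 := ler_norm (t - s); rewrite distrC in h2.
have h3 := normr_ge0 (s - t).
rewrite ler_norml /clamp1 /Num.max /Num.min.
case: (ltP s 1) => s1; case: (ltP t 1) => t1; rewrite ?ltr01;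
  try case: (ltP 0 s) => s0; try case: (ltP 0 t) => t0; lra.
Qed.

Lemma continuous_clamp1 : continuous clamp1.
Proof.
move=> t; apply/cvgrPdist_lt => e e0; exists e => // s /= ts.
exact: le_lt_trans (clamp1_lip _ _) ts.
Qed.

Lemma continuous_clamp : continuous clamp.
Proof.
move=> x A [[U V] /= [nU nV] UVA].
exists (clamp1 @^-1` U, clamp1 @^-1` V); first by split; exact: continuous_clamp1.
by move=> y [y1 y2]; apply: UVA.
Qed.

Lemma within_continuous_clamp (f : R * R -> R) :
  {within I2, continuous f} -> continuous (f \o clamp).
Proof.
move=> /subspace_continuousP cf x A hA.
have hB : nbhs (clamp x) [set z | I2 z -> A (f z)] := cf _ (clamp_I2 x) _ hA.
have hC : nbhs x (clamp @^-1` [set z | I2 z -> A (f z)]) := continuous_clamp hB.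
change (nbhs x ((f \o clamp) @^-1` A)).
by apply: filterS hC => y h; apply: h; exact: clamp_I2.
Qed.

Lemma within_continuous_measurable (f : R * R -> R) :
  {within I2, continuous f} -> measurable_fun (I2 : set plane) (f : plane -> R).
Proof.
move=> cf; apply: (eq_measurable_fun (f \o clamp)).
  by move=> x /set_mem xI; rewrite /= clamp_id.
by apply: measurable_funTS; exact: continuous_plane_measurable (within_continuous_clamp cf).
Qed.

Lemma compact_I2 : compact I2.
Proof. by apply: compact_setX; exact: segment_compact. Qed.

Lemma within_continuous_bounded (f : R * R -> R) :
  {within I2, continuous f} -> exists2 M, 0 <= M & forall x, I2 x -> `|f x| <= M.
Proof.
move=> cf; have := continuous_compact cf compact_I2.
move/compact_bounded => [M [Mr MB]].
exists (`|M| + 1); first by rewrite addr_ge0.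
move=> x xI; apply: MB; last by exists x.
by rewrite ltr_pwDr// ler_norm.
Qed.

End PlaneTopology.

(** * Differentiability of the parametrization *)

Section StrictDifferentiability.
Context {R : realType}.
Local Notation I2 := (@I2 R).

Lemma nbhs01P (u : R) (P : R -> Prop) : (\forall v \near nbhs01 u, P v) ->
  exists2 e, 0 < e & forall v, `|u - v| < e -> v != u -> 0 <= v <= 1 -> P v.
Proof.
by move=> [e /= e0 eP]; exists e.
Qed.

(** In the interior the difference quotients inside the unit interval are
    ordinary ones, and at the end points they still give continuity, which is
    all that the mean value theorem asks for. *)
Lemma mvt01 (phi dphi : R -> R) (a b : R) : 0 <= a -> a <= b -> b <= 1 ->
  (forall u, 0 <= u <= 1 -> (phi v - phi u) / (v - u) @[v --> nbhs01 u] --> dphi u) ->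
  exists2 c, a <= c <= b & phi b - phi a = dphi c * (b - a).
Proof.
move=> a0 ab b1 dq.
have qe u : 0 <= u <= 1 -> forall e, 0 < e -> exists2 d, 0 < d &
    forall v, `|u - v| < d -> v != u -> 0 <= v <= 1 -> `|dphi u - (phi v - phi u) / (v - u)| < e.
  move=> u01 e e0; have /cvgrPdist_lt/(_ _ e0) := dq u u01; exact: nbhs01P.
have [||c cab ->] := @MVT_segment R phi dphi a b ab; last 1 first.
- by exists c => //; rewrite in_itv/= in cab.
- move=> x; rewrite in_itv/= => /andP[ax xb].
  have x0 : 0 < x by exact: le_lt_trans ax.
  have x1 : x < 1 by exact: lt_le_trans b1.
  have x01 : 0 <= x <= 1 by rewrite !ltW.
  have D : (fun h => h^-1 *: (phi (h *: 1 + x) - phi x)) @ 0^' --> dphi x.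
    apply/cvgrPdist_lt => e e0; have [d d0 dP] := qe x x01 e e0.
    pose m := Num.min d (Num.min x (1 - x)).
    have m0 : 0 < m by rewrite !lt_min d0 x0 subr_gt0 x1.
    exists m => // h /=; rewrite sub0r normrN !lt_min => /and3P[hd hx hx1] h0.
    rewrite /GRing.scale/= mulr1 [_^-1 * _]mulrC.
    have := dP (h + x); rewrite (_ : x - (h + x) = - h); last by ring.
    rewrite normrN addrK; apply => //.
      by rewrite -subr_eq0 addrK.
    move: hx hx1; rewrite !ltr_norml => /andP[h1 h2] /andP[h3 h4]; lra.
  by apply: DeriveDef; [exact: cvgP D|exact: cvg_lim D].
- apply/subspace_continuousP => x; rewrite /= in_itv/= => /andP[ax xb].
  have x01 : 0 <= x <= 1 by rewrite (le_trans a0 ax) (le_trans xb b1).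
  have [d d0 dP] := qe x x01 1 ltr01.
  apply/cvgrPdist_lt => e e0.
  pose m := Num.min d (e / (`|dphi x| + 1)).
  have c0 : 0 < `|dphi x| + 1 by rewrite ltr_wpDl.
  have m0 : 0 < m by rewrite lt_min d0 divr_gt0.
  exists m => // v /=; rewrite lt_min => /andP[vd ve]; rewrite in_itv/= => /andP[av vb].
  have [->|vx] := eqVneq v x; first by rewrite subrr normr0.
  have v01 : 0 <= v <= 1 by rewrite (le_trans a0 av) (le_trans vb b1).
  have := dP v vd vx v01; set q := _ / _ => hq.
  have vx0 : v - x != 0 by rewrite subr_eq0.
  have -> : phi x - phi v = q * (x - v).
    by rewrite /q; field.
  have q1 : `|q| <= `|dphi x| + 1.
    rewrite -[q](subKr (dphi x)); apply: le_trans (ler_normB _ _) _.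
    by rewrite lerD2l ltW.
  rewrite normrM; apply: le_lt_trans (ler_wpM2r (normr_ge0 _) q1) _.
  by rewrite mulrC -ltr_pdivlMr.
Qed.

Definition near2 (x y : R * R) (d : R) := `|x.1 - y.1| < d /\ `|x.2 - y.2| < d.

Lemma within_continuous_near2 (f : R * R -> R) x e : {within I2, continuous f} ->
  I2 x -> 0 < e -> exists2 d, 0 < d & forall y, near2 x y d -> I2 y -> `|f x - f y| < e.
Proof.
move=> /subspace_continuousP cf xI e0; have := cf x xI.
move=> /cvgrPdist_lt/(_ _ e0) [[A B] /= [[d1 /= d10 A1] [d2 /= d20 B2]] AB].
exists (Num.min d1 d2); first by rewrite lt_min d10.
move=> [y1 y2] []; rewrite /= !lt_min => /andP[h1 _] /andP[_ h2] yI.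
by apply: (AB (y1, y2)) => //; split; [exact: A1|exact: B2].
Qed.

(** A function with continuous partial derivatives is strictly
    differentiable: move first horizontally, then vertically. *)
Lemma strict_diff (f : R * R -> R) x e : C1_on_I2 f -> I2 x -> 0 < e ->
  exists2 d, 0 < d & forall p q, near2 x p d -> near2 x q d -> I2 p -> I2 q ->
   `|f q - f p - (Ds f x * (q.1 - p.1) + Dt f x * (q.2 - p.2))|
     <= e * (`|q.1 - p.1| + `|q.2 - p.2|).
Proof.
move=> [cs ct cDs cDt] xI e0.
have [d1 d10 D1] := within_continuous_near2 cDs xI e0.
have [d2 d20 D2] := within_continuous_near2 cDt xI e0.
exists (Num.min d1 d2); first by rewrite lt_min d10.
have box (a b c u r d : R) : `|u - a| < d -> `|u - b| < d -> a <= c <= b \/ b <= c <= a -> `|u - c| < d.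
  by rewrite !ltr_norml => /andP[h1 h2] /andP[h3 h4] [/andP[h5 h6]|/andP[h5 h6]]; lra.
have mv (phi dphi : R -> R) (a b : R) : 0 <= a <= 1 -> 0 <= b <= 1 ->
  (forall u, 0 <= u <= 1 -> (phi v - phi u) / (v - u) @[v --> nbhs01 u] --> dphi u) ->
  exists2 c, a <= c <= b \/ b <= c <= a & phi b - phi a = dphi c * (b - a).
  move=> /andP[a0 a1] /andP[b0 b1] dq; have [ab|/ltW ba] := leP a b.
    by have [c cab ->] := mvt01 a0 ab b1 dq; exists c => //; left.
  have [c cab e1] := mvt01 b0 ba a1 dq; exists c; first by right.
  by rewrite -[LHS]opprB e1 -mulrN opprB.
have in01 (a b c : R) : 0 <= a <= 1 -> 0 <= b <= 1 -> a <= c <= b \/ b <= c <= a -> 0 <= c <= 1.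
  by move=> /andP[? ?] /andP[? ?] [/andP[? ?]|/andP[? ?]]; lra.
case: x xI D1 D2 => x1 x2 xI D1 D2 [p1 p2] [q1 q2] [/= xp1 xp2] [/= xq1 xq2].
rewrite !lt_min in xp1 xp2 xq1 xq2.
move: xp1 xp2 xq1 xq2 => /andP[xp1 xp1'] /andP[xp2 xp2'] /andP[xq1 xq1'] /andP[xq2 xq2'].
move=> [/= p1I p2I] [/= q1I q2I].
rewrite !in_itv/= in p1I p2I q1I q2I.
have [c1 c1P E1] := mv (fun u => f (u, p2)) (fun u => Ds f (u, p2)) p1 q1 p1I q1I
  (fun u u01 => cs (u, p2) (conj u01 p2I)).
have [c2 c2P E2] := mv (fun u => f (q1, u)) (fun u => Dt f (q1, u)) p2 q2 p2I q2I
  (fun u u01 => ct (q1, u) (conj q1I u01)).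
have -> : f (q1, q2) - f (p1, p2) - (Ds f (x1, x2) * (q1 - p1) + Dt f (x1, x2) * (q2 - p2)) =
   (Ds f (c1, p2) - Ds f (x1, x2)) * (q1 - p1) + (Dt f (q1, c2) - Dt f (x1, x2)) * (q2 - p2).
  by move: E1 E2 => /= E1 E2; rewrite !mulrBl -E1 -E2; ring.
apply: le_trans (ler_normD _ _) _; rewrite !normrM mulrDr; apply: lerD.
  rewrite ler_wpM2r// ltW// distrC; apply: D1.
    by split => //=; exact: box xp1 xq1 c1P.
  by split; rewrite /= in_itv//=; exact: in01 c1P.
rewrite ler_wpM2r// ltW// distrC; apply: D2.
  by split => //=; exact: box xp2' xq2' c2P.
by split; rewrite /= in_itv//=; exact: in01 c2P.
Qed.

Lemma C1_continuous (f : R * R -> R) : C1_on_I2 f -> {within I2, continuous f}.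
Proof.
move=> fC; apply/subspace_continuousP => -[x1 x2] xI; apply/cvgrPdist_lt => e e0.
have [d d0 dP] := strict_diff fC xI (ltr01 : 0 < (1 : R)).
pose A := Ds f (x1, x2); pose B := Dt f (x1, x2); pose c := `|A| + `|B| + 2.
have c0 : 0 < c by rewrite ltr_wpDl// addr_ge0.
pose m := Num.min d (e / c).
have m0 : 0 < m by rewrite lt_min d0 divr_gt0.
exists ([set y | `|x1 - y| < m], [set y | `|x2 - y| < m]).
  by split; exists m.
move=> [y1 y2] [/= h1 h2] yI.
rewrite !lt_min in h1 h2; move: h1 h2 => /andP[h1 h1'] /andP[h2 h2'].
have xx : near2 (x1, x2) (x1, x2) d by split; rewrite subrr normr0.
have := dP (x1, x2) (y1, y2) xx (conj h1 h2) xI yI => /=.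
rewrite mul1r (distrC y1) (distrC y2) => h.
rewrite distrC.
rewrite ltr_pdivlMr// in h1'; rewrite ltr_pdivlMr// in h2'.
rewrite -/A -/B in h.
have -> : f (y1, y2) - f (x1, x2) = (f (y1, y2) - f (x1, x2) -
  (A * (y1 - x1) + B * (y2 - x2))) + (A * (y1 - x1) + B * (y2 - x2)) by ring.
apply: le_lt_trans (ler_normD _ _) _.
apply: le_lt_trans (lerD h (ler_normD _ _)) _.
rewrite !normrM (distrC y1) (distrC y2).
move: h1' h2'; rewrite /c; set s := `|x1 - y1|; set t := `|x2 - y2|.
have s0 : 0 <= s := normr_ge0 _; have t0 : 0 <= t := normr_ge0 _.
have A0 := normr_ge0 A; have B0 := normr_ge0 B.
move: (`|A|) (`|B|) A0 B0 => u v A0 B0 h1' h2'.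
have := mulr_ge0 B0 s0; have := mulr_ge0 A0 t0; have := mulr_ge0 A0 s0; have := mulr_ge0 B0 t0.
have [st|/ltW ts] := leP s t.
  have := ler_wpM2l A0 st; lra.
have := ler_wpM2l B0 ts; lra.
Qed.

End StrictDifferentiability.

Section Parametrized.
Context {R : realType}.
Local Notation plane := (measurableTypeR R * measurableTypeR R)%type.
Local Notation I2 := (@I2 R).
Variables (S : set 'rV[R]_4) (sigma : R * R -> 'rV[R]_4).
Hypothesis sigmaS : parametrization S sigma.

Local Notation s_ i := (Defs.coord sigma i).
Local Notation a_ i := (Ds (s_ i)).
Local Notation b_ i := (Dt (s_ i)).

Let C1 i : C1_on_I2 (s_ i). Proof. by have [] := sigmaS. Qed.

(** The coefficients of the first fundamental form, and its determinant. *)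
Definition ffE x : R := \sum_i a_ i x ^+ 2.
Definition ffF x : R := \sum_i a_ i x * b_ i x.
Definition ffG x : R := \sum_i b_ i x ^+ 2.
Definition gram x : R := ffE x * ffG x - ffF x ^+ 2.

Definition sdist2 (x y : R * R) : R := \sum_i (s_ i y - s_ i x) ^+ 2.

(** Lagrange's identity: the determinant is the sum of the squared 2x2 minors of
    the Jacobian. *)
Lemma gramE x : gram x = 2^-1 * \sum_i \sum_j (a_ i x * b_ j x - a_ j x * b_ i x) ^+ 2.
Proof.
rewrite /gram /ffE /ffF /ffG !big_ord_recl !big_ord0 !addr0.
by field.
Qed.

Lemma jacobianE x i (j : 'I_2) : Defs.jacobian sigma x i j = if j == 0 then a_ i x else b_ i x.
Proof. by rewrite mxE. Qed.

(** The Jacobian has a left inverse [N], and [det (N J) = 1] is a combination of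
    the 2x2 minors, which therefore cannot all vanish. *)
Lemma gram_gt0 x : I2 x -> 0 < gram x.
Proof.
move=> xI; have g0 : 0 <= gram x.
  rewrite gramE mulr_ge0 ?invr_ge0// sumr_ge0// => i _; apply: sumr_ge0 => j _; exact: sqr_ge0.
rewrite lt_def g0 andbT; apply/negP => /eqP gx0.
have minor i j : a_ i x * b_ j x - a_ j x * b_ i x = 0.
  have : \sum_i \sum_j (a_ i x * b_ j x - a_ j x * b_ i x) ^+ 2 = 0.
    by have := gramE x; rewrite gx0 => /esym/eqP; rewrite mulf_eq0 invr_eq0 pnatr_eq0/= => /eqP.
  move/eqP; rewrite psumr_eq0; last by move=> k _; apply: sumr_ge0 => l _; exact: sqr_ge0.
  move=> /allP/(_ i); rewrite mem_index_enum => /(_ isT)/=.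
  rewrite psumr_eq0; last by move=> l _; exact: sqr_ge0.
  move=> /allP/(_ j); rewrite mem_index_enum => /(_ isT)/=.
  by rewrite sqrf_eq0 => /eqP.
have [_ rk _ _] := sigmaS.
have : row_full (Defs.jacobian sigma x) by rewrite /row_full rk.
move=> /row_fullP [N NJ].
pose i0 : 'I_2 := 0; pose i1 : 'I_2 := 1.
have e (i j : 'I_2) : \sum_k N i k * Defs.jacobian sigma x k j = (i == j)%:R.
  by have := congr1 (fun M : 'M[R]_2 => M i j) NJ; rewrite !mxE.
have e00 := e i0 i0; have e11 := e i1 i1; have e01 := e i0 i1; have e10 := e i1 i0.
have : (\sum_k N i0 k * a_ k x) * (\sum_k N i1 k * b_ k x) -
       (\sum_k N i0 k * b_ k x) * (\sum_k N i1 k * a_ k x) = 1.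
  rewrite (eq_bigr _ (fun k _ => congr1 (fun t => N i0 k * t) (jacobianE x k i0))) in e00.
  rewrite (eq_bigr _ (fun k _ => congr1 (fun t => N i1 k * t) (jacobianE x k i1))) in e11.
  rewrite (eq_bigr _ (fun k _ => congr1 (fun t => N i0 k * t) (jacobianE x k i1))) in e01.
  rewrite /= in e00 e11 e01.
  by rewrite e00 e11 e01 mulr1 mul0r subr0.
rewrite !mulr_suml -sumrB big1; first by move/esym/eqP; rewrite oner_eq0.
move=> k _; rewrite !mulr_sumr -sumrB big1// => l _.
have := minor k l => h.
rewrite (_ : _ - _ = N i0 k * N i1 l * (a_ k x * b_ l x - a_ l x * b_ k x)); last by ring.
by rewrite h mulr0.
Qed.

Lemma ffEG_gt0 x : I2 x -> 0 < ffE x /\ 0 < ffG x.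
Proof.
move=> /gram_gt0; rewrite /gram => h.
have E0 : 0 <= ffE x by apply: sumr_ge0 => i _; exact: sqr_ge0.
have G0 : 0 <= ffG x by apply: sumr_ge0 => i _; exact: sqr_ge0.
have F0 := sqr_ge0 (ffF x).
have : 0 < ffE x * ffG x by lra.
rewrite !lt_def E0 G0 !andbT => /andP[+ _].
by rewrite mulf_eq0 negb_or => /andP[].
Qed.

Definition ff x (h1 h2 : R) : R := ffE x * h1 ^+ 2 + 2 * ffF x * h1 * h2 + ffG x * h2 ^+ 2.

Lemma ffS x h1 h2 : ff x h1 h2 = \sum_i (a_ i x * h1 + b_ i x * h2) ^+ 2.
Proof.
rewrite /ff /ffE /ffF /ffG mulr_sumr !mulr_suml -!big_split/=.
by apply: eq_bigr => i _; ring.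
Qed.

(** The smallest eigenvalue of a positive 2x2 matrix is at least the quotient
    of its determinant by its trace. *)
Lemma ff_ge x h1 h2 : I2 x ->
  gram x / (ffE x + ffG x) * (h1 ^+ 2 + h2 ^+ 2) <= ff x h1 h2.
Proof.
move=> xI; have [E0 G0] := ffEG_gt0 xI.
have EG : 0 < ffE x + ffG x by exact: addr_gt0.
rewrite mulrAC ler_pdivrMr// -subr_ge0 /ff /gram.
rewrite (_ : _ - _ = (ffE x * h1 + ffF x * h2) ^+ 2 + (ffF x * h1 + ffG x * h2) ^+ 2); last by ring.
by rewrite addr_ge0 ?sqr_ge0.
Qed.

Lemma sqrD_ge (u v w t : R) : `|v - u| <= w -> 0 <= w -> w ^+ 2 <= t -> v ^+ 2 >= u ^+ 2 / 2 - t.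
Proof.
move=> vu w0 wt.
have : (v - u) ^+ 2 <= t.
  by apply: le_trans wt; rewrite -[leLHS]real_normK ?num_real// lerXn2r ?nnegrE.
have := sqr_ge0 (u - 2 * (u - v)); nra.
Qed.

(** Strict differentiability with an error small compared with the least
    eigenvalue of the first fundamental form. *)
Lemma local_lower x : I2 x -> exists c d : R, [/\ 0 < c, 0 < d &
  forall p q, near2 x p d -> near2 x q d -> I2 p -> I2 q ->
   c * ((q.1 - p.1) ^+ 2 + (q.2 - p.2) ^+ 2) <= sdist2 p q].
Proof.
move=> xI; have [E0 G0] := ffEG_gt0 xI.
have EG : 0 < ffE x + ffG x by exact: addr_gt0.
pose l := gram x / (ffE x + ffG x).
have l0 : 0 < l by rewrite divr_gt0// gram_gt0.
(* the four squared errors then add up to at most l / 4 times the squared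
   distance, half of what the linear part provides *)
pose e := Num.sqrt (l / 32).
have e0 : 0 < e by rewrite sqrtr_gt0 divr_gt0.
have e2 : e ^+ 2 = l / 32 by rewrite sqr_sqrtr// ltW// divr_gt0.
have H i : exists2 d, 0 < d & forall p q, near2 x p d -> near2 x q d -> I2 p -> I2 q ->
   `|s_ i q - s_ i p - (a_ i x * (q.1 - p.1) + b_ i x * (q.2 - p.2))|
     <= e * (`|q.1 - p.1| + `|q.2 - p.2|) by exact: strict_diff.
have H' i : exists d : R, 0 < d /\
   forall p q, near2 x p d -> near2 x q d -> I2 p -> I2 q ->
   `|s_ i q - s_ i p - (a_ i x * (q.1 - p.1) + b_ i x * (q.2 - p.2))|
     <= e * (`|q.1 - p.1| + `|q.2 - p.2|).
  by have [d d0 dP] := H i; exists d.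
have [d dP] := choice H'.
pose m := \big[Num.min/1]_i d i.
have m0 : 0 < m by apply: lt_bigmin => // i _; have [] := dP i.
have md i : m <= d i by exact: bigmin_le_cond.
have nm p i : near2 x p m -> near2 x p (d i).
  by move=> [h1 h2]; split; [exact: lt_le_trans h1 _|exact: lt_le_trans h2 _].
exists (l / 4), m; split=> //; first by rewrite divr_gt0.
move=> p q xp xq pI qI.
set h1 := q.1 - p.1; set h2 := q.2 - p.2.
have key i : (a_ i x * h1 + b_ i x * h2) ^+ 2 / 2 - l / 16 * (h1 ^+ 2 + h2 ^+ 2) <= (s_ i q - s_ i p) ^+ 2.
  have [_ /(_ p q (nm p i xp) (nm q i xq) pI qI)] := dP i; rewrite -/h1 -/h2 => h.
  apply: sqrD_ge h _ _; first by rewrite mulr_ge0 ?addr_ge0// ltW.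
  rewrite exprMn e2 -[h1 ^+ 2]real_normK ?num_real// -[h2 ^+ 2]real_normK ?num_real//.
  have := sqr_ge0 (`|h1| - `|h2|); move: l0; clear; nra.
apply: (@le_trans _ _ (\sum_(i < 4) ((a_ i x * h1 + b_ i x * h2) ^+ 2 / 2 - l / 16 * (h1 ^+ 2 + h2 ^+ 2)))); last first.
  by apply: ler_sum => i _; exact: key.
rewrite sumrB -mulr_suml -ffS sumr_const card_ord.
have := ff_ge h1 h2 xI; rewrite -/l; move: (ff x h1 h2) => f hf.
rewrite -mulr_natl; lra.
Qed.

Lemma nbhs_near2 (x : R * R) d : 0 < d -> nbhs x [set p | near2 x p d].
Proof.
move=> d0; exists ([set t | `|x.1 - t| < d], [set t | `|x.2 - t| < d]).
  by split; exists d.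
by move=> p [].
Qed.

Lemma continuous_sclamp i : continuous (s_ i \o clamp).
Proof. by apply: within_continuous_clamp; exact: C1_continuous. Qed.

Lemma sdist2_gt0 x y : I2 x -> I2 y -> x != y -> 0 < sdist2 x y.
Proof.
move=> xI yI xy; have s0 : 0 <= sdist2 x y by apply: sumr_ge0 => i _; exact: sqr_ge0.
rewrite lt_def s0 andbT; apply: contra_neq xy => s0E.
have [_ _ inj _] := sigmaS; apply: inj; rewrite ?inE//.
apply/rowP => i; move/eqP: s0E; rewrite psumr_eq0; last by move=> k _; exact: sqr_ge0.
move=> /allP/(_ i); rewrite mem_index_enum => /(_ isT)/=.
by rewrite sqrf_eq0 subr_eq0 => /eqP.
Qed.

Lemma continuous_sdist2 :
  continuous (fun z : (R * R) * (R * R) => sdist2 (clamp z.1) (clamp z.2)).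
Proof.
have H i : continuous (fun z : (R * R) * (R * R) => (s_ i (clamp z.2) - s_ i (clamp z.1)) ^+ 2).
  move=> z.
  have c1 : (fun z : (R * R) * (R * R) => s_ i (clamp z.1)) @ z --> s_ i (clamp z.1).
    by apply: (@cvg_comp _ _ _ fst (s_ i \o clamp) _ (nbhs z.1)); [exact: cvg_fst|exact: continuous_sclamp].
  have c2 : (fun z : (R * R) * (R * R) => s_ i (clamp z.2)) @ z --> s_ i (clamp z.2).
    by apply: (@cvg_comp _ _ _ snd (s_ i \o clamp) _ (nbhs z.2)); [exact: cvg_snd|exact: continuous_sclamp].
  by apply: cvgM; exact: cvgB.
move=> z; exact: (cvg_sumr _ (fun i => H i z)).
Qed.

(** An injective immersion of a compact square is bi-Lipschitz: near the
    diagonal by [local_lower], away from it by injectivity. *)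
Lemma global_lower : exists2 c : R, 0 < c & forall x y, I2 x -> I2 y ->
  c * ((y.1 - x.1) ^+ 2 + (y.2 - x.2) ^+ 2) <= sdist2 x y.
Proof.
pose P (c : R) (z : (R * R) * (R * R)) := I2 z.1 -> I2 z.2 ->
  c * ((z.2.1 - z.1.1) ^+ 2 + (z.2.2 - z.1.2) ^+ 2) <= sdist2 z.1 z.2.
have cI : compact (I2 `*` I2) by apply: compact_setX; exact: compact_I2.
have /compact_near_coveringP/(_ R 0^'+ P _) cov := cI.
have : \forall c \near 0^'+, I2 `*` I2 `<=` P c.
  apply: cov => -[x y] [/= xI yI].
  have [<-|xy] := eqVneq x y.
    have [c [d [c0 d0 H]]] := local_lower xI.
    exists ([set z | near2 x z.1 d /\ near2 x z.2 d], [set t | t <= c]).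
      split; last by exact: nbhs_right_le.
      exists ([set p | near2 x p d], [set p | near2 x p d]); first by split; exact: nbhs_near2.
      by move=> z [].
    move=> [[p q] t] [/= [xp xq] tc] pI qI; apply: le_trans (H p q xp xq pI qI).
    by rewrite ler_wpM2r// addr_ge0 ?sqr_ge0.
  have D0 := sdist2_gt0 xI yI xy; set D := sdist2 x y in D0.
  exists ([set z | D / 2 < sdist2 (clamp z.1) (clamp z.2)], [set t | t <= D / 4]).
    split; last by apply: nbhs_right_le; rewrite divr_gt0.
    have DE : D / 2 < sdist2 (clamp x) (clamp y) by rewrite !clamp_id// -/D; lra.
    have hN : nbhs (sdist2 (clamp x) (clamp y)) [set t | D / 2 < t].
      by apply: open_nbhs_nbhs; split; [exact: open_gt|exact: DE].
    exact: (@continuous_sdist2 (x, y) _ hN).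
  move=> [[[p1 p2] [q1 q2]] t] /= [h tD] pI qI; rewrite !clamp_id// in h.
  apply: le_trans (ltW h).
  move: pI qI => [/=] ; rewrite !in_itv/= => /andP[? ?] /andP[? ?] [/=].
  rewrite !in_itv/= => /andP[? ?] /andP[? ?].
  have sq (u v : R) : 0 <= u -> u <= 1 -> 0 <= v -> v <= 1 -> (v - u) ^+ 2 <= 1.
    move=> u0 u1 v0 v1; have a0 : 0 <= 1 - (v - u) by lra.
    have b0 : 0 <= 1 + (v - u) by lra.
    have := mulr_ge0 a0 b0; nra.
  have h1 : (q1 - p1) ^+ 2 + (q2 - p2) ^+ 2 <= 2.
    by rewrite -[2]/(1 + 1); apply: lerD; apply: sq.
  have h0 : 0 <= (q1 - p1) ^+ 2 + (q2 - p2) ^+ 2 by rewrite addr_ge0 ?sqr_ge0.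
  move: tD h1 h0; move: (_ + _) => r tD h1 h0.
  have [t0|/ltW t0] := leP 0 t; last by apply: le_trans (mulr_le0_ge0 t0 h0) _; lra.
  nra.
move=> cn; have cn2 : \forall c \near (0 : R)^'+, I2 `*` I2 `<=` P c /\ 0 < c.
  by apply: filterI => //; exact: nbhs_right_gt.
have [c [cP c0]] := @filter_ex _ _ (at_right_proper_filter (0 : R)) _ cn2.
by exists c => // x y xI yI; apply: (cP (x, y)).
Qed.

End Parametrized.

(** * Rescaling in the plane *)

Section PlaneScaling.
Context {R : realType}.
Local Notation plane := (measurableTypeR R * measurableTypeR R)%type.
Local Notation leb := (@lebesgue_measure R).

Definition zoom (k : R) (x h : plane) : plane := (k^-1 * h.1 + x.1, k^-1 * h.2 + x.2).

Lemma measurable_zoom k x : measurable_fun setT (zoom k x).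
Proof.
apply: measurable_fun_pair; apply: measurable_funD => //; exact: measurable_funM.
Qed.

(** Tonelli, and one affine substitution in each variable. *)
Lemma ge0_integral_zoom (k : R) (x : plane) (F : plane -> \bar R) : 0 < k ->
  measurable_fun setT F -> (forall h, 0 <= F h)%E ->
  (\int[lebesgue_R2]_h F (zoom k x h) = (k ^+ 2)%:E * \int[lebesgue_R2]_h F h)%E.
Proof.
move=> k0 mF F0.
have k1 : k^-1 != 0 by rewrite invr_eq0 gt_eqF.
have kk : `|k^-1|^-1 = k by rewrite gtr0_norm ?invr_gt0// invrK.
have mG : measurable_fun setT (F \o zoom k x).
  exact: measurableT_comp mF (measurable_zoom k x).
transitivity (\int[leb \x leb]_h (F \o zoom k x) h)%E; first by [].
rewrite fubini_tonelli1//; last by move=> h; exact: F0.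
have mFF : measurable_fun setT (fubini_F leb F) by exact: measurable_fun_fubini_tonelli_F.
have FF0 u : (0 <= fubini_F leb F u)%E by apply: integral_ge0 => v _; exact: F0.
transitivity (\int[leb]_u (k%:E * (fubini_F leb F (k^-1 * u + x.1)%R)))%E.
  apply: eq_integral => u _; rewrite /fubini_F /zoom/=.
  have := @ge0_integral_affine R k^-1 x.2 (fun v => F ((k^-1 * u + x.1)%R, v)) k1.
  rewrite kk => ->//.
  by apply: measurableT_comp mF _; exact: pair1_measurable.
rewrite ge0_integralZl//=; last 2 first.
- apply: (measurableT_comp mFF); apply: measurable_funD => //; exact: measurable_funM.
- by rewrite lee_fin ltW.
rewrite (ge0_integral_affine x.1 k1 mFF FF0) kk muleA -EFinM -expr2; congr (_ * _)%E.
by rewrite -fubini_tonelli1.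
Qed.

(** The limit Gaussians; the factor [8] is the one in the reproducing kernel at
    scale [k / 2]. *)
Definition gauss2 (E F G : R) (h : plane) : R :=
  expR (- ((E * h.1 ^+ 2 + 2 * F * h.1 * h.2 + G * h.2 ^+ 2) / 8)).

Lemma measurable_gauss2 E F G : measurable_fun setT (gauss2 E F G).
Proof.
apply: measurableT_comp => //; apply: measurableT_comp => //.
apply: measurable_funM => //.
have m1 : measurable_fun setT (fst : plane -> R) by [].
have m2 : measurable_fun setT (snd : plane -> R) by [].
apply: measurable_funD; [apply: measurable_funD|].
- by apply: measurable_funM => //; exact: measurable_funX.
- by apply: measurable_funM => //; apply: measurable_funM.
- by apply: measurable_funM => //; exact: measurable_funX.
Qed.

Lemma has_int_gauss2 E F G : 0 < G -> 0 < E * G - F ^+ 2 ->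
  has_int lebesgue_R2 setT (gauss2 E F G) (8 * pi / Num.sqrt (E * G - F ^+ 2)).
Proof.
move=> G0 D0; apply: has_int_ge0 => //.
- exact: measurable_gauss2.
- by move=> h _; exact: expR_ge0.
- exact: integral_gauss2.
Qed.

End PlaneScaling.

Section OpenSquare.
Context {R : realType}.
Local Notation plane := (measurableTypeR R * measurableTypeR R)%type.
Local Notation I2 := (@I2 R : set plane).

(** The open square differs from the closed one by a null set, and leaves room
    around each of its points for rescaling. *)
Definition I2o : set plane := `]0, 1[%classic `*` `]0, 1[%classic.

Lemma measurable_I2o : measurable I2o.
Proof. by apply: measurableX; exact: measurable_itv. Qed.

Lemma sub_I2o : I2o `<=` I2.
Proof. by move=> x [h1 h2]; split; apply: subset_itv_oo_cc. Qed.

Lemma lebesgue_I2o : lebesgue_R2 I2o = 1%E.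
Proof.
rewrite /lebesgue_R2 /sprod product_measure1E; try exact: measurable_itv.
have l1 : lebesgue_measure (`]0, 1[%classic : set R) = 1%E.
  by rewrite lebesgue_measure_itv/= lte_fin ltr01 oppr0 adde0.
by transitivity (1 * 1 : \bar R)%E; [congr (_ * _)%E|rewrite mule1].
Qed.

Lemma lebesgue_boundary : lebesgue_R2 (I2 `\` I2o) = 0%E.
Proof.
rewrite measureD; [|exact: measurable_I2|exact: measurable_I2o|].
  rewrite setIidr; last exact: sub_I2o.
  by rewrite [X in (X - _)%E]lebesgue_I2 [X in (_ - X)%E]lebesgue_I2o subee.
by rewrite [ltLHS]lebesgue_I2 ltry.
Qed.

Lemma has_int_I2o f v : has_int lebesgue_R2 I2 f v -> has_int lebesgue_R2 I2o f v.
Proof.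
move=> [fi fv]; have DN : I2 `\` (I2 `\` I2o) = I2o by rewrite setDD setIidr//; exact: sub_I2o.
have mN : measurable (I2 `\` I2o) by apply: measurableD; [exact: measurable_I2|exact: measurable_I2o].
split; first by apply: integrableS fi; [exact: measurable_I2|exact: measurable_I2o|exact: sub_I2o].
rewrite -fv /Rintegral; congr fine.
rewrite [RHS](negligible_integral mN measurable_I2 fi lebesgue_boundary).
by rewrite DN.
Qed.

End OpenSquare.

(** * Laplace asymptotics *)

Section Laplace.
Context {R : realType}.
Local Notation plane := (measurableTypeR R * measurableTypeR R)%type.
Local Notation I2 := (@I2 R : set plane).
Variables (S : set 'rV[R]_4) (sigma : R * R -> 'rV[R]_4).
Hypothesis sigmaS : parametrization S sigma.
Variables (A : R * R -> R) (M : R).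
Hypothesis cA : {within I2, continuous A}.
Hypothesis A0 : forall x, I2 x -> 0 <= A x.
Hypothesis AM : forall x, I2 x -> A x <= M.

Local Notation s_ i := (Defs.coord sigma i).
Local Notation gram := (gram sigma).
Local Notation sdist2 := (sdist2 sigma).

Definition wgauss (k : R) (x y : plane) : R := A y * expR (- (k ^+ 2 / 8 * sdist2 x y)).

(** A Gaussian average of [A] around [x], at scale [1 / k] on the surface. *)
Definition gauss_avg (k : R) (x : plane) : R := k ^+ 2 * int_I2 (wgauss k x).

Definition zoomed (k : R) (x h : plane) : R := (wgauss k x \_ I2) (zoom k x h).

Lemma measurable_coord i : measurable_fun I2 (s_ i).
Proof.
apply: within_continuous_measurable; apply: C1_continuous.
by have [] := sigmaS.
Qed.

Lemma measurable_sdist2 x : measurable_fun I2 (sdist2 x : plane -> R).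
Proof.
rewrite /sdist2; apply: measurable_sum => i.
apply: measurable_funX; apply: measurable_funB => //; exact: measurable_coord.
Qed.

Lemma sdist2_ge0 x y : 0 <= sdist2 x y.
Proof. by apply: sumr_ge0 => i _; exact: sqr_ge0. Qed.

Lemma measurable_wgauss k x : measurable_fun I2 (wgauss k x).
Proof.
apply: measurable_funM; first exact: within_continuous_measurable.
apply: measurableT_comp => //; apply: measurableT_comp => //.
by apply: measurable_funM => //; exact: measurable_sdist2.
Qed.

Lemma wgauss_ge0 k x y : I2 y -> 0 <= wgauss k x y.
Proof. by move=> yI; rewrite mulr_ge0 ?expR_ge0 ?A0. Qed.

Lemma M_ge0 : 0 <= M.
Proof.
have I0 : I2 (0, 0) by split; rewrite /= in_itv/= lexx ler01.
exact: le_trans (A0 I0) (AM I0).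
Qed.

Lemma wgauss_le k x y : I2 y -> wgauss k x y <= M.
Proof.
move=> yI; rewrite -[leRHS]mulr1 ler_pM ?expR_ge0 ?A0 ?AM// -expR0 ler_expR.
by rewrite oppr_le0 mulr_ge0 ?sdist2_ge0// divr_ge0// sqr_ge0.
Qed.

Lemma has_int_wgauss k x : has_int lebesgue_R2 I2 (wgauss k x) (int_I2 (wgauss k x)).
Proof.
split=> //; apply: (@integrable_I2 _ _ M); first exact: measurable_wgauss.
by move=> y yI; rewrite ger0_norm ?wgauss_le ?wgauss_ge0.
Qed.

Lemma patch_wgauss_ge0 k x y : 0 <= (wgauss k x \_ I2) y.
Proof. by rewrite patchE; case: ifP => // /set_mem/wgauss_ge0. Qed.

Lemma measurable_patch_wgauss k x : measurable_fun setT (wgauss k x \_ I2).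
Proof. by apply/(measurable_restrictT _ measurable_I2); exact: measurable_wgauss. Qed.

(** The substitution [y = x + h / k] absorbs the factor [k ^+ 2]. *)
Lemma has_int_zoomed k x : 0 < k -> has_int lebesgue_R2 setT (zoomed k x) (gauss_avg k x).
Proof.
move=> k0; apply: has_int_ge0 => //.
- exact: measurableT_comp (measurable_patch_wgauss k x) (measurable_zoom k x).
- by move=> h _; exact: patch_wgauss_ge0.
rewrite /zoomed.
rewrite (@ge0_integral_zoom _ k x (EFin \o (wgauss k x \_ I2)))//; last 2 first.
- by apply/measurable_EFinP; exact: measurable_patch_wgauss.
- by move=> h; rewrite lee_fin patch_wgauss_ge0.
have [H _] := has_int_restrict lebesgue_R2 (wgauss k x) (int_I2 (wgauss k x)) measurable_I2.
by rewrite (has_int_EFin measurableT (H (has_int_wgauss k x))).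
Qed.

Section Bound.
Variable c : R.
Hypothesis c0 : 0 < c.
Hypothesis lower : forall x y, I2 x -> I2 y ->
  c * ((y.1 - x.1) ^+ 2 + (y.2 - x.2) ^+ 2) <= sdist2 x y.

(** The bi-Lipschitz bound gives a majorant that depends on neither [x] nor
    [k]. *)
Lemma zoomed_le k x h : I2 x -> 0 < k -> `|zoomed k x h| <= M * gauss2 c 0 c h.
Proof.
move=> xI k0; rewrite ger0_norm ?patch_wgauss_ge0// /zoomed patchE; case: ifP => [/set_mem yI|_]; last first.
  by rewrite mulr_ge0 ?M_ge0 ?expR_ge0.
rewrite ler_pM ?A0 ?AM ?expR_ge0// ler_expR lerN2.
have := lower xI yI; rewrite /zoom/= !addrK => h1.
have k2 : 0 <= k ^+ 2 / 8 by rewrite divr_ge0// sqr_ge0.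
apply: le_trans (ler_wpM2l k2 h1); rewrite le_eqVlt; apply/orP; left; apply/eqP.
by field; rewrite gt_eqF.
Qed.

Lemma integrable_zoomed_bound :
  lebesgue_R2.-integrable setT (EFin \o (fun h => M * gauss2 c 0 c h)).
Proof.
have D0 : 0 < c * c - 0 ^+ 2 by rewrite expr0n/= subr0 mulr_gt0.
by have [] := has_intZ M measurableT (has_int_gauss2 c0 D0).
Qed.

Lemma gauss_avg_le k x : I2 x -> 0 < k -> `|gauss_avg k x| <= M * (8 * pi / c).
Proof.
move=> xI k0; have [hi hv] := has_int_zoomed x k0.
have D0 : 0 < c * c - 0 ^+ 2 by rewrite expr0n/= subr0 mulr_gt0.
have [gi gv] := has_intZ M measurableT (has_int_gauss2 c0 D0).
have -> : M * (8 * pi / c) = M * (8 * pi / Num.sqrt (c * c - 0 ^+ 2)).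
  by rewrite expr0n/= subr0 -expr2 sqrtr_sqr gtr0_norm.
rewrite -hv -gv; apply: le_trans (le_normr_Rintegral measurableT hi) _.
apply: le_Rintegral => //; first exact: integrable_norm.
by move=> h _; exact: zoomed_le.
Qed.

Section Limit.
Variables (u : nat -> R) (x : plane).
Hypothesis u0 : forall n, 0 < u n.
Hypothesis uoo : u @ \oo --> +oo.
Hypothesis xI : I2o x.

Let y (h : plane) n := zoom (u n) x h.

Lemma zoom_cvg1 h : (y h n).1 @[n --> \oo] --> x.1.
Proof.
have v0 : (u n)^-1 @[n --> \oo] --> (0 : R).
  by apply/gtr0_cvgV0 => //; exact: nearW.
rewrite -[x.1]add0r -[X in X + _](mul0r h.1).
by apply: cvgD; [apply: cvgM => //; exact: cvg_cst|exact: cvg_cst].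
Qed.

Lemma zoom_cvg2 h : (y h n).2 @[n --> \oo] --> x.2.
Proof.
have v0 : (u n)^-1 @[n --> \oo] --> (0 : R).
  by apply/gtr0_cvgV0 => //; exact: nearW.
rewrite -[x.2]add0r -[X in X + _](mul0r h.2).
by apply: cvgD; [apply: cvgM => //; exact: cvg_cst|exact: cvg_cst].
Qed.

Lemma zoom_cvg h : y h @ \oo --> (x : R * R).
Proof.
move=> B [[U V] /= [nU nV] UVB].
have h1 : \forall n \near \oo, U (y h n).1 := zoom_cvg1 h nU.
have h2 : \forall n \near \oo, V (y h n).2 := zoom_cvg2 h nV.
by apply: filterS2 h1 h2 => n Un Vn; exact: UVB.
Qed.

Lemma zoom_I2 h : \forall n \near \oo, I2 (y h n).
Proof.
have [] := xI; rewrite /= !in_itv/= => /andP[x10 x11] /andP[x20 x21].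
near=> n; split; rewrite /= in_itv/=; apply/andP; split; apply: ltW; near: n.
- exact: (cvgr_gt _ (zoom_cvg1 h)).
- exact: (cvgr_lt _ (zoom_cvg1 h)).
- exact: (cvgr_gt _ (zoom_cvg2 h)).
- exact: (cvgr_lt _ (zoom_cvg2 h)).
Unshelve. all: by end_near. Qed.

Lemma zoom_near2 h d : 0 < d -> \forall n \near \oo, near2 x (y h n) d.
Proof.
move=> d0; near=> n; split; near: n.
  by have /cvgrPdist_lt/(_ _ d0) := zoom_cvg1 h.
by have /cvgrPdist_lt/(_ _ d0) := zoom_cvg2 h.
Unshelve. all: by end_near. Qed.

Lemma cvg_zoom_coord h i :
  u n * (s_ i (y h n) - s_ i x) @[n --> \oo] --> Ds (s_ i) x * h.1 + Dt (s_ i) x * h.2.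
Proof.
apply/cvgrPdist_le => e e0.
pose b := `|h.1| + `|h.2| + 1; have b0 : 0 < b by rewrite ltr_wpDl// addr_ge0.
have e'0 : 0 < e / b by rewrite divr_gt0.
have C1 : C1_on_I2 (s_ i) by have [] := sigmaS.
have [d d0 dP] := strict_diff C1 (sub_I2o xI) e'0.
have xx : near2 x x d by split; rewrite subrr normr0.
near=> n.
have yI : I2 (y h n) by near: n; exact: zoom_I2.
have yd : near2 x (y h n) d by near: n; exact: zoom_near2.
have := dP x (y h n) xx yd (sub_I2o xI) yI; rewrite /y /zoom/= !addrK.
set sy := s_ i _; set sx := s_ i x; set a := Ds _ _; set b' := Dt _ _.
have un := u0 n; have un0 : u n != 0 by rewrite gt_eqF.
rewrite !normrM (@ger0_norm _ (u n)^-1); last by rewrite invr_ge0 ltW.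
move=> H; have := ler_wpM2l (ltW un) H.
rewrite -{1}(gtr0_norm un) -normrM.
rewrite (_ : u n * (sy - sx - _) = - (a * h.1 + b' * h.2 - u n * (sy - sx))); last by field.
rewrite normrN => {}H; apply: le_trans H _.
rewrite (_ : u n * _ = e * ((`|h.1| + `|h.2|) / b)); last by field; rewrite gt_eqF.
apply: ler_piMr; first exact: ltW.
by rewrite ler_pdivrMr// mul1r /b lerDl.
Unshelve. all: by end_near. Qed.

Lemma cvg_zoom_sdist2 h : u n ^+ 2 * sdist2 x (y h n) @[n --> \oo] --> ff sigma x h.1 h.2.
Proof.
rewrite ffS /sdist2.
have -> : (fun n => u n ^+ 2 * \sum_i (s_ i (y h n) - s_ i x) ^+ 2) =
    fun n => \sum_i (u n * (s_ i (y h n) - s_ i x)) ^+ 2.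
  by apply/funext => n; rewrite mulr_sumr; apply: eq_bigr => i _; rewrite exprMn.
by apply: cvg_sumr => i; apply: cvgM; exact: cvg_zoom_coord.
Qed.

Lemma cvg_zoom_A h : A (y h n) @[n --> \oo] --> A x.
Proof.
have cAc := within_continuous_clamp cA.
have H : (A \o clamp) (y h n) @[n --> \oo] --> A x.
  have := cAc x; rewrite /continuous_at /= clamp_id; last exact: sub_I2o.
  by move=> H; exact: (@cvg_comp _ _ _ (y h) (A \o clamp) \oo (nbhs x) (nbhs (A x)) (zoom_cvg h) H).
apply: cvg_trans H; apply: near_eq_cvg.
near=> n; have yI : I2 (y h n) by near: n; exact: zoom_I2.
by rewrite /= clamp_id.
Unshelve. all: by end_near. Qed.

(** Under rescaling the exponent converges to the first fundamental form. *)
Lemma cvg_zoomed h : zoomed (u n) x h @[n --> \oo] -->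
  A x * gauss2 (ffE sigma x) (ffF sigma x) (ffG sigma x) h.
Proof.
have H : A (y h n) * expR (- (8^-1 * (u n ^+ 2 * sdist2 x (y h n)))) @[n --> \oo] -->
    A x * expR (- (8^-1 * ff sigma x h.1 h.2)).
  apply: cvgM; first exact: cvg_zoom_A.
  apply: (@cvg_comp _ _ _ _ expR); last exact: continuous_expR.
  apply: cvgN; apply: cvgM; first exact: cvg_cst.
  exact: cvg_zoom_sdist2.
have -> : gauss2 (ffE sigma x) (ffF sigma x) (ffG sigma x) h = expR (- (8^-1 * ff sigma x h.1 h.2)).
  by rewrite /gauss2 /ff mulrC.
apply: cvg_trans H; apply: near_eq_cvg.
near=> n; have yI : I2 (y h n) by near: n; exact: zoom_I2.
rewrite /zoomed patchE mem_set// /wgauss -/(y h n); congr (_ * expR (- _)).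
by rewrite mulrA (mulrC 8^-1).
Unshelve. all: by end_near. Qed.

Lemma gauss_avg_cvg : gauss_avg (u n) x @[n --> \oo] --> A x * (8 * pi / Num.sqrt (gram x)).
Proof.
have xI' := sub_I2o xI; have [E0 G0] := ffEG_gt0 sigmaS xI'.
have [_ <-] := has_intZ (A x) measurableT (has_int_gauss2 G0 (gram_gt0 sigmaS xI')).
have [] := @dominated_has_int _ _ _ lebesgue_R2 setT (fun n => zoomed (u n) x) (fun n => gauss_avg (u n) x)
  (fun h => A x * gauss2 (ffE sigma x) (ffF sigma x) (ffG sigma x) h)
  (fun h => M * gauss2 c 0 c h) measurableT.
- by move=> n; exact: has_int_zoomed.
- by move=> h _; exact: cvg_zoomed.
- exact: integrable_zoomed_bound.
- by move=> n h _; exact: zoomed_le.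
by [].
Qed.

End Limit.
End Bound.

Lemma continuous_gram_clamp : continuous (gram \o clamp).
Proof.
have cont (B : R * R -> R) : {within Defs.I2, continuous B} -> forall z, B (clamp t) @[t --> z] --> B (clamp z).
  by move=> cB z; exact: within_continuous_clamp.
have C1 i : C1_on_I2 (s_ i) by have [] := sigmaS.
have ca i z : Ds (s_ i) (clamp t) @[t --> z] --> Ds (s_ i) (clamp z) by apply: cont; have [] := C1 i.
have cb i z : Dt (s_ i) (clamp t) @[t --> z] --> Dt (s_ i) (clamp z) by apply: cont; have [] := C1 i.
have cE : continuous (fun z => \sum_i Ds (s_ i) (clamp z) ^+ 2).
  by move=> z; apply: cvg_sumr => i; apply: cvgM; exact: ca.
have cF : continuous (fun z => \sum_i Ds (s_ i) (clamp z) * Dt (s_ i) (clamp z)).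
  by move=> z; apply: cvg_sumr => i; apply: cvgM; [exact: ca|exact: cb].
have cG : continuous (fun z => \sum_i Dt (s_ i) (clamp z) ^+ 2).
  by move=> z; apply: cvg_sumr => i; apply: cvgM; exact: cb.
move=> z; exact: (cvgB (cvgM (cE z) (cG z)) (cvgM (cF z) (cF z))).
Qed.

(** The Gaussian averages converge at each point of the open square and are
    uniformly bounded, so they may be integrated against [A]. *)
Lemma laplace (u : nat -> R) (v : nat -> R) : (forall n, 0 < u n) -> u @ \oo --> +oo ->
  (forall n, has_int lebesgue_R2 I2 (fun x => A x * gauss_avg (u n) x) (v n)) ->
  v @ \oo --> 8 * pi * int_I2 (fun x => A x ^+ 2 / Num.sqrt (gram x)).
Proof.
move=> u0 uoo hv; have [c c0 lower] := global_lower sigmaS.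
have [] := @dominated_has_int _ _ _ lebesgue_R2 I2o (fun n x => A x * gauss_avg (u n) x) v
  (fun x => A x * (A x * (8 * pi / Num.sqrt (gram x)))) (fun=> M * (M * (8 * pi / c)))
  measurable_I2o (fun n => has_int_I2o (hv n)).
- by move=> x xI; apply: cvgM; [exact: cvg_cst|exact: (gauss_avg_cvg c0)].
- apply: integrableS (@integrable_I2 _ (fun=> M * (M * (8 * pi / c))) `|M * (M * (8 * pi / c))| _ _) => //.
  + exact: measurable_I2.
  + exact: measurable_I2o.
  + exact: sub_I2o.
- move=> n x /sub_I2o xI; rewrite normrM; apply: ler_pM => //.
    by rewrite ger0_norm ?A0 ?AM.
  exact: (gauss_avg_le c0).
move=> [hi _] cv.
suff E : 8 * pi * int_I2 (fun x => A x ^+ 2 / Num.sqrt (gram x)) =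
  \int[lebesgue_R2]_(x in I2o) (A x * (A x * (8 * pi / Num.sqrt (gram x)))) by rewrite E.
pose f x := A x * (A x * (8 * pi / Num.sqrt (gram x))).
have mN : measurable (I2 `\` I2o : set plane).
  by apply: measurableD; [exact: measurable_I2|exact: measurable_I2o].
have DN : I2 `\` (I2 `\` I2o) = I2o by rewrite setDD setIidr//; exact: sub_I2o.
have mg : measurable_fun I2 (fun x => (Num.sqrt (gram x))^-1).
  apply: (eq_measurable_fun (fun x => (Num.sqrt (gram (clamp x)))^-1)).
    by move=> x /set_mem xI; rewrite clamp_id.
  apply: measurable_funTS; apply: continuous_plane_measurable => z.
  apply: cvgV; first by rewrite sqrtr_eq0 -ltNge (gram_gt0 sigmaS)//; exact: clamp_I2.
  apply: (@cvg_comp _ _ _ _ Num.sqrt); last exact: sqrt_continuous.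
  exact: continuous_gram_clamp.
have mA : measurable_fun I2 A by exact: within_continuous_measurable.
have fi : lebesgue_R2.-integrable I2 (EFin \o f).
  apply/(negligible_integrable mN measurable_I2 _ lebesgue_boundary); last by rewrite DN.
  apply/measurable_EFinP; apply: measurable_funM => //; apply: measurable_funM => //.
  by apply: measurable_funM.
rewrite /Rintegral -[in RHS]DN -(negligible_integral mN measurable_I2 fi lebesgue_boundary).
have [_ <-] : has_int lebesgue_R2 I2 (fun x => 8 * pi * (A x ^+ 2 / Num.sqrt (gram x)))
   (8 * pi * int_I2 (fun x => A x ^+ 2 / Num.sqrt (gram x))).
  have pi80 : 8 * pi != 0 :> R by rewrite mulf_neq0// gt_eqF// pi_gt0.
  have h : has_int lebesgue_R2 I2 f (\int[lebesgue_R2]_(x in I2) f x) by split.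
  have := has_intZ (8 * pi)^-1 measurable_I2 h.
  move=> h2; apply: has_intZ; first exact: measurable_I2.
  split=> //; apply: eq_integrable h2.1; first exact: measurable_I2.
  move=> x xI; rewrite /= /f; congr EFin.
  by move: (pi : R) pi80 (A x) (Num.sqrt (gram x))^-1 => p p0 a r; field; move: p0; rewrite mulf_eq0 negb_or => /andP[].
transitivity (\int[lebesgue_R2]_(x in I2) f x); last by [].
by apply: eq_Rintegral => x _; rewrite /f; ring.
Qed.

End Laplace.

(** * Characteristic functions of Gaussian variables *)

Section GaussianLaw.
Context {R : realType}.
Local Notation leb := (@lebesgue_measure R).

(** The density is the Radon-Nikodym derivative almost everywhere. *)
Lemma integral_normal_prob (s : R) (f : R -> \bar R) :
  (normal_prob 0 s).-integrable setT f ->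
  (\int[normal_prob 0 s]_x f x = \int[leb]_x (f x * (normal_pdf 0 s x)%:E))%E.
Proof.
move=> fi; have dom := normal_prob_dominates 0 s.
rewrite -(Radon_Nikodym_change_of_variables dom measurableT fi).
have mf := measurable_int _ fi.
have mp : measurable_fun setT (fun x => (normal_pdf 0 s x)%:E).
  by apply/measurable_EFinP; exact: measurable_normal_pdf.
apply: ae_eq_integral => //.
- by apply: emeasurable_funM => //; apply: measurable_int; exact: Radon_Nikodym_integrable.
- exact: emeasurable_funM.
apply: ae_eqe_mul2l; apply: integral_ae_eq => //.
  exact: Radon_Nikodym_integrable.
by move=> A _ mA; rewrite -Radon_Nikodym_integral.
Qed.

(** The substitution [x = sqrt 2 * s * y] reduces the normal density to the
    standard Gaussian. *)
Lemma has_int_normal_gauss (s a : R) (f : R -> R) : 0 < s ->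
  has_int leb setT (fun x => f (Num.sqrt 2 * s * x) * gauss_fun x) a ->
  has_int leb setT (fun x => f x * normal_pdf 0 s x) (a / Num.sqrt pi).
Proof.
move=> s0 ha; have r2 : 0 < Num.sqrt 2 :> R by rewrite sqrtr_gt0.
have b0 : 0 < Num.sqrt 2 * s by rewrite mulr_gt0.
have bn : (Num.sqrt 2 * s)^-1 != 0 by rewrite invr_eq0 gt_eqF.
have sp0 : 0 < Num.sqrt pi :> R by rewrite sqrtr_gt0 pi_gt0.
have := has_intZ (Num.sqrt 2 * s * Num.sqrt pi)^-1 measurableT (has_int_affine 0 bn ha).
apply: eq_has_int => // [x _|]; last first.
  rewrite gtr0_norm ?invr_gt0// invrK; move: (Num.sqrt pi) (Num.sqrt 2) sp0 r2 => p r p0 r0.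
  by field; rewrite !gt_eqF.
rewrite normal_pdfE ?gt_eqF// /normal_peak /normal_fun /gauss_fun !addr0 mulVKf ?gt_eqF// subr0.
have -> : Num.sqrt (s ^+ 2 * pi *+ 2) = Num.sqrt 2 * s * Num.sqrt pi.
  rewrite -[_ *+ 2]mulr_natl sqrtrM// sqrtrM ?sqr_ge0// sqrtr_sqr gtr0_norm//; ring.
rewrite mulrCA; congr (_ * (_ * expR _)).
by rewrite exprMn exprVn exprMn sqr_sqrtr// -[_ ^+ 2 *+ 2]mulr_natl mulNr mulrC.
Qed.

Lemma has_int_cos_normal (s k : R) : 0 < s ->
  has_int leb setT (fun x => cos (k * x) * normal_pdf 0 s x) (expR (- (1 / 2) * (k ^+ 2 * s ^+ 2))).
Proof.
move=> s0; have sp0 : 0 < Num.sqrt pi :> R by rewrite sqrtr_gt0 pi_gt0.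
have h := has_int_cos_gauss (k * (Num.sqrt 2 * s)).
apply: (eq_has_int measurableT) (@has_int_normal_gauss s _ (fun x => cos (k * x)) s0 _) => //; last first.
  by apply: (eq_has_int measurableT) h => // x _; rewrite !mulrA.
rewrite mulrC mulKf ?gt_eqF//; congr expR.
by rewrite !exprMn sqr_sqrtr//; field.
Qed.

Lemma has_int_sin_normal (s k : R) : 0 < s ->
  has_int leb setT (fun x => sin (k * x) * normal_pdf 0 s x) 0.
Proof.
move=> s0; have h := has_int_sin_gauss (k * (Num.sqrt 2 * s)).
apply: (eq_has_int measurableT) (@has_int_normal_gauss s _ (fun x => sin (k * x)) s0 _) => //; last first.
  by apply: (eq_has_int measurableT) h => // x _; rewrite !mulrA.
by rewrite mul0r.
Qed.

Section Law.
Context d (T : measurableType d) (P : probability T R) (X : T -> R) (v : R).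
Hypothesis mX : measurable_fun setT X.
Hypothesis v0 : 0 <= v.
Hypothesis lawX : forall A : set R, measurable A -> P (X @^-1` A) = centred_gaussian v A.

Lemma integrable_bounded (g : R -> R) : measurable_fun setT g -> (forall x, `|g x| <= 1) ->
  forall d' (T' : measurableType d') (Q : probability T' R) (Y : T' -> R), measurable_fun setT Y ->
  Q.-integrable setT (fun t => (g (Y t))%:E).
Proof.
move=> mg g1 d' T' Q Y mY; apply: measurable_bounded_integrable => //.
- by rewrite (@le_lt_trans _ _ 1%E)// ?ltry// probability_le1.
- exact: measurableT_comp.
- exists 1; split; first exact: num_real.
  by move=> N N1 t _; apply: le_trans (g1 _) (ltW N1).
Qed.

(** Integrals under [P] are integrals under the law, which has no density when
    the variance vanishes. *)
Lemma Rintegral_law (g : R -> R) a : measurable_fun setT g -> (forall x, `|g x| <= 1) ->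
  (v = 0 -> g 0 = a) ->
  (0 < v -> has_int leb setT (fun x => g x * normal_pdf 0 (Num.sqrt v) x) a) ->
  \int[P]_t g (X t) = a.
Proof.
move=> mg g1 g0 gn; rewrite /Rintegral.
have mgE : measurable_fun setT (EFin \o g) by exact/measurable_EFinP.
have giX := integrable_bounded mg g1 P mX.
have := @integral_pushforward _ _ T (measurableTypeR R) _ X mX P setT (EFin \o g) mgE giX measurableT.
rewrite preimage_setT => <-.
have [vE|vN] := eqVneq v 0.
  transitivity (fine (\int[\d_(0%R : measurableTypeR R)]_y (EFin \o g) y)%E).
    congr fine; apply: eq_measure_integral => A mA _.
    by apply: etrans (lawX mA) _; rewrite /centred_gaussian vE eqxx.
  by rewrite integral_dirac// diracT mul1e /= g0.
have vp : 0 < v by rewrite lt_def vN.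
transitivity (fine (\int[normal_prob 0%R (Num.sqrt v)]_y (EFin \o g) y)%E).
  congr fine; apply: eq_measure_integral => A mA _.
  by apply: etrans (lawX mA) _; rewrite /centred_gaussian (negbTE vN).
rewrite integral_normal_prob; last first.
  exact: (@integrable_bounded _ mg g1 _ _ (normal_prob 0 (Num.sqrt v)) id).
under eq_integral do rewrite -EFinM.
by rewrite (has_int_EFin measurableT (gn vp)).
Qed.

Lemma measurable_cosM k : measurable_fun setT (fun x : R => cos (k * x)).
Proof.
apply: measurableT_comp; last exact: measurable_funM.
by apply: continuous_measurable_fun; exact: continuous_cos.
Qed.

Lemma measurable_sinM k : measurable_fun setT (fun x : R => sin (k * x)).
Proof.
apply: measurableT_comp; last exact: measurable_funM.
by apply: continuous_measurable_fun; exact: continuous_sin.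
Qed.

Lemma cos_le_norm (x : R) : `|cos x| <= 1.
Proof. by rewrite ler_norml cos_geN1 cos_le1. Qed.

Lemma sin_le_norm (x : R) : `|sin x| <= 1.
Proof. by rewrite ler_norml sin_geN1 sin_le1. Qed.

(** The real and imaginary parts are the cosine and sine transforms of the law;
    the latter vanishes by symmetry. *)
Lemma characteristic_function (k : R) :
  cintegrable P (fun t => cexpi (k * X t)) /\
  cintegral P (fun t => cexpi (k * X t)) = (expR (- (1 / 2) * (k ^+ 2 * v)))%:C%C.
Proof.
have mc := measurable_cosM k; have ms := measurable_sinM k.
split.
  split; rewrite /cexpi/=.
    exact: (integrable_bounded mc (fun x => cos_le_norm _)).
  exact: (integrable_bounded ms (fun x => sin_le_norm _)).
rewrite /cintegral /cexpi/=; congr (_ +i* _)%C.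
  apply: (Rintegral_law mc) => [x|->|vp]; first exact: cos_le_norm.
    by rewrite !mulr0 cos0 expR0.
  by have := has_int_cos_normal k (_ : 0 < Num.sqrt v); rewrite sqr_sqrtr//; apply; rewrite sqrtr_gt0.
apply: (Rintegral_law ms) => [x|_|vp]; first exact: sin_le_norm.
  by rewrite mulr0 sin0.
by apply: has_int_sin_normal; rewrite sqrtr_gt0.
Qed.

End Law.

End GaussianLaw.

(** * The area density *)

Section Indices.

Lemma fst4_neq_snd4 ab : snd4 ab != fst4 ab.
Proof. by have := valP ab; rewrite /fst4 /snd4 ltn_neqAle eq_sym => /andP[]. Qed.

Lemma sum_split4 (V : nmodType) (F : 'I_4 -> V) ab :
  \sum_i F i = F (fst4 ab) + F (snd4 ab) + \sum_(i <- rest4 ab) F i.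
Proof.
rewrite (bigD1 (fst4 ab))//= (bigD1 (snd4 ab))/=; last exact: fst4_neq_snd4.
by rewrite addrA /rest4 big_filter big_enum_cond.
Qed.

Lemma size_rest4 ab : size (rest4 ab) = 2%N.
Proof.
have := sum_split4 (fun=> 1%N) ab.
rewrite sum1_card card_ord sum1_size.
by move=> h; lia.
Qed.

Lemma sum_split_pairs (V : nmodType) (F : 'I_4 -> V) ab : \sum_i F i =
  F (fst4 ab) + F (snd4 ab) + (F (cofst4 ab) + F (cosnd4 ab)).
Proof.
rewrite (sum_split4 F ab) /cofst4 /cosnd4; have := size_rest4 ab.
case: (rest4 ab) => [|c [|d [|]]]//= _.
by rewrite !big_cons big_nil addr0.
Qed.

End Indices.

Section Density.
Context {R : realType}.
Variables (sigma : R * R -> 'rV[R]_4).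
Local Notation a_ i := (Ds (Defs.coord sigma i)).
Local Notation b_ i := (Dt (Defs.coord sigma i)).

Lemma det2 (F : comNzRingType) (N : 'M[F]_2) : \det N = N 0 0 * N 1 1 - N 0 1 * N 1 0.
Proof.
rewrite (expand_det_row _ 0) !big_ord_recl big_ord0 addr0 /cofactor !det_mx11 !mxE/=.
rewrite expr0 mul1r expr1 mulN1r mulrN; congr (_ * N _ _ - N _ _ * N _ _);
  by apply: val_inj.
Qed.

Lemma detJ i j x : \det (Jmx sigma i j x) = a_ i x * b_ j x - b_ i x * a_ j x.
Proof. by rewrite det2 !mxE. Qed.

Lemma absJE ab x : absJ sigma ab x =
  `|a_ (fst4 ab) x * b_ (snd4 ab) x - b_ (fst4 ab) x * a_ (snd4 ab) x|.
Proof. by rewrite /absJ detJ. Qed.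

(** Splitting the rows of the Jacobian as those of [J_ab] and [J_cd] exhibits
    [J_ab^T (1 + W^T W) J_ab = J_ab^T J_ab + J_cd^T J_cd] as the matrix of the
    first fundamental form. *)
Lemma rho_absJ ab x : 0 < gram sigma x ->
  rho sigma ab x * absJ sigma ab x = absJ sigma ab x ^+ 2 / Num.sqrt (gram sigma x).
Proof.
move=> g0; rewrite /rho /absJ; set J := Jmx sigma (fst4 ab) (snd4 ab) x.
set K := Jmx sigma (cofst4 ab) (cosnd4 ab) x.
have [J0|J0] := eqVneq (\det J) 0; first by rewrite J0 normr0 mulr0 expr0n mul0r.
have uJ : J \in unitmx by rewrite unitmxE unitfE.
have E : \det (1%:M + (Wmx sigma ab x)^T *m Wmx sigma ab x) * \det J ^+ 2 = gram sigma x.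
  rewrite expr2 mulrCA -{1}(det_tr J) -!det_mulmx mulmxDl mul1mx mulmxDr.
  rewrite /Wmx -/J -/K trmx_mul !mulmxA -trmx_mul -!mulmxA mulVmx// mulmx1.
  rewrite trmx1 mul1mx.
  rewrite det2 /gram /ffE /ffF /ffG !(sum_split_pairs _ ab) !mxE !big_ord_recl !big_ord0 !mxE/=.
  ring.
have W0 : 0 < \det (1%:M + (Wmx sigma ab x)^T *m Wmx sigma ab x).
  by rewrite -(pmulr_lgt0 _ (_ : 0 < \det J ^+ 2)) ?E// lt_def sqrf_eq0 J0 sqr_ge0.
rewrite -E sqrtrM ?ltW// sqrtr_sqr.
have s0 : Num.sqrt (\det (1%:M + (Wmx sigma ab x)^T *m Wmx sigma ab x)) != 0.
  by rewrite gt_eqF// sqrtr_gt0.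
have j0 : `|\det J| != 0 by rewrite normr_eq0.
move: (Num.sqrt _) s0 (`|\det J|) j0 => s s0 j j0.
by field; rewrite s0 j0.
Qed.

End Density.

(** * The Wilson surface observable *)

Section Wilson.
Context {R : realType}.
Local Notation plane := (measurableTypeR R * measurableTypeR R)%type.
Local Notation I2 := (@I2 R : set plane).
Variables (S : set 'rV[R]_4) (sigma : R * R -> 'rV[R]_4).
Hypothesis sigmaS : parametrization S sigma.
Local Notation s_ i := (Defs.coord sigma i).

Lemma absJ_continuous ab : {within I2, continuous (absJ sigma ab)}.
Proof.
have C1 i : C1_on_I2 (s_ i) by have [] := sigmaS.
have ca i z : Ds (s_ i) (clamp t) @[t --> z] --> Ds (s_ i) (clamp z).
  by apply: within_continuous_clamp; have [] := C1 i.
have cb i z : Dt (s_ i) (clamp t) @[t --> z] --> Dt (s_ i) (clamp z).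
  by apply: within_continuous_clamp; have [] := C1 i.
pose a := fst4 ab; pose b := snd4 ab.
pose f z := `|Ds (s_ a) (clamp z) * Dt (s_ b) (clamp z) - Dt (s_ a) (clamp z) * Ds (s_ b) (clamp z)|.
have cf : continuous f.
  by move=> z; exact: (cvg_norm (cvgB (cvgM (ca a z) (cb b z)) (cvgM (cb a z) (ca b z)))).
apply: (@subspace_eq_continuous _ _ _ f); last exact: continuous_subspaceT.
by move=> x /set_mem xI; rewrite /f clamp_id//; exact: (esym (absJE _ _ _)).
Qed.

Lemma absJ_bounded : exists M, forall ab x, I2 x -> absJ sigma ab x <= M.
Proof.
have H ab : exists M, forall x, I2 x -> `|absJ sigma ab x| <= M.
  by have [M _ MP] := within_continuous_bounded (@absJ_continuous ab); exists M.
have [M MP] := choice H.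
exists (\sum_ab `|M ab|) => ab x xI.
apply: le_trans (ler_norm _) _; apply: le_trans (MP ab x xI) _.
by rewrite (bigD1 ab)//= -[leLHS]addr0 lerD ?ler_norm// sumr_ge0.
Qed.

Lemma coord_bounded : exists2 r, 0 <= r & forall i x, I2 x -> `|s_ i x| <= r.
Proof.
have H i : exists M, forall x, I2 x -> `|s_ i x| <= M.
  have C1 : C1_on_I2 (s_ i) by have [] := sigmaS.
  by have [M _ MP] := within_continuous_bounded (C1_continuous C1); exists M.
have [M MP] := choice H.
exists (\sum_i `|M i|); first exact: sumr_ge0.
move=> i x xI; apply: le_trans (MP i x xI) _.
by rewrite (bigD1 i)//= -[leLHS]addr0 lerD ?ler_norm// sumr_ge0.
Qed.

Definition scaled (k : R) : plane -> 'rV[R]_4 := fun x => (k / 2) *: sigma x.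
Definition weight (k : R) (ab : pair4) : plane -> R := fun x => k / 4 * absJ sigma ab x.

Lemma psi_gt0 (w : 'rV[R]_4) : 0 < psi w.
Proof. by rewrite divr_gt0 ?expR_gt0// sqrtr_gt0 mulr_gt0// pi_gt0. Qed.

Lemma psi_le (w : 'rV[R]_4) : psi w <= (Num.sqrt (2 * pi))^-1.
Proof.
rewrite /psi ler_piMl ?invr_ge0 ?sqrtr_ge0// -expR0 ler_expR.
by rewrite mulNr oppr_le0 divr_ge0// sumr_ge0// => i _; exact: sqr_ge0.
Qed.

Lemma wilson_data k : 0 < k -> exists rho C, forall ab,
  bounded_data (scaled k) (xi_coef (weight k) (scaled k) ab) rho C.
Proof.
move=> k0; have [M MP] := absJ_bounded; have [r r0 rP] := coord_bounded.
have k20 : 0 <= k / 2 by rewrite divr_ge0// ltW.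
have k40 : 0 <= k / 4 by rewrite divr_ge0// ltW.
have mw i : measurable_fun I2 (fun x => scaled k x 0 i).
  rewrite (_ : (fun x => _) = fun x => k / 2 * s_ i x).
    apply: measurable_funM => //; exact: (measurable_coord sigmaS).
  by apply/funext => x; rewrite mxE.
exists (k / 2 * r), (k / 4 * M * (Num.sqrt (2 * pi))^-1) => ab; split=> //.
- apply: measurable_funM.
    apply: measurable_funM => //.
    exact: within_continuous_measurable (@absJ_continuous ab).
  apply: measurable_funM => //; apply: measurable_funM => //.
  apply: measurableT_comp => //; apply: measurable_funM => //.
  apply: measurableT_comp => //; apply: measurable_sum => i; exact: measurable_funX.
- exact: mulr_ge0.
- move=> x i xI; rewrite mxE normrM ger0_norm// ler_wpM2l//; exact: rP.
- move=> x xI; rewrite /xi_coef normrM (normrM (sgn ab)) /sgn normrX normrN1 expr1n mul1r.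
  rewrite (gtr0_norm (psi_gt0 _)) /weight normrM normr_id (ger0_norm k40).
  apply: ler_pM; [exact: mulr_ge0|exact/ltW/psi_gt0|by apply: ler_wpM2l => //; exact: MP|exact: psi_le].
Qed.

Section Kernel.
Variables (k rho C : R).
Hypothesis k0 : 0 < k.
Hypothesis bd : forall ab, bounded_data (scaled k) (xi_coef (weight k) (scaled k) ab) rho C.
Local Notation Y := (xi_integral (weight k) (scaled k)).

Lemma wilson_vectorE : wilson_vector sigma k = Y.
Proof. exact: sum_hilbert_int_xi bd. Qed.

(** One factor [k] of [k ^+ 2 / 4] stays outside; the rest is the weight of the
    vector whose norm appears in the theorem. *)
Lemma wilson_exponentE (B : BBtype R) : wilson_exponent sigma k B = k * sharp B Y.
Proof.
rewrite (sharp_xi_integral bd) mulr_sumr; apply: eq_bigr => ab _.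
have [_ <-] := has_intZ k measurable_I2 (has_int_sharp_xi bd B ab).
by apply: eq_int_I2 => x _; rewrite /weight /scaled; field.
Qed.

(** The two Gaussian factors [psi] complete the square in the reproducing kernel:
    [- |w|^2 / 2 - |w'|^2 / 2 + w . w' = - |w - w'|^2 / 2]. *)
Lemma xi_coef_kernel ab x x' :
  xi_coef (weight k) (scaled k) ab x * (xi_coef (weight k) (scaled k) ab x' *
     expR (\sum_i scaled k x 0 i * scaled k x' 0 i)) =
  k ^+ 2 / (32 * pi) * (absJ sigma ab x * wgauss sigma (absJ sigma ab) k x x').
Proof.
have pi0 : 0 < pi :> R by exact: pi_gt0.
have s2 : sgn ab * sgn ab = 1 :> R by rewrite /sgn -expr2 sqrr_sign.
have p2 : psi (scaled k x) * psi (scaled k x') * expR (\sum_i scaled k x 0 i * scaled k x' 0 i) =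
    expR (- (k ^+ 2 / 8 * sdist2 sigma x x')) / (2 * pi).
  have c0 : Num.sqrt (2 * pi) != 0 :> R by rewrite gt_eqF// sqrtr_gt0 mulr_gt0.
  have cc : Num.sqrt (2 * pi) ^+ 2 = 2 * pi :> R by rewrite sqr_sqrtr// mulr_ge0// ltW.
  have E (x1 x2 x3 c : R) : c != 0 -> x1 / c * (x2 / c) * x3 = x1 * x2 * x3 / c ^+ 2.
    by move=> c1; field.
  rewrite /psi E// cc -!expRD.
  congr (expR _ / _); rewrite -mulrDl -opprD /sdist2 mulNr addrC -big_split/=.
  rewrite mulr_sumr mulr_suml -sumrB -sumrN; apply: eq_bigr => i _.
  by rewrite !mxE /Defs.coord; field.
rewrite /xi_coef /wgauss /weight.
move: p2; set p := psi _; set p' := psi _; set e := expR (\sum_i _); set f := expR (- _).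
set A := absJ sigma ab x; set A' := absJ sigma ab x' => p2.
have -> : k / 4 * A * (sgn ab * p) * (k / 4 * A' * (sgn ab * p') * e) =
  (sgn ab * sgn ab) * (k ^+ 2 / 16 * A * A') * (p * p' * e) by field.
rewrite s2 p2; move: (pi : R) pi0 => q q0; field; by rewrite gt_eqF.
Qed.

Lemma has_int_gauss_avg ab : has_int lebesgue_R2 I2
  (fun x => absJ sigma ab x * gauss_avg sigma (absJ sigma ab) k x)
  (32 * pi * fock_ip (Y ab) (Y ab)).
Proof.
have [M MP] := absJ_bounded.
have A0 x : I2 x -> 0 <= absJ sigma ab x by move=> _; exact: normr_ge0.
apply: (eq_has_int measurable_I2) (has_intZ (32 * pi) measurable_I2 (has_int_xi_integral bd ab)) => // x _.
have p32 : 32 * pi != 0 :> R by rewrite mulf_neq0 ?gt_eqF ?pi_gt0.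
set w := scaled k; set g := xi_coef _ _ _.
have G : g x * int_I2 (fun x' => g x' * expR (\sum_i w x 0 i * w x' 0 i)) =
    k ^+ 2 / (32 * pi) * absJ sigma ab x * int_I2 (wgauss sigma (absJ sigma ab) k x).
  have hw := has_int_wgauss sigmaS (@absJ_continuous ab) A0 (MP ab) k x.
  have [Ax0|Ax0] := eqVneq (absJ sigma ab x) 0.
    have -> : g x = 0 by rewrite /g /xi_coef /weight Ax0 mulr0 mul0r.
    by rewrite Ax0 mulr0 !mul0r.
  have gx0 : g x != 0.
    apply: mulf_neq0; apply: mulf_neq0 => //; last by rewrite gt_eqF// psi_gt0.
      by rewrite gt_eqF// divr_gt0.
    by rewrite signr_eq0.
  have [_ h2] := has_intZ ((g x)^-1 * (k ^+ 2 / (32 * pi) * absJ sigma ab x)) measurable_I2 hw.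
  rewrite (eq_int_I2 (g := fun x' => (g x)^-1 * (k ^+ 2 / (32 * pi) * absJ sigma ab x) *
    wgauss sigma (absJ sigma ab) k x x')) => [|x' _].
    by rewrite /int_I2 h2 !mulrA divff// mul1r.
  apply: (mulfI gx0); rewrite xi_coef_kernel !mulrA divff// mul1r.
  by [].
rewrite G /gauss_avg; move: (pi : R) p32 => q q0; field.
by move: q0; rewrite mulf_eq0 negb_or => /andP[].
Qed.

End Kernel.

Lemma areaE : area sigma =
  \sum_(ab : pair4) int_I2 (fun x => absJ sigma ab x ^+ 2 / Num.sqrt (gram sigma x)).
Proof.
apply: eq_bigr => ab _; apply: eq_int_I2 => x xI.
exact/rho_absJ/(gram_gt0 sigmaS).
Qed.

(** Each component contributes [(32 pi)^-1 * 8 pi = 1/4] of its share of the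
    area. *)
Lemma wilson_norm_cvg :
  form_norm (wilson_vector sigma k) ^+ 2 @[k --> +oo] --> 4^-1 * area sigma.
Proof.
apply/cvg_pinftyP => u uoo.
(* the weak integrals are computed for positive parameters only *)
pose u1 n := Num.max 1 (u n).
have u10 n : 0 < u1 n by rewrite lt_max ltr01.
have u1oo : u1 @ \oo --> +oo.
  apply/cvgryPge => a; move/cvgryPge/(_ a): uoo; apply: filterS => n an.
  by rewrite le_max an orbT.
pose v ab n := fock_ip (xi_integral (weight (u1 n)) (scaled (u1 n)) ab)
                       (xi_integral (weight (u1 n)) (scaled (u1 n)) ab).
have [M MP] := absJ_bounded.
have pi0 : 0 < pi :> R by exact: pi_gt0.
have vP ab : v ab @ \oo --> 4^-1 * int_I2 (fun x => absJ sigma ab x ^+ 2 / Num.sqrt (gram sigma x)).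
  have A0 x : I2 x -> 0 <= absJ sigma ab x by move=> _; exact: normr_ge0.
  have h n : has_int lebesgue_R2 I2 (fun x => absJ sigma ab x * gauss_avg sigma (absJ sigma ab) (u1 n) x)
      (32 * pi * v ab n).
    by have [rho [C bd]] := wilson_data (u10 n); exact: has_int_gauss_avg (u10 n) bd ab.
  have cv := laplace sigmaS (@absJ_continuous ab) A0 (MP ab) u10 u1oo h.
  have -> : v ab = fun n => (32 * pi)^-1 * (32 * pi * v ab n).
    by apply/funext => n; rewrite mulKf// gt_eqF// mulr_gt0.
  set I := int_I2 _ in cv *.
  have -> : 4^-1 * I = (32 * pi)^-1 * (8 * pi * I).
    by move: (pi : R) pi0 => q q0; field; rewrite gt_eqF.
  by apply: cvgM; [exact: cvg_cst|exact: cv].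
rewrite areaE mulr_sumr.
apply: cvg_trans (cvg_sumr _ vP); apply: near_eq_cvg.
have : \forall n \near \oo, 1 <= u n by move/cvgryPge/(_ 1): uoo.
apply: filterS => n n1.
have -> : u n = u1 n by rewrite /u1 (max_idPr n1).
have [rho [C bd]] := wilson_data (u10 n).
by rewrite (wilson_vectorE bd) (xi_integral_norm bd).
Qed.

End Wilson.

Local Open Scope complex_scope.

Theorem theorem7p11 (R : realType) (S : set 'rV[R]_4)
    (sigma : R * R -> 'rV[R]_4)
    (mu : R -> probability (g_sigma_algebraType (BBopen R)) R)
    (flatS : flat_rectangle S)
    (sigmaS : parametrization S sigma)
    (mu_wiener : forall theta : R, 0 < theta -> is_wiener theta (mu theta)) :
  (forall k : R, 0 < k ->
     cintegrable (mu (k ^+ 2)) (fun B => cexpi (wilson_exponent sigma k B)) /\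
     cintegral (mu (k ^+ 2)) (fun B => cexpi (wilson_exponent sigma k B)) =
       (expR (- (1 / 2) * form_norm (wilson_vector sigma k) ^+ 2))%:C) /\
  expR (- (1 / 2) * form_norm (wilson_vector sigma k) ^+ 2) @[k --> +oo] -->
    expR (- (1 / 8) * area sigma).
Proof.
split=> [k k0|]; last first.
  have -> : - (1 / 8) * area sigma = - (1 / 2) * (4^-1 * area sigma) by field.
  apply: (@cvg_comp _ _ _ _ expR); last exact: continuous_expR.
  by apply: cvgM; [exact: cvg_cst|exact: wilson_norm_cvg sigmaS].
have [rho [C bd]] := wilson_data sigmaS k0.
have k20 : 0 < k ^+ 2 by rewrite exprn_gt0.
have dual := exp_type_dual (xi_integral_exp_type bd).
have [mX lawX] := mu_wiener _ k20 _ dual.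
have v0 : 0 <= form_norm (xi_integral (weight sigma k) (scaled sigma k)) ^+ 2 / k ^+ 2.
  by rewrite divr_ge0 ?sqr_ge0.
have := characteristic_function mX v0 lawX k.
rewrite (wilson_vectorE bd) [k ^+ 2 * _]mulrC divfK ?gt_eqF//.
rewrite (_ : (fun B => cexpi (wilson_exponent sigma k B)) =
  fun B => cexpi (k * sharp B (xi_integral (weight sigma k) (scaled sigma k))))//.
by apply/funext => B; rewrite (wilson_exponentE bd).
Qed.
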